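(* Let $k\ge1$. The $\mathfrak S_{k+1}$-cycle index of the $\mathfrak S_{k+1}$-species $\mathcal{CT}_k^{XY}$ is given, for $\sigma\in\mathfrak S_{k+1}$, by $$Z^{\mathfrak S_{k+1}}_{\mathcal{CT}^{XY}_k}(\sigma)=p_1[x]\cdot\prod_{c\in C(\sigma)}Z^{\mathfrak S_k}_{\mathcal{CT}^Y_k}\Big(\prod_{i\in c}\rho_i(\sigma)\Big)\big(p_{|c|}[x],p_{2|c|}[x],\dots;\,p_{|c|}[y],p_{2|c|}[y],\dots\big),$$ where $C(\sigma)$ is the set of cycles of $\sigma$ as a permutation of $[k+1]$ (fixed points included) and the product $\prod_{i\in c}\rho_i(\sigma)$ is taken in order with respect to any choice of linearization of the cyclic order of the elements of $c$.
   Context: **$k$-coding trees.** A $k$-coding tree is a finite tree with vertices colored black and white, each edge joining a black and a white vertex, in which every black vertex has exactly $k+1$ (white) neighbors and carries a cyclic ordering of them (white vertices may have any number of black neighbors; a single white vertex is allowed). Black vertices are labeled by sort $X$ and white vertices by sort $Y$. $\mathcal{CT}_k^Y$ and $\mathcal{CT}_k^{XY}$ are the two-sort species of $k$-coding trees rooted at a white vertex and at an edge. **Actions.** $\mathfrak S_m$ is the symmetric group on $[m]=\{1,\dots,m\}$ and $\mathfrak S_k\subset\mathfrak S_{k+1}$ is the subgroup fixing $k+1$. For $\sigma\in\mathfrak S_{k+1}$, $i\in[k+1]$, let $\rho_i(\sigma)\in\mathfrak S_{k+1}$ be $a\mapsto\sigma(i+a)-\sigma(i)$, with sums and differences reduced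 modulo $k+1$ to representatives in $\{1,\dots,k+1\}$; $\rho_i(\sigma)$ fixes $k+1$, so lies in $\mathfrak S_k$. In a $\mathcal{CT}^Y_k$-structure, the cyclic order at each black vertex is linearized by putting its parent (the neighbor toward the root) last, in position $k+1$. Thus a $\mathcal{CT}_k^Y$-structure is a root label $y$ together with a set of structures $(x;W_1,\dots,W_k)$, with $x$ a black label and the $W_i$ $\mathcal{CT}_k^Y$-structures. Recursively, $\sigma\in\mathfrak S_k$ acts on a $\mathcal{CT}_k^Y$-structure by fixing $y$ and replacing each $(x;W_1,\dots,W_k)$ by $(x;W'_1,\dots,W'_k)$ with $W'_{\sigma(i)}=\rho_i(\sigma)\cdot W_i$. A $\mathcal{CT}^{XY}_k$-structure is written $(x;W_1,\dots,W_{k+1})$ with $x$ the root black vertex, the $W_i$ $\mathcal{CT}_k^Y$-structures and the white vertex of the root edge being the root of $W_{k+1}$; $\sigma\in\mathfrak S_{k+1}$ sends it to $(x;W'_1,\dots,W'_{k+1})$ with $W'_{\sigma(i)}=\rho_i(\sigma)\cdot W_i$. These actions commute with relabeling. **Ordered product.** If $c=(c_1,c_2,\dots,c_m)$ with $\sigma(c_j)=c_{j+1}$ (indices cyclic), the product is the composition $\rho_{c_m}(\sigma)\circ\cdots\circ\rho_{c_2}(\sigma)\circ\rho_{c_1}(\sigma)$. **$\Gamma$-cycle index.** For a two-sort species $F$ with an action of a group $\Gamma$ commuting with relabelings (a $\Gamma$-species) and $\gamma\in\Gamma$, $$Z^\Gamma_F(\gamma)=\sum_{m,n\ge0}\frac1{m!\,n!}\sum_{\mu\in\mathfrak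 S_m,\nu\in\mathfrak S_n}\left|\mathrm{Fix}(\gamma\cdot F[\mu,\nu])\right|p_\mu[x]\,p_\nu[y],$$ with $p_\mu[x]=\prod_i p_i[x]^{\mu_i}$, $\mu_i$ the number of $i$-cycles of $\mu$ (similarly for $y$). The notation $Z(\gamma)(p_m[x],p_{2m}[x],\dots;p_m[y],p_{2m}[y],\dots)$ means substituting $p_{jm}$ for $p_j$ in both sets of variables. *)

(* Defs.v *)
From mathcomp Require Import all_boot all_algebra fingroup perm finmap.
From mathcomp Require Import boolp classical_sets fsbigop.
From mathcomp.multinomials Require Import monalg.

Set Implicit Arguments.
Unset Strict Implicit.
Unset Printing Implicit Defensive.

Import GRing.Theory.
Local Open Scope ring_scope.

(* Black vertices have labels in X, white vertices have labels in Y.  The first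
   component gives the neighbours of each black vertex, the second one the
   successor function of the cyclic order on these neighbours. *)
Definition coding_data (X Y : finType) : finType :=
  ({ffun X -> {set Y}} * {ffun X -> {ffun Y -> Y}})%type.

Section CodingTrees.
Variables (X Y : finType).
Implicit Types (T : coding_data X Y) (x b : X) (y r w : Y).

Definition nbrs T x : {set Y} := T.1 x.
Definition next_nbr T x : {ffun Y -> Y} := T.2 x.

Definition adj T : rel (X + Y) := fun u v =>
  match u, v with
  | inl x, inr y => y \in nbrs T x
  | inr y, inl x => y \in nbrs T x
  | _, _ => false
  end.

Definition is_tree (V : finType) (e : rel V) : Prop :=
  (forall u v, connect e u v) /\
  (forall c : seq V, uniq c -> path.cycle e c -> (size c <= 2)%N).

(* f is the identity off N, so that a cyclic order has only one encoding. *)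
Definition cyclic_order (N : {set Y}) (f : {ffun Y -> Y}) : Prop :=
  (forall y, y \notin N -> f y = y) /\ (forall y, y \in N -> orbit f y =i N).

Definition is_coding_tree (k : nat) T : Prop :=
  [/\ is_tree (adj T), forall x, #|nbrs T x| = k.+1
    & forall x, cyclic_order (nbrs T x) (next_nbr T x)].

Definition remove T (u : X + Y) : rel (X + Y) :=
  fun v v' => [&& adj T v v', v != u & v' != u].

(* The neighbour of a vertex in the direction of another vertex v: the one
   still connected to v once the vertex is removed.  The default values are
   irrelevant in a tree. *)
Definition white_towards T x (v : X + Y) (dflt : Y) : Y :=
  odflt dflt [pick w in nbrs T x | connect (remove T (inl x)) (inr w) v].

Definition black_towards T y x : X :=
  odflt x [pick b | (y \in nbrs T b) &&
                    connect (remove T (inr y)) (inl b) (inl x)].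

End CodingTrees.

Section Action.
Variable k : nat.
Local Notation pos := 'I_k.+1.

(* The positions 1, ..., k+1 are represented by their residues modulo k+1, with
   the addition of 'I_k.+1 as a cyclic group: k+1 is represented by 0, and the
   subgroup of permutations fixing k+1 by the stabilizer of 0. *)
Lemma rho_subproof (s : 'S_k.+1) (i : pos) :
  injective (fun a : pos => s (i + a) - s i).
Proof. by move=> a b /addIr /perm_inj /addrI. Qed.

Definition rho (i : pos) (s : 'S_k.+1) : 'S_k.+1 := perm (@rho_subproof s i).

Section Labels.
Variables (X Y : finType).
Implicit Types (T : coding_data X Y) (x b : X) (y r w p : Y) (s t : 'S_k.+1).

(* The cyclic order at x is linearized so that p is in position k+1, that is 0:
   the neighbour in position i is the i-th successor of p. *)
Definition nbr_at T x p (i : pos) : Y := iter i (next_nbr T x) p.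

Definition pos_of T x p y : pos := odflt 0 [pick i | nbr_at T x p i == y].

(* The cyclic order at x in which the neighbour formerly in position i is in
   position t i, for all i. *)
Definition permute_nbrs T x p t : {ffun Y -> Y} :=
  [ffun y => if y \in nbrs T x
             then nbr_at T x p ((t^-1)%g (ordS (t (pos_of T x p y))))
             else y].

(* The action keeps the underlying graph and only modifies the cyclic orders.
   local_perm n T r s x is the permutation by which the recursive action of s
   on T rooted at r acts at the black vertex x: it is s if x is a child of r;
   otherwise x is in the i-th subtree W_i of a child b of r, on which rho_i(s)
   acts; W_i is rooted at the white neighbour w of b in position i.
   A recursion depth n = #|X| reaches all black vertices. *)
Fixpoint local_perm (n : nat) T r s x : 'S_k.+1 :=
  let b := black_towards T r x in
  if b == x then s else
  if n is n'.+1 then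
    let w := white_towards T b (inl x) r in
    local_perm n' T w (rho (pos_of T b r w) s) x
  else s.

Definition CTY_data : finType := (coding_data X Y * Y)%type.

Definition CTY : {set CTY_data} := [set S | `[< is_coding_tree k S.1 >]].

(* This is an action of the permutations s with s 0 = 0 only. *)
Definition act_CTY s (S : CTY_data) : CTY_data :=
  let: (T, r) := S in
  ((T.1, [ffun x => permute_nbrs T x (white_towards T x (inr r) r)
                                 (local_perm #|X| T r s x)]), r).

Definition CTXY_data : finType := (coding_data X Y * (X * Y))%type.

Definition CTXY : {set CTXY_data} :=
  [set S | `[< is_coding_tree k S.1 >] & S.2.2 \in nbrs S.1 S.2.1].

(* In a pair (x0, w0), x0 is the root black vertex and w0 the white vertex of
   the root edge.  For x != x0 the subtree W_i containing x is rooted at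
   w = nbr_at T x0 w0 i.  The root of the new W'_(k+1) is that of W_i with s i = k+1. *)
Definition act_CTXY s (S : CTXY_data) : CTXY_data :=
  let: (T, (x0, w0)) := S in
  ((T.1, [ffun x =>
     if x == x0 then permute_nbrs T x0 w0 s else
     let w := white_towards T x0 (inl x) w0 in
     permute_nbrs T x (white_towards T x (inr w) w)
                  (local_perm #|X| T w (rho (pos_of T x0 w0 w) s) x)]),
   (x0, nbr_at T x0 w0 ((s^-1)%g 0))).

Definition relabel (mu : {perm X}) (nu : {perm Y}) T : coding_data X Y :=
  ([ffun x => nu @: nbrs T ((mu^-1)%g x)],
   [ffun x => [ffun y => nu (next_nbr T ((mu^-1)%g x) ((nu^-1)%g y))]]).

Definition relabel_CTY (mu : {perm X}) (nu : {perm Y}) (S : CTY_data)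
  : CTY_data := (relabel mu nu S.1, nu S.2).

Definition relabel_CTXY (mu : {perm X}) (nu : {perm Y}) (S : CTXY_data)
  : CTXY_data := (relabel mu nu S.1, (mu S.2.1, nu S.2.2)).

End Labels.
End Action.

(* Formal power series over rat in the variables p_i[x], indexed by inl i, and
   p_i[y], indexed by inr i, for i >= 1 (the variables of index 0 do not occur in
   cycle indices): a series is its family of coefficients.  The sums over
   classical sets in mul_series, cycle_index and dilate l, for l >= 1, have
   finite support. *)
Definition pmonom : choiceType := {cmonom (nat + nat)%type}.
Definition pseries : Type := pmonom -> rat.

Definition monom_series (e : pmonom) : pseries := fun e' => (e' == e)%:R.

Definition mul_series (f g : pseries) : pseries := fun e =>
  \sum_(ab \in [set ab : pmonom * pmonom | mmul ab.1 ab.2 = e]%classic)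
    f ab.1 * g ab.2.

(* The monomial obtained by substituting p_(j * l) for p_j. *)
Definition dilate_monom (l : nat) (e : pmonom) : pmonom :=
  \big[mmul/mone]_(v <- finsupp e)
    expcmn (ucm (match v with inl j => inl (j * l)%N | inr j => inr (j * l)%N end))
           (e v).

Definition dilate (l : nat) (f : pseries) : pseries := fun e =>
  \sum_(e' \in [set e' | dilate_monom l e' = e]%classic) f e'.

Definition num_cycles (n : nat) (mu : 'S_n) (i : nat) : nat :=
  #|[set c in porbits mu | #|c| == i]|.

Definition cycle_monom (m n : nat) (mu : 'S_m) (nu : 'S_n) : pmonom :=
  mmul (\big[mmul/mone]_(1 <= i < m.+1) expcmn (ucm (inl i)) (num_cycles mu i))
       (\big[mmul/mone]_(1 <= i < n.+1) expcmn (ucm (inr i)) (num_cycles nu i)).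

(* The structures on the label sets [m] and [n] are the elements of F m n; rel
   is their relabeling and act the action of the group element at which the
   cycle index is taken. *)
Definition cycle_index (D : nat -> nat -> finType) (F : forall m n, {set D m n})
    (rel : forall m n, 'S_m -> 'S_n -> D m n -> D m n)
    (act : forall m n, D m n -> D m n) : pseries := fun e =>
  \sum_(mn \in [set: nat * nat]%classic)
    ((mn.1`! * mn.2`!)%:R^-1 *
     \sum_(mu : 'S_mn.1) \sum_(nu : 'S_mn.2)
       #|[set S in F mn.1 mn.2 | act _ _ (rel _ _ mu nu S) == S]|%:R *
       monom_series (cycle_monom mu nu) e).

Definition Z_CTY (k : nat) (s : 'S_k.+1) : pseries :=
  @cycle_index (fun m n => CTY_data 'I_m 'I_n) (fun m n => CTY k 'I_m 'I_n)
    (fun m n => @relabel_CTY 'I_m 'I_n) (fun m n => @act_CTY k 'I_m 'I_n s).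

Definition Z_CTXY (k : nat) (s : 'S_k.+1) : pseries :=
  @cycle_index (fun m n => CTXY_data 'I_m 'I_n) (fun m n => CTXY k 'I_m 'I_n)
    (fun m n => @relabel_CTXY 'I_m 'I_n) (fun m n => @act_CTXY k 'I_m 'I_n s).

Definition linearizes (T : finType) (s : {perm T}) (c : {set T}) (l : seq T)
  : Prop := [/\ uniq l, l =i c & fcycle s l].

(* rho_(c_m) o ... o rho_(c_1): the product of permutations in MathComp composes
   from left to right. *)
Definition rho_prod (k : nat) (s : 'S_k.+1) (l : seq 'I_k.+1) : 'S_k.+1 :=
  (\prod_(i <- l) rho i s)%g.

(* Main.v *)
From mathcomp Require Import boolp classical_sets fsbigop.
Require Import Defs.
From mathcomp Require Import all_boot fingroup perm finmap.
From mathcomp.multinomials Require Import monalg.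
From mathcomp Require Import all_algebra.

Set Implicit Arguments.
Unset Strict Implicit.
Unset Printing Implicit Defensive.
Import GRing.Theory Num.Theory.

(** Let [S] be an edge-rooted tree that is fixed by [sigma] and a relabeling
    [(mu, nu)]. Its root black vertex [x0] is fixed by [mu], and [S] consists of
    [x0] and of the [k + 1] trees [W i] hanging from it. It is fixed exactly if
    [W (sigma i)] is always obtained from [W i] by the relabeling and the action
    of [rho i sigma] ([fixed_CTXYP]). Along a cycle [c] of [sigma], one of these
    trees thus determines the other ones, and it only has to be fixed by the
    relabeling [(mu ^+ #|c|, nu ^+ #|c|)] and the product of the [rho i sigma] in
    the order of [c] ([card_colored_fixed]). This rests on the recursive action
    being an action ([act_CTYM]) that commutes with relabelings ([relabel_act]):
    it is computed along paths from the root, and these are preserved both by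
    relabelings and by the passage from a tree to a subtree ([emb_act]).

    It remains to sum over [mu] and [nu]. The indices of the subtrees, together
    with one more color for [x0], are a coloring of the labels that is equivariant
    for [mu] and [sigma]. When [mu] runs once through a cycle [c] of colors, it
    induces a return permutation of the labels of one color of [c], and the cycles
    of [mu] on these colors are [#|c|] times as long as those of the return
    permutation ([framed_cycle_prod]): this is the substitution of [p_(j * #|c|)]
    for [p_j]. To average over [mu], one numbers the labels of each color
    compatibly with [mu]. There are as many such frames for each colored
    permutation as there are families of return permutations, namely the product
    over the cycles [c] of the factorials of the sizes of their colors
    ([card_frames], [card_box_perms]); and each bijection from the boxes to the
    labels, with each family of return permutations, is a frame of one colored
    permutation. Hence the average over the colored permutations with given sizes
    of the colors is a product, over the cycles [c], of averages over return
    permutations ([colored_sum]), which are the terms of the cycle indices on the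
    right-hand side.

    Finally, the equality of the series is checked on each coefficient, in a ring
    of polynomials in the power sums ([agree], [Z_CTXY_coef]). *)

(** * Acyclic graphs *)

Section AcyclicGraphs.
Variables (V : finType) (e : rel V).
Hypothesis e_sym : symmetric e.

Definition acyclic := forall c, uniq c -> path.cycle e c -> size c <= 2.

Definition avoiding u : rel V := fun v v' => [&& e v v', v != u & v' != u].

Lemma avoiding_sym u : symmetric (avoiding u).
Proof. by move=> v w; rewrite /avoiding e_sym [in LHS](andbC (v != u)). Qed.

Lemma avoiding_connect u v w : connect (avoiding u) v w -> connect e v w.
Proof. by apply: connect_sub => {}v {}w /and3P[evw _ _]; apply: connect1. Qed.

Lemma path_avoiding u v p :
  v != u -> path (avoiding u) v p = path e v p && (u \notin p).
Proof.
elim: p v => [|w p IHp] v vu //=.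
rewrite in_cons negb_or [u == w]eq_sym {1}/avoiding vu /=.
have [->|wu] /= := eqVneq w u; first by rewrite !andbF.
by rewrite andbT (IHp _ wu) andbA.
Qed.

(** The branches at [u] are in bijection with its neighbors: otherwise two
    neighbors joined by a path off [u] would close a cycle through [u]. *)
Lemma acyclic_branch u w1 w2 :
  acyclic -> e u w1 -> e u w2 -> connect (avoiding u) w1 w2 -> w1 = w2.
Proof.
move=> acyc uw1 uw2 /connectP[p + w2E].
rewrite {w2}w2E in uw2 *; move=> path_p.
case/shortenP: path_p uw2 => [[//|w p']].
move=> av_p' uniq_p' _ uw2; have /andP[/and3P[_ w1u _] _] := av_p'.
move: av_p'; rewrite path_avoiding // => /andP[path_p' u_p'].
(* The path from [w1] to [w2] closes up at [u] into a cycle of length at least 3. *)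
have uniq_c : uniq (u :: w1 :: w :: p').
  by rewrite cons_uniq uniq_p' in_cons negb_or eq_sym w1u u_p'.
suff cycle_c : path.cycle e (u :: w1 :: w :: p') by have := acyc _ uniq_c cycle_c.
by move: path_p' uw2 => /= /andP[-> path_p'] uw2; rewrite rcons_path path_p' uw1 e_sym.
Qed.

Lemma connect_avoiding u v :
  connect e u v -> u != v -> exists2 w, e u w & connect (avoiding u) w v.
Proof.
case/connectP=> p path_p ->; case/shortenP: path_p => [[|w q]] /=.
  by rewrite eqxx.
case/andP=> uw path_q; rewrite in_cons negb_or => /andP[/andP[uw' u_q] _] _ _.
exists w => //; apply/connectP; exists q => //.
by rewrite path_avoiding 1?eq_sym // path_q.
Qed.

Lemma simple_path u v : connect e u v ->
  exists p, [/\ path e u p, uniq (u :: p) & last u p = v].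
Proof. by case/connectP=> p /shortenP[q path_q uniq_q _ ->]; exists q. Qed.

End AcyclicGraphs.

Lemma sub_acyclic (V : finType) (e e' : rel V) :
  subrel e' e -> acyclic e -> acyclic e'.
Proof.
by move=> sub acyc [//|v c] uniq_c /(sub_path sub); apply: (acyc (v :: c)).
Qed.

(** * Cyclic orders *)

Section CyclicOrders.
Variables (k : nat) (Y : finType).
Implicit Types (N : {set Y}) (f : {ffun Y -> Y}) (u : 'I_k.+1 -> Y).

(** Cyclic orders are handled through their linearizations [u], on which a
    permutation of the positions acts by composition ([permute_nbrs_enum]). *)
Definition cyclic_enum N f u :=
  [/\ injective u, N = [set u i | i : 'I_k.+1], forall i, f (u i) = u (ordS i)
    & forall y, y \notin N -> f y = y].

Lemma cyclic_enum_iter N f u i n :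
  cyclic_enum N f u -> iter n f (u i) = u (inZp (i + n)).
Proof.
case=> _ _ fu _; elim: n => [|n IHn] /=; first by rewrite addn0 valZpK.
rewrite IHn fu; congr (u _); apply: val_inj => /=.
by rewrite -[X in X %% _ = _]addn1 modnDml addn1 addnS.
Qed.

Lemma cyclic_enum_in N f u i : cyclic_enum N f u -> u i \in N.
Proof. by case=> _ -> _ _; apply: imset_f. Qed.

Lemma cyclic_enumP N f u y :
  cyclic_enum N f u -> reflect (exists i, y = u i) (y \in N).
Proof.
case=> _ -> _ _; apply: (iffP imsetP) => [[i _ ->]|[i ->]]; last by exists i.
by exists i.
Qed.

Lemma cyclic_enum_order N f u : cyclic_enum N f u -> cyclic_order N f.
Proof.
move=> fNu; split=> [|y]; first by case: fNu.
case/(cyclic_enumP _ fNu)=> i -> {y} y; rewrite -fconnect_orbit.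
apply/idP/(cyclic_enumP _ fNu) => [/connectP[p + ->]|[j ->]].
  case/fpathP=> n ->; rewrite last_traject (cyclic_enum_iter _ _ fNu).
  by eexists.
suff <-: iter (j + (k.+1 - i)) f (u i) = u j by apply: fconnect_iter.
rewrite (cyclic_enum_iter _ _ fNu); congr (u _); apply: val_inj => /=.
by rewrite addnCA subnKC 1?ltnW // modnDr modn_small.
Qed.

Lemma cyclic_enum_card N f u : cyclic_enum N f u -> #|N| = k.+1.
Proof. by case=> u_inj -> _ _; rewrite card_imset // card_ord. Qed.

Lemma cyclic_order_enum N f p :
  cyclic_order N f -> #|N| = k.+1 -> p \in N ->
  cyclic_enum N f (fun i => iter i f p).
Proof.
move=> [foff fN] cardN Np.
have ordN y : y \in N -> fingraph.order f y = k.+1.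
  move=> Ny; rewrite -size_orbit -cardN -(eq_card (fN y Ny)).
  by apply/esym/card_uniqP/orbit_uniq.
have iterN n : iter n f p \in N by rewrite -(fN _ Np) -fconnect_orbit fconnect_iter.
have iter_inj i j : i < k.+1 -> j < k.+1 -> iter i f p = iter j f p -> i = j.
  have nth_orbit n : n < k.+1 -> nth p (orbit f p) n = iter n f p.
    by move=> ltnk; rewrite /orbit nth_traject ?ordN.
  move=> ltik ltjk; rewrite -(nth_orbit i) // -(nth_orbit j) // => /eqP.
  by rewrite nth_uniq ?size_orbit ?ordN ?orbit_uniq // => /eqP.
(* The orbit of [f p] is also the whole of [N], so it returns to [p], and it
   cannot do so before [k + 1] steps. *)
have iter_k1 : iter k.+1 f p = p.
  have := Np; rewrite -(fN (f p) (iterN 1)) /orbit (ordN _ (iterN 1)).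
  case/trajectP=> i ltik; rewrite -iterSr => pE.
  have [<-//|neq_ik] := eqVneq i k.
  have ltik' : i.+1 < k.+1 by rewrite ltn_neqAle eqSS neq_ik.
  by have := iter_inj i.+1 0 ltik' isT (esym pE).
have enum_inj : injective (fun i : 'I_k.+1 => iter i f p).
  by move=> i j /iter_inj-/(_ (ltn_ord i) (ltn_ord j)) /val_inj.
split=> // [|i] /=.
  apply/esym/eqP; rewrite eqEcard card_imset // card_ord cardN leqnn andbT.
  by apply/subsetP=> _ /imsetP[i _ ->].
rewrite -iterS; have [iE|neq_ik] := eqVneq (i : nat) k.
  by rewrite iE iter_k1 modnn.
by rewrite modn_small // ltnS ltn_neqAle neq_ik leq_ord.
Qed.

End CyclicOrders.

(** * Neighbors in coding trees *)

Section Linearization.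
Variables (k : nat) (X Y : finType).
Implicit Types (T : coding_data X Y) (u : 'I_k.+1 -> Y) (s t : 'S_k.+1).

Lemma coding_data_eq T T' :
  nbrs T =1 nbrs T' -> (forall x, next_nbr T x =1 next_nbr T' x) -> T = T'.
Proof.
case: T T' => [N f] [N' f'] eqN eqf; congr (_, _); apply/ffunP=> x //.
  exact: eqN.
by apply/ffunP=> y; apply: eqf.
Qed.

Lemma cyclic_enum_uniq N (f g : {ffun Y -> Y}) u :
  cyclic_enum N f u -> cyclic_enum N g u -> f = g.
Proof.
move=> fNu [_ _ gu goff]; apply/ffunP=> y; case: (boolP (y \in N)) => [|Ny].
  by case/(cyclic_enumP _ fNu)=> i ->; rewrite gu; case: fNu.
by rewrite goff //; case: fNu => _ _ _ ->.
Qed.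

Section AtVertex.
Variables (T : coding_data X Y) (x : X) (u : 'I_k.+1 -> Y).
Hypothesis Tu : cyclic_enum (nbrs T x) (next_nbr T x) u.

Lemma nbr_at_enum i : nbr_at T x (u ord0) i = u i.
Proof. by rewrite /nbr_at (cyclic_enum_iter _ _ Tu) add0n valZpK. Qed.

Lemma pos_of_enum i : pos_of k T x (u ord0) (u i) = i.
Proof.
rewrite /pos_of; case: pickP => [j|/(_ i)]; last by rewrite nbr_at_enum eqxx.
by rewrite nbr_at_enum => /eqP; case: Tu => u_inj _ _ _ /u_inj.
Qed.

Lemma permute_nbrs_enum t :
  cyclic_enum (nbrs T x) (permute_nbrs T x (u ord0) t) (u \o (t^-1)%g).
Proof.
have [u_inj NE _ _] := Tu; split=> [|||y]; last by rewrite ffunE => /negPf->.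
- exact: inj_comp u_inj perm_inj.
- rewrite NE; apply/setP=> y; apply/imsetP/imsetP=> -[i _ ->].
    by exists (t i); rewrite //= permK.
  by exists ((t^-1)%g i).
move=> i /=; rewrite ffunE (cyclic_enum_in _ Tu) pos_of_enum permKV.
by rewrite nbr_at_enum.
Qed.

End AtVertex.

Lemma permute_no_nbrs T x p t :
  cyclic_order (nbrs T x) (next_nbr T x) -> nbrs T x = set0 ->
  permute_nbrs T x p t = next_nbr T x.
Proof.
by case=> foff _ N0; apply/ffunP=> y; rewrite ffunE N0 inE foff // N0 inE.
Qed.

End Linearization.

(** * The permutations acting at the vertices of a tree *)

Section LocalPermutations.
Variables k : nat.
Implicit Types (s t : 'S_k.+1) (i : 'I_k.+1).

Lemma rho_fix0 i s : rho i s ord0 = ord0.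
Proof.
by rewrite permE; have -> : ord0 = 0%R :> 'I_k.+1 by []; rewrite addr0 subrr.
Qed.

(** The subtree at position [i] sits at position [t i] when [s] acts, whence the
    index on the right: this identity makes the recursive action an action. *)
Lemma rhoM i t s : rho i (t * s)%g = (rho i t * rho (t i) s)%g.
Proof.
apply/permP=> a; rewrite permM !permE /=.
by rewrite [(t i + _)%R]addrC subrK.
Qed.

Variables (X Y : finType).
Implicit Types (T : coding_data X Y) (x b : X) (y r w : Y) (p : seq (X + Y)).

Record forest T : Prop := Forest {
  forest_acyclic : acyclic (adj T);
  forest_order x : cyclic_order (nbrs T x) (next_nbr T x);
  forest_card x y : y \in nbrs T x -> #|nbrs T x| = k.+1 }.

Lemma forest_enum T x w : forest T -> w \in nbrs T x ->
  cyclic_enum (nbrs T x) (next_nbr T x)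
    (fun i : 'I_k.+1 => iter i (next_nbr T x) w).
Proof.
by case=> _ ord card xw; apply: cyclic_order_enum; rewrite ?(card _ _ xw).
Qed.

Lemma adj_sym T : symmetric (adj T).
Proof. by case=> [x|y] [x'|y']. Qed.

Lemma white_towardsE T x v w d : acyclic (adj T) ->
  w \in nbrs T x -> connect (remove T (inl x)) (inr w) v ->
  white_towards T x v d = w.
Proof.
move=> acyc xw wv; rewrite /white_towards; case: pickP => [w' /andP[xw' w'v]|].
  suff [] : inr w' = inr w :> X + Y by [].
  apply: (acyclic_branch (@adj_sym T) (u := inl x)) => //.
  rewrite (connect_trans w'v) // (sym_connect_sym (avoiding_sym (@adj_sym T) _)).
  exact: wv.
by move/(_ w); rewrite xw wv.
Qed.

Lemma black_towardsE T y b x : acyclic (adj T) ->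
  y \in nbrs T b -> connect (remove T (inr y)) (inl b) (inl x) ->
  black_towards T y x = b.
Proof.
move=> acyc by_ bx; rewrite /black_towards; case: pickP => [b' /andP[b'y b'x]|].
  suff [] : inl b' = inl b :> X + Y by [].
  apply: (acyclic_branch (@adj_sym T) (u := inr y)) => //.
  rewrite (connect_trans b'x) // (sym_connect_sym (avoiding_sym (@adj_sym T) _)).
  exact: bx.
by move/(_ b); rewrite by_ bx.
Qed.

(** The recursion of the action along a given path from the root [r]: in this
    form, it does not refer to the other vertices of the tree. *)
Fixpoint path_perm T r s p : 'S_k.+1 :=
  if p is inl b :: inr w :: p' then path_perm T w (rho (pos_of k T b r w) s) p'
  else s.

Lemma path_connect_remove T u v p : path (adj T) v p -> u \notin v :: p ->
  connect (remove T u) v (last v p).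
Proof.
rewrite in_cons negb_or => path_p /andP[uv u_p]; apply/connectP; exists p => //.
by rewrite (path_avoiding _ p) 1?eq_sym // path_p.
Qed.

(** In a tree, the neighbors towards [x] that the recursion computes are the
    successive vertices of the simple path from [r] to [x], and the depth has to
    reach the number of black vertices before [x]. *)
Lemma local_permE n T r s x p : acyclic (adj T) ->
    path (adj T) (inr r) p -> uniq (inr r :: p) -> last (inr r) p = inl x ->
    count is_inl p <= n.+1 ->
  local_perm n T r s x = path_perm T r s p.
Proof.
move=> acyc.
have [m] := ubnP (size p); elim: m => // m IHm in n r s p *.
case: p => [|[b|//] p] //= lt_p_m /andP[rb path_p] /andP[r_p uniq_p] lastE.
have bE : black_towards T r x = b.
  by apply: black_towardsE; rewrite // -lastE path_connect_remove.
rewrite add1n ltnS; case: n => [|n] /= le_p_n.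
all: case: p => [|[//|w] p] in lt_p_m path_p r_p uniq_p lastE le_p_n *.
all: rewrite {}bE.
- by case: lastE => ->; rewrite eqxx.
- case/lastP: p lastE le_p_n {lt_p_m path_p r_p uniq_p} => //= p v.
  by rewrite last_rcons => ->; rewrite -cats1 count_cat addn1.
- by case: lastE => ->; rewrite eqxx.
have [bx|_] := eqVneq b x.
  case/andP: uniq_p => /negP[]; rewrite bx.
  by rewrite -(lastE : last (inr w) p = inl x) mem_last.
have [/= bw path_p'] := andP path_p; have [b_p uniq_p'] := andP uniq_p.
have -> : white_towards T b (inl x) r = w.
  by apply: white_towardsE; rewrite // -lastE path_connect_remove.
apply: IHm => //; first by rewrite -ltnS (ltn_trans _ lt_p_m).
Qed.

End LocalPermutations.

Section PermutedOrder.
Variables (k : nat) (X Y : finType) (T T2 : coding_data X Y) (x : X).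
Variables (u : 'I_k.+1 -> Y) (t : 'S_k.+1).
Hypothesis Tu : cyclic_enum (nbrs T x) (next_nbr T x) u.
Hypotheses (eqN : nbrs T2 x = nbrs T x)
  (T2f : next_nbr T2 x = permute_nbrs T x (u ord0) t).

Lemma permuted_enum :
  cyclic_enum (nbrs T2 x) (next_nbr T2 x) (u \o (t^-1)%g).
Proof. by rewrite eqN T2f; apply: permute_nbrs_enum. Qed.

Lemma permute_nbrsM s :
  permute_nbrs T2 x (u ((t^-1)%g ord0)) s = permute_nbrs T x (u ord0) (t * s)%g.
Proof.
have := permute_nbrs_enum permuted_enum s.
rewrite eqN; move/cyclic_enum_uniq; apply.
have := permute_nbrs_enum Tu (t * s)%g; rewrite invMg.
case=> u_inj NE fu foff; split=> //.
- by move=> i j; have := u_inj i j; rewrite /= !permM.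
- by rewrite {1}NE; apply: eq_imset => i /=; rewrite permM.
by move=> i; have := fu i; rewrite /= !permM.
Qed.

Lemma pos_of_permuted i :
  pos_of k T2 x (u ((t^-1)%g ord0)) (u i) = t i.
Proof.
by have := pos_of_enum permuted_enum (t i); rewrite /= permK.
Qed.

Lemma nbr_at_permuted i :
  nbr_at T2 x (u ((t^-1)%g ord0)) i = u ((t^-1)%g i).
Proof. exact: (nbr_at_enum permuted_enum). Qed.

End PermutedOrder.

(** * Coding trees on subsets of the labels *)

Section Subtrees.
Variables (k : nat) (X Y : finType).
Implicit Types (T : coding_data X Y) (A : {set X}) (B : {set Y}).
Implicit Types (x b : X) (y r w : Y) (p : seq (X + Y)) (s t : 'S_k.+1).

Definition in_parts A B (v : X + Y) :=
  match v with inl x => x \in A | inr y => y \in B end.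

(** The labels of a subtree form subsets [A] and [B] of [X] and [Y], instead of
    types of their own: all the subtrees then have the same type, and the
    relabelings of the whole tree apply to them. *)
Record coding_tree_on A B T r : Prop := CodingTreeOn {
  tree_forest :> forest k T;
  tree_component v : connect (adj T) (inr r) v = in_parts A B v;
  tree_outside x : x \notin A -> nbrs T x = set0 }.

Lemma tree_nbrs A B T r x y : coding_tree_on A B T r ->
  y \in nbrs T x -> (x \in A) && (y \in B).
Proof.
move=> Tr xy; case: (boolP (x \in A)) => [Ax|/(tree_outside Tr) N0]; last first.
  by rewrite N0 inE in xy.
have := tree_component Tr (inr y); rewrite /= => <-.
apply: (connect_trans (y := inl x)); last exact: connect1.
by rewrite (tree_component Tr).
Qed.

Lemma tree_root A B T r : coding_tree_on A B T r -> r \in B.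
Proof. by move=> Tr; have := tree_component Tr (inr r); rewrite connect0. Qed.

Lemma vertex_path A B T r x : coding_tree_on A B T r -> x \in A ->
  exists p w, [/\ path (adj T) (inr r) (rcons p (inl x)),
    uniq (inr r :: rcons p (inl x)), last (inr r) p = inr w & w \in nbrs T x].
Proof.
move=> Tr Ax; have := tree_component Tr (inl x); rewrite /= Ax.
case/simple_path=> p; case/lastP: p => [|p v] [] //.
rewrite last_rcons => path_p uniq_p vE; rewrite {}vE in path_p uniq_p.
have := path_p; rewrite rcons_path; case lastE: (last _ _) => [b|w] /andP[_ xw].
  by [].
by exists p, w.
Qed.

Lemma parentE T r p x w : acyclic (adj T) ->
    path (adj T) (inr r) (rcons p (inl x)) -> uniq (inr r :: rcons p (inl x)) ->
    last (inr r) p = inr w ->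
  white_towards T x (inr r) r = w.
Proof.
rewrite rcons_path -rcons_cons rcons_uniq.
move=> acyc /andP[path_p xp] /andP[x_p _] lastE; rewrite lastE in xp.
apply: white_towardsE => //.
rewrite (sym_connect_sym (avoiding_sym (@adj_sym _ _ T) _)) -lastE.
exact: (path_connect_remove path_p).
Qed.

Lemma count_inl p : uniq p -> count is_inl p <= #|X|.
Proof.
move=> uniq_p; rewrite -size_filter cardE -(size_map (@inl X Y)).
apply: uniq_leq_size; first exact: filter_uniq.
by move=> [x|y]; rewrite mem_filter //= => _; rewrite map_f // mem_enum.
Qed.

(** The cyclic order at [x] after the action of [s]. *)
Definition act_next s T r x :=
  permute_nbrs T x (white_towards T x (inr r) r) (local_perm #|X| T r s x).

Lemma act_nextE s T r p x w : acyclic (adj T) ->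
    path (adj T) (inr r) (rcons p (inl x)) -> uniq (inr r :: rcons p (inl x)) ->
    last (inr r) p = inr w ->
  act_next s T r x = permute_nbrs T x w (path_perm T r s (rcons p (inl x))).
Proof.
move=> acyc path_p uniq_p lastE; rewrite /act_next (parentE acyc path_p uniq_p lastE).
rewrite (local_permE _ acyc path_p) ?last_rcons //; apply: leqW.
by apply: count_inl; case/andP: uniq_p.
Qed.

Lemma act_nextF s T r x : next_nbr (act_CTY s (T, r)).1 x = act_next s T r x.
Proof. by rewrite /next_nbr ffunE. Qed.

Lemma act_next_out s A B T r x : coding_tree_on A B T r -> x \notin A ->
  act_next s T r x = next_nbr T x.
Proof.
move=> Tr Ax; rewrite /act_next permute_no_nbrs ?(tree_outside Tr) //.
rewrite -(tree_outside Tr Ax); exact: (forest_order Tr).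
Qed.

Lemma act_tree s A B T r : coding_tree_on A B T r ->
  coding_tree_on A B (act_CTY s (T, r)).1 r.
Proof.
move=> Tr; have [[acyc ord card] comp out] := Tr; split=> //; split=> // x.
rewrite act_nextF; have [Ax|Ax] := boolP (x \in A); last first.
  by rewrite (act_next_out _ Tr) //; apply: ord.
have [p [w [path_p uniq_p lastE xw]]] := vertex_path Tr Ax.
rewrite (act_nextE _ acyc path_p uniq_p lastE).
apply: cyclic_enum_order.
exact: (permute_nbrs_enum (forest_enum Tr xw) (path_perm T r s (rcons p (inl x)))).
Qed.

Lemma path_perm_fix0 T r t p : t ord0 = ord0 ->
  path_perm T r t p ord0 = ord0.
Proof.
have [m] := ubnP (size p); elim: m => // m IHm in r t p *.
case: p => [|[b|//] [|[//|w] p]] //= lt_p_m t0.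
by apply: IHm; [rewrite -ltnS (ltn_trans _ lt_p_m)|exact: rho_fix0].
Qed.

(** In [T2] the action of [t] has moved each vertex of the path from a position
    [i] to the position [t i], where the action of [s] on the subtree is read;
    the two recursions then compose by [rhoM]. *)
Lemma path_permM T T2 r t s p :
    forest k T -> nbrs T2 =1 nbrs T -> t ord0 = ord0 ->
    path (adj T) (inr r) p ->
    (forall p1 b p2 w, p = p1 ++ inl b :: p2 -> last (inr r) p1 = inr w ->
      next_nbr T2 b = permute_nbrs T b w (path_perm T r t (rcons p1 (inl b)))) ->
  path_perm T r (t * s)%g p = (path_perm T r t p * path_perm T2 r s p)%g.
Proof.
move=> Tf eqN; have [m] := ubnP (size p); elim: m => // m IHm in r t s p *.
case: p => [|[b|//] [|[//|w] p]] //= lt_p_m t0 /and3P[br bw path_p] T2f.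
have Tu := forest_enum Tf br.
have [i wE] := cyclic_enumP _ Tu bw.
have T2u := T2f [::] b (inr w :: p) r erefl erefl.
have t0V : (t^-1)%g ord0 = ord0 by rewrite -{1}t0 permK.
have posE : pos_of k T b r w = i by rewrite wE (pos_of_enum Tu).
have := pos_of_permuted Tu (eqN b) T2u i; rewrite t0V -wE posE => ->.
rewrite rhoM; apply: IHm => //; first by rewrite -ltnS (ltn_trans _ lt_p_m).
  exact: rho_fix0.
move=> p1 b' p2 w' pE lastE.
by rewrite (T2f (inl b :: inr w :: p1) b' p2 w') /= ?pE // posE.
Qed.

Lemma act_CTYM A B T r t s : coding_tree_on A B T r -> t ord0 = ord0 ->
  act_CTY s (act_CTY t (T, r)) = act_CTY (t * s)%g (T, r).
Proof.
move=> Tr t0; have Tf := tree_forest Tr; have acyc := forest_acyclic Tf.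
set T2 := (act_CTY t (T, r)).1; have T2r : coding_tree_on A B T2 r by apply: act_tree.
rewrite -[act_CTY t _]/(T2, r) [LHS]surjective_pairing [RHS]surjective_pairing.
congr (_, _); apply: coding_data_eq => // x y.
rewrite !act_nextF; congr (_ y).
have [Ax|Ax] := boolP (x \in A); last first.
  by rewrite (act_next_out _ T2r) // act_nextF !(act_next_out _ Tr).
have [p [w [path_p uniq_p lastE xw]]] := vertex_path Tr Ax.
rewrite (@act_nextE s T2 _ _ _ _ acyc path_p uniq_p lastE).
rewrite (act_nextE _ acyc path_p uniq_p lastE).
rewrite (path_permM (T2 := T2) s Tf _ t0 path_p) // => [|p1 b p2 w' pE lastE'].
  have Tu := forest_enum Tf xw.
  have T2x : next_nbr T2 x = permute_nbrs T x w (path_perm T r t (rcons p (inl x))).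
    by rewrite act_nextF (act_nextE _ acyc path_p uniq_p lastE).
  have := permute_nbrsM (T2 := T2) Tu erefl T2x (path_perm T2 r s (rcons p (inl x))).
  set q := path_perm T r t _; have q0 : q ord0 = ord0 by apply: path_perm_fix0.
  have -> : (q^-1)%g ord0 = ord0 by rewrite -{1}q0 permK.
  by move=> /= ->.
rewrite /T2 act_nextF (@act_nextE _ _ _ p1 _ w') //.
- by move: path_p; rewrite pE -cat_rcons cat_path => /andP[].
by move: uniq_p; rewrite pE -cat_rcons -cat_cons cat_uniq => /andP[].
Qed.

End Subtrees.

(** * Embeddings of trees *)

Section Embeddings.
Variables (k : nat) (X Y X' Y' : finType) (phi : X' -> X) (psi : Y' -> Y).
Implicit Types (s : 'S_k.+1).

Definition emb_vertex (v : X' + Y') : X + Y :=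
  match v with inl x => inl (phi x) | inr y => inr (psi y) end.

(** The black vertices in [A'] have all their neighbors in the image, so that a
    path of [T'] is also a path of [T], along which the positions are the same.
    Both the relabelings and the inclusions of subtrees are of this kind. *)
Record embeds (A' : {set X'}) (T' : coding_data X' Y') (T : coding_data X Y)
  : Prop := Embeds {
  emb_injl : injective phi;
  emb_injr : injective psi;
  emb_nbrs x : x \in A' -> nbrs T (phi x) = psi @: nbrs T' x;
  emb_next x y : x \in A' -> y \in nbrs T' x ->
    next_nbr T (phi x) (psi y) = psi (next_nbr T' x y);
  emb_outside x : x \notin A' -> nbrs T' x = set0 }.

Variables (A' : {set X'}) (T' : coding_data X' Y') (T : coding_data X Y).
Hypothesis T'T : embeds A' T' T.

Lemma emb_inj : injective emb_vertex.
Proof.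
by move=> [x|y] [x'|y'] //= [] => [/(emb_injl T'T)|/(emb_injr T'T)] ->.
Qed.

Lemma emb_in x y : y \in nbrs T' x -> x \in A'.
Proof. by apply: contraLR => /(emb_outside T'T) ->; rewrite inE. Qed.

Lemma emb_adj u v : adj T' u v -> adj T (emb_vertex u) (emb_vertex v).
Proof.
have nbr x y : y \in nbrs T' x -> psi y \in nbrs T (phi x).
  by move=> xy; rewrite (emb_nbrs T'T (emb_in xy)) imset_f.
by case: u v => [x|y] [x'|y'] //=; apply: nbr.
Qed.

Lemma emb_path u p :
  path (adj T') u p -> path (adj T) (emb_vertex u) (map emb_vertex p).
Proof. by move=> path_p; apply: (homo_path emb_adj path_p). Qed.

Lemma emb_acyclic : acyclic (adj T) -> acyclic (adj T').
Proof.
move=> acyc c uniq_c cycle_c; rewrite -(size_map emb_vertex); apply: acyc.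
  by rewrite (map_inj_uniq emb_inj).
by case: c cycle_c {uniq_c} => //= v c /emb_path; rewrite map_rcons.
Qed.

Lemma emb_enum x (u : 'I_k.+1 -> Y') : x \in A' ->
  (forall y, y \notin nbrs T (phi x) -> next_nbr T (phi x) y = y) ->
  cyclic_enum (nbrs T' x) (next_nbr T' x) u ->
  cyclic_enum (nbrs T (phi x)) (next_nbr T (phi x)) (psi \o u).
Proof.
move=> Ax foff T'u; have [u_inj NE fu _] := T'u; split=> //.
- exact: inj_comp (emb_injr T'T) u_inj.
- by rewrite (emb_nbrs T'T Ax) NE -imset_comp.
by move=> i; rewrite /= (emb_next T'T) ?fu // (cyclic_enum_in _ T'u).
Qed.

Hypotheses (Tf : forest k T) (T'f : forest k T').

Lemma emb_pos x y z : y \in nbrs T' x -> z \in nbrs T' x ->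
  pos_of k T (phi x) (psi y) (psi z) = pos_of k T' x y z.
Proof.
move=> xy xz; have T'u := forest_enum T'f xy.
have Tu := emb_enum (emb_in xy) (forest_order Tf (phi x)).1 T'u.
have [i zE] := cyclic_enumP _ T'u xz.
have := pos_of_enum Tu i; rewrite /= -zE => ->.
by have := pos_of_enum T'u i; rewrite /= -zE => ->.
Qed.

Lemma emb_path_perm r s p : path (adj T') (inr r) p ->
  path_perm T (psi r) s (map emb_vertex p) = path_perm T' r s p.
Proof.
have [m] := ubnP (size p); elim: m => // m IHm in r s p *.
case: p => [|[b|//] [|[//|w] p]] //= lt_p_m /and3P[br bw path_p].
by rewrite emb_pos // IHm // -ltnS (ltn_trans _ lt_p_m).
Qed.

Lemma emb_act_next s B' r x : coding_tree_on k A' B' T' r -> x \in A' ->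
  exists (q : 'S_k.+1) w, [/\ act_next s T' r x = permute_nbrs T' x w q,
    act_next s T (psi r) (phi x) = permute_nbrs T (phi x) (psi w) q
    & w \in nbrs T' x].
Proof.
move=> T'r Ax; have [p [w [path_p uniq_p lastE xw]]] := vertex_path T'r Ax.
exists (path_perm T' r s (rcons p (inl x))), w; split=> //.
  by rewrite (act_nextE _ (forest_acyclic T'f) path_p uniq_p lastE).
have := emb_path path_p; rewrite map_rcons /= => path_fp.
have uniq_fp : uniq (inr (psi r) :: rcons (map emb_vertex p) (inl (phi x))).
  by rewrite -[inl _]/(emb_vertex (inl x)) -map_rcons (map_inj_uniq emb_inj (inr r :: _)).
rewrite (act_nextE _ (forest_acyclic Tf) path_fp uniq_fp (w := psi w)).
  by rewrite -(emb_path_perm s path_p) map_rcons.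
by rewrite -[inr (psi r)]/(emb_vertex (inr r)) last_map lastE.
Qed.

End Embeddings.

(** The action at a vertex depends only on the path from the root, which is the
    same in [T'] and in [T]. *)
Lemma emb_act (k : nat) (X Y X' Y' : finType) (phi : X' -> X) (psi : Y' -> Y)
    A' B' (T' : coding_data X' Y') (T : coding_data X Y) r (s : 'S_k.+1) :
    embeds phi psi A' T' T -> forest k T -> coding_tree_on k A' B' T' r ->
  embeds phi psi A' (act_CTY s (T', r)).1 (act_CTY s (T, psi r)).1.
Proof.
move=> T'T Tf T'r; have [phi_inj psi_inj eqN _ out] := T'T.
split=> // x y Ax xy; rewrite !act_nextF.
have [p [w [-> -> xw]]] := emb_act_next T'T Tf T'r s T'r Ax.
have T'u := forest_enum T'r xw.
have Tu := emb_enum T'T Ax (forest_order Tf (phi x)).1 T'u.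
have [_ _ fu _] := permute_nbrs_enum T'u p.
have [_ _ gu _] := permute_nbrs_enum Tu p.
have /cyclic_enumP-/(_ _ xy)[i ->] := permute_nbrs_enum T'u p.
by rewrite fu gu.
Qed.

(** * Transport of trees along injections *)

Section Push.
Variables (X Y X' Y' : finType) (phi : X' -> X) (psi : Y' -> Y).

(** The labels that are not in the images become isolated, so that the image of a
    tree is a tree on the subsets [phi @: setT] and [psi @: setT]. *)
Definition push (T : coding_data X' Y') : coding_data X Y :=
  ([ffun x => if [pick x' | phi x' == x] is Some x' then psi @: nbrs T x'
              else set0],
   [ffun x => [ffun y =>
      if ([pick x' | phi x' == x], [pick y' | psi y' == y]) is (Some x', Some y')
      then psi (next_nbr T x' y') else y]]).

Definition push_CTY (S : CTY_data X' Y') : CTY_data X Y := (push S.1, psi S.2).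

Hypotheses (phi_inj : injective phi) (psi_inj : injective psi).
Implicit Types T : coding_data X' Y'.

Let pick_phi x : [pick x' | phi x' == phi x] = Some x.
Proof. by case: pickP => [x' /eqP/phi_inj->|/(_ x)/eqP]. Qed.

Let pick_psi y : [pick y' | psi y' == psi y] = Some y.
Proof. by case: pickP => [y' /eqP/psi_inj->|/(_ y)/eqP]. Qed.

Let pick_out (U V : finType) (f : U -> V) v :
  v \notin codom f -> [pick u | f u == v] = None.
Proof. by case: pickP => // u /eqP <-; rewrite codom_f. Qed.

Lemma push_nbrs T x : nbrs (push T) (phi x) = psi @: nbrs T x.
Proof. by rewrite /nbrs ffunE pick_phi. Qed.

Lemma push_next T x y : next_nbr (push T) (phi x) (psi y) = psi (next_nbr T x y).
Proof. by rewrite /next_nbr !ffunE pick_phi pick_psi. Qed.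

Lemma push_no_nbrs T x : x \notin codom phi -> nbrs (push T) x = set0.
Proof. by move=> xP; rewrite /nbrs ffunE pick_out. Qed.

Lemma push_next_out T x y :
  (x \notin codom phi) || (y \notin codom psi) -> next_nbr (push T) x y = y.
Proof.
rewrite /next_nbr !ffunE; case/orP=> [xP|yP]; first by rewrite pick_out.
by case: pickP => // x' _; rewrite pick_out.
Qed.

Lemma push_eq T (T2 : coding_data X Y) :
    (forall x, nbrs T2 (phi x) = psi @: nbrs T x) ->
    (forall x y, next_nbr T2 (phi x) (psi y) = psi (next_nbr T x y)) ->
    (forall x, x \notin codom phi -> nbrs T2 x = set0) ->
    (forall x y, (x \notin codom phi) || (y \notin codom psi) ->
      next_nbr T2 x y = y) ->
  T2 = push T.
Proof.
move=> eqN eqf noN foff; apply: coding_data_eq => [x|x y].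
  have [/codomP[x' ->]|xP] := boolP (x \in codom phi).
    by rewrite eqN push_nbrs.
  by rewrite noN // push_no_nbrs.
have [xyP|] := boolP ((x \notin codom phi) || (y \notin codom psi)).
  by rewrite foff // push_next_out.
rewrite negb_or !negbK => /andP[/codomP[x' ->] /codomP[y' ->]].
by rewrite eqf push_next.
Qed.

Lemma push_inj : injective push.
Proof.
move=> T T2 eqT; apply: coding_data_eq => [x|x y].
  by apply: (imset_inj psi_inj); rewrite -!push_nbrs eqT.
by apply: psi_inj; rewrite -!push_next eqT.
Qed.

Lemma push_CTY_inj : injective push_CTY.
Proof.
move=> [T r] [T2 r2] eqS.
by have /push_inj/= -> := congr1 fst eqS; have /psi_inj/= -> := congr1 snd eqS.
Qed.

Lemma push_embeds (A : {set X'}) T :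
  (forall x, x \notin A -> nbrs T x = set0) -> embeds phi psi A T (push T).
Proof.
by move=> out; split=> // [x _|x y _ _]; [apply: push_nbrs|apply: push_next].
Qed.

Lemma push_adj T u v : adj (push T) (emb_vertex phi psi u) v ->
  exists2 v', v = emb_vertex phi psi v' & adj T u v'.
Proof.
case: u v => [x|y] [x'|y'] //=.
  by rewrite push_nbrs => /imsetP[y xy ->]; exists (inr y).
have [/codomP[x ->]|xP] := boolP (x' \in codom phi); last first.
  by rewrite push_no_nbrs // inE.
by rewrite push_nbrs => /imsetP[y2 xy2 /psi_inj yE]; exists (inl x); rewrite // yE.
Qed.

Lemma push_path T u q : path (adj (push T)) (emb_vertex phi psi u) q ->
  exists2 q', q = map (emb_vertex phi psi) q' & path (adj T) u q'.
Proof.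
elim: q u => [|v q IHq] u /=; first by exists [::].
case/andP=> /push_adj[v' -> uv'] /IHq[q' -> path_q'].
by exists (v' :: q'); rewrite //= uv'.
Qed.

Lemma push_adj_source T u v : adj (push T) u v ->
  exists u', u = emb_vertex phi psi u'.
Proof.
case: u v => [x|y] [x'|y'] //=.
  have [/codomP[x1 ->] _|xP] := boolP (x \in codom phi); first by exists (inl x1).
  by rewrite push_no_nbrs // inE.
have [/codomP[x1 ->]|xP] := boolP (x' \in codom phi); last first.
  by rewrite push_no_nbrs // inE.
by rewrite push_nbrs => /imsetP[y1 _ ->]; exists (inr y1).
Qed.

(** A vertex on a cycle has a neighbor, hence it is not one of the isolated
    vertices, and the cycle lifts. *)
Lemma push_acyclic T : acyclic (adj T) -> acyclic (adj (push T)).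
Proof.
have f_inj : injective (emb_vertex phi psi).
  by move=> [x|y] [x'|y'] //= [] => [/phi_inj|/psi_inj] ->.
move=> acyc [//|v c] uniq_c cycle_c.
have [v' vE] : exists v', v = emb_vertex phi psi v'.
  by case: c cycle_c {uniq_c} => [|v2 c] /andP[/push_adj_source].
rewrite {}vE in uniq_c cycle_c *; have [q] := push_path cycle_c.
case/lastP: q => [|q v2]; first by case: (c).
rewrite map_rcons => /rcons_inj[cE /f_inj <-] cycle_q.
rewrite cE -map_cons size_map; apply: (acyc (v' :: q)) => //.
by move: uniq_c; rewrite cE -map_cons map_inj_uniq.
Qed.

Lemma push_tree k A B T r : coding_tree_on k A B T r ->
  coding_tree_on k (phi @: A) (psi @: B) (push T) (psi r).
Proof.
move=> Tr; have Tf := tree_forest Tr.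
have emb := push_embeds (tree_outside Tr); split.
- split=> [|x|x y xy]; first exact: push_acyclic (forest_acyclic Tf).
    have noff y : y \notin nbrs (push T) x -> next_nbr (push T) x y = y.
      have [/andP[]|] := boolP ((x \in codom phi) && (y \in codom psi)).
        case/codomP=> x' -> /codomP[y' ->]; rewrite push_nbrs push_next.
        by rewrite (mem_imset _ _ psi_inj) => /(forest_order Tf x').1 ->.
      by rewrite negb_and => /push_next_out.
    have [N0|[y xy]] := set_0Vmem (nbrs (push T) x).
      by split=> y; rewrite N0 inE // => _; apply: noff; rewrite N0 inE.
    have [/codomP[x' xE]|xP] := boolP (x \in codom phi); last first.
      by rewrite push_no_nbrs // inE in xy.
    rewrite {}xE push_nbrs in xy noff *; have [y' x'y' _] := imsetP xy.
    rewrite -push_nbrs; apply: cyclic_enum_order.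
    apply: (emb_enum emb _ _ (forest_enum Tf x'y')); last by rewrite push_nbrs.
    by case/andP: (tree_nbrs Tr x'y').
  have [/codomP[x' xE]|xP] := boolP (x \in codom phi); last first.
    by rewrite push_no_nbrs // inE in xy.
  rewrite {}xE push_nbrs in xy *; have [y' x'y' _] := imsetP xy.
  by rewrite card_imset // (forest_card Tf x'y').
- move=> v; apply/idP/idP.
    case/connectP=> q /(push_path (u := inr r))[q' -> path_q] ->.
    rewrite -[inr (psi r)]/(emb_vertex phi psi (inr r)) last_map.
    have := tree_component Tr (last (inr r) q').
    have -> : connect (adj T) (inr r) (last (inr r) q') by apply/connectP; exists q'.
    by case: (last _ _) => [x|y] /= /esym; apply: imset_f.
  have conn w : in_parts A B w ->
      connect (adj (push T)) (inr (psi r)) (emb_vertex phi psi w).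
    rewrite -(tree_component Tr) => /connectP[q path_q ->].
    apply/connectP; exists (map (emb_vertex phi psi) q).
      exact: (emb_path emb path_q).
    by rewrite -[inr (psi r)]/(emb_vertex phi psi (inr r)) last_map.
  case: v => [x|y] /= /imsetP[z Az ->].
    exact: (conn (inl z)).
  exact: (conn (inr z)).
move=> x xA; have [/codomP[x' xE]|xP] := boolP (x \in codom phi); last first.
  by rewrite push_no_nbrs.
rewrite {}xE push_nbrs in xA *; rewrite (tree_outside Tr) ?imset0 //.
by apply: contraNN xA => Ax; rewrite imset_f.
Qed.

Lemma push_act k A B T r (s : 'S_k.+1) : coding_tree_on k A B T r ->
  act_CTY s (push_CTY (T, r)) = push_CTY (act_CTY s (T, r)).
Proof.
move=> Tr; have emb := push_embeds (tree_outside Tr).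
have pTr := push_tree Tr; have Tf := tree_forest Tr.
have emb2 := emb_act s emb pTr Tr.
rewrite [LHS]surjective_pairing [RHS]surjective_pairing; congr (_, _).
apply: push_eq => [x|x y|x xP|x y].
- exact: push_nbrs.
- rewrite !act_nextF; have [xy|xy] := boolP (y \in nbrs T x).
    have [xA _] := andP (tree_nbrs Tr xy).
    by have := emb_next emb2 xA xy; rewrite !act_nextF.
  rewrite /act_next ffunE push_nbrs (mem_imset _ _ psi_inj) (negPf xy).
  by rewrite ffunE (negPf xy).
- exact: push_no_nbrs.
move=> xy; rewrite act_nextF /act_next ffunE ifF //; apply/negbTE.
case/orP: xy => [xP|yP]; first by rewrite push_no_nbrs // inE.
have [/codomP[x' ->]|xP] := boolP (x \in codom phi); last first.
  by rewrite push_no_nbrs // inE.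
rewrite push_nbrs; apply: contraNN yP => /imsetP[y' _ ->]; exact: codom_f.
Qed.

End Push.

Lemma push_push (X1 Y1 X2 Y2 X3 Y3 : finType) (phi : X1 -> X2) (psi : Y1 -> Y2)
    (phi' : X2 -> X3) (psi' : Y2 -> Y3) T :
    injective phi -> injective psi -> injective phi' -> injective psi' ->
  push phi' psi' (push phi psi T) = push (phi' \o phi) (psi' \o psi) T.
Proof.
move=> phi_inj psi_inj phi_inj' psi_inj'.
apply: push_eq => /= [||x|x y|x|x y].
- exact: inj_comp.
- exact: inj_comp.
- by rewrite !push_nbrs // -imset_comp.
- by rewrite !push_next.
- move=> xP; have [/codomP[x' xE]|xP'] := boolP (x \in codom phi'); last first.
    by rewrite push_no_nbrs.
  rewrite xE push_nbrs // push_no_nbrs ?imset0 //; apply: contraNN xP.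
  by case/codomP=> x1 x1E; rewrite xE x1E; apply: (codom_f (phi' \o phi)).
have [xyP _|] := boolP ((x \notin codom phi') || (y \notin codom psi')).
  by rewrite push_next_out.
rewrite negb_or !negbK => /andP[/codomP[x' ->] /codomP[y' ->]] xyP.
rewrite push_next // push_next_out //; case/orP: xyP => xyP; apply/orP.
  left; apply: contraNN xyP => /codomP[x1 ->]; exact: (codom_f (phi' \o phi)).
right; apply: contraNN xyP => /codomP[y1 ->]; exact: (codom_f (psi' \o psi)).
Qed.

Lemma push_fun_eq (X Y X' Y' : finType) (phi phi' : X -> X') (psi psi' : Y -> Y')
    T : phi =1 phi' -> psi =1 psi' -> push phi psi T = push phi' psi' T.
Proof.
move=> eq_phi eq_psi; congr (_, _); apply/ffunP=> x; rewrite !ffunE.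
  rewrite (eq_pick (fun u => congr1 (eq_op^~ x) (eq_phi u))).
  by case: pickP => // x' _; apply: eq_imset.
apply/ffunP=> y; rewrite !ffunE.
rewrite (eq_pick (fun u => congr1 (eq_op^~ x) (eq_phi u))).
rewrite (eq_pick (fun u => congr1 (eq_op^~ y) (eq_psi u))).
by case: pickP => // x' _; case: pickP => // y' _; rewrite eq_psi.
Qed.

Lemma relabelE (X Y : finType) (mu : {perm X}) (nu : {perm Y}) T :
  relabel mu nu T = push mu nu T.
Proof.
have muP x : x \in codom mu by rewrite -[x](permKV mu) codom_f.
have nuP y : y \in codom nu by rewrite -[y](permKV nu) codom_f.
apply: push_eq => [||x|x y|x|x y]; try exact: perm_inj.
- by rewrite /nbrs ffunE permK.
- by rewrite /next_nbr !ffunE !permK.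
- by rewrite muP.
by rewrite muP nuP.
Qed.

Section Relabelings.
Variables (k : nat) (X Y : finType).
Implicit Types (mu : {perm X}) (nu : {perm Y}) (A : {set X}) (B : {set Y}).

Definition CTY_on A B : {set CTY_data X Y} :=
  [set S | `[< coding_tree_on k A B S.1 S.2 >]].

Lemma CTY_onP A B S : reflect (coding_tree_on k A B S.1 S.2) (S \in CTY_on A B).
Proof. by rewrite inE; apply: asboolP. Qed.

Lemma CTY_onT : CTY_on [set: X] [set: Y] = CTY k X Y.
Proof.
apply/setP=> -[T r]; rewrite !inE; apply: asbool_equiv_eq.
have inT v : in_parts [set: X] [set: Y] v by case: v => v; rewrite /= inE.
split=> [[[acyc ord card] comp _]|[[conn acyc] card ord]].
  split=> // [|x].
    split=> // u v; apply: (connect_trans (y := inr r)); last by rewrite comp.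
    by rewrite (sym_connect_sym (@adj_sym _ _ T)) comp.
  have : connect (adj T) (inr r) (inl x) by rewrite comp.
  case/connectP=> p; case/lastP: p => [|p v] //; rewrite last_rcons rcons_path.
  move=> /andP[_ +] vE; rewrite -{}vE; case: (last _ _) => //= y.
  exact: card.
split=> [|v|x]; last by rewrite inE.
  by split=> // x y _; apply: card.
by rewrite inT; apply: conn.
Qed.

Lemma relabel_CTYE mu nu S : relabel_CTY mu nu S = push_CTY mu nu S.
Proof. by rewrite /relabel_CTY relabelE. Qed.

Lemma relabel_tree A B mu nu S : S \in CTY_on A B ->
  relabel_CTY mu nu S \in CTY_on (mu @: A) (nu @: B).
Proof.
case: S => T r /CTY_onP Tr; apply/CTY_onP; rewrite relabel_CTYE.
by apply: push_tree => //; apply: perm_inj.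
Qed.

Lemma relabel_CTYM mu nu mu' nu' S :
  relabel_CTY mu' nu' (relabel_CTY mu nu S) =
  relabel_CTY (mu * mu')%g (nu * nu')%g S.
Proof.
rewrite !relabel_CTYE /push_CTY /= push_push; try exact: perm_inj.
by rewrite permM; congr (_, _); apply: push_fun_eq => z; rewrite /= permM.
Qed.

Lemma relabel_act A B mu nu (s : 'S_k.+1) S : S \in CTY_on A B ->
  act_CTY s (relabel_CTY mu nu S) = relabel_CTY mu nu (act_CTY s S).
Proof.
case: S => T r /CTY_onP Tr; rewrite !relabel_CTYE.
by apply: push_act Tr; apply: perm_inj.
Qed.

Lemma act_CTY_on A B (s : 'S_k.+1) S : S \in CTY_on A B ->
  act_CTY s S \in CTY_on A B.
Proof. by case: S => T r /CTY_onP Tr; apply/CTY_onP; apply: act_tree. Qed.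

End Relabelings.

Section Pull.
Variables (k : nat) (X Y X' Y' : finType) (phi : X' -> X) (psi : Y' -> Y).
Hypotheses (phi_inj : injective phi) (psi_inj : injective psi).

Definition pull (T : coding_data X Y) : coding_data X' Y' :=
  ([ffun x => psi @^-1: nbrs T (phi x)],
   [ffun x => [ffun y =>
      odflt y [pick y' | psi y' == next_nbr T (phi x) (psi y)]]]).

Variables (T : coding_data X Y) (r : Y').
Hypothesis Tr : coding_tree_on k (phi @: setT) (psi @: setT) T (psi r).

Let in_codom x y : y \in nbrs T x -> (x \in codom phi) && (y \in codom psi).
Proof.
by case/(tree_nbrs Tr)/andP=> /imsetP[x' _ ->] /imsetP[y' _ ->]; rewrite !codom_f.
Qed.

Let next_in x y : y \in nbrs T x -> next_nbr T x y \in nbrs T x.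
Proof.
move=> xy; have := (forest_order Tr x).2 y xy (next_nbr T x y).
by rewrite -fconnect_orbit fconnect1.
Qed.

Lemma pull_nbrs x : nbrs T (phi x) = psi @: nbrs (pull T) x.
Proof.
apply/setP=> y; apply/idP/imsetP=> [xy|[y' + ->]]; last by rewrite /nbrs ffunE inE.
have /andP[_ /codomP[y' yE]] := in_codom xy; exists y' => //.
by rewrite /nbrs ffunE inE -yE.
Qed.

Lemma pull_next x y : next_nbr T (phi x) (psi y) = psi (next_nbr (pull T) x y).
Proof.
rewrite [next_nbr (pull T) _]ffunE ffunE; case: pickP => [y' /eqP -> //|noy].
have [xy|/(forest_order Tr _).1 -> //] := boolP (psi y \in nbrs T (phi x)).
have /andP[_ /codomP[y' yE]] := in_codom (next_in xy).
by have := noy y'; rewrite -yE eqxx.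
Qed.

Lemma pullK : push phi psi (pull T) = T.
Proof.
apply/esym/push_eq => // [x|x y|x xP|x y xyP].
- exact: pull_nbrs.
- exact: pull_next.
- by apply: (tree_outside Tr); apply: contraNN xP => /imsetP[x' _ ->]; apply: codom_f.
apply: (forest_order Tr _).1; apply/negP=> /in_codom.
by rewrite -(negbK (_ && _)) negb_and xyP.
Qed.

Lemma pull_tree : coding_tree_on k setT setT (pull T) r.
Proof.
have out x : x \notin setT -> nbrs (pull T) x = set0 by rewrite inE.
have := push_embeds phi_inj psi_inj out; rewrite pullK => emb.
have Tf := tree_forest Tr; split=> [|v|//].
  split=> [|x|x y xy]; first exact: (emb_acyclic emb (forest_acyclic Tf)).
    have [N0|[y xy]] := set_0Vmem (nbrs (pull T) x).
      split=> y; rewrite N0 inE // => _; apply: psi_inj; rewrite -pull_next.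
      by apply: (forest_order Tf _).1; rewrite pull_nbrs N0 imset0 inE.
    have Tu : cyclic_enum (nbrs T (phi x)) (next_nbr T (phi x))
        (fun i : 'I_k.+1 => psi (iter i (next_nbr (pull T) x) y)).
      have xy' : psi y \in nbrs T (phi x) by rewrite pull_nbrs imset_f.
      have iterE n : iter n (next_nbr T (phi x)) (psi y) =
          psi (iter n (next_nbr (pull T) x) y).
        by elim: n => //= n ->; rewrite pull_next.
      have [u_inj NE fu foff] := forest_enum Tf xy'.
      split=> // [i j||i]; last by have := fu i; rewrite !iterE.
        by have := u_inj i j; rewrite !iterE.
      by rewrite NE; apply: eq_imset => j; rewrite iterE.
    have [u_inj NE fu foff] := Tu.
    apply: (@cyclic_enum_order k _ _ _ (fun i => iter i (next_nbr (pull T) x) y)).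
    split=> [i j eq_ij|||z xz].
    - by apply: u_inj; rewrite eq_ij.
    - apply: (imset_inj psi_inj); rewrite -pull_nbrs NE -imset_comp.
      exact: eq_imset.
    - by move=> i; apply: psi_inj; rewrite -pull_next fu.
    apply: psi_inj; rewrite -pull_next foff // pull_nbrs.
    by rewrite (mem_imset _ _ psi_inj).
  have := forest_card Tf (x := phi x) (y := psi y).
  by rewrite pull_nbrs card_imset // mem_imset //; apply.
have -> : in_parts setT setT v by case: v => v; rewrite /= inE.
have : connect (adj T) (inr (psi r)) (emb_vertex phi psi v).
  by rewrite (tree_component Tr); case: v => v; rewrite /= imset_f.
rewrite -{1}pullK => /connectP[q /(push_path phi_inj psi_inj (u := inr r))].
case=> q' -> path_q'; rewrite -[inr (psi r)]/(emb_vertex phi psi (inr r)) last_map.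
by move/(emb_inj emb)=> ->; apply/connectP; exists q'.
Qed.

End Pull.

(** [push] is a bijection from the trees on [X'] and [Y'] to the trees on the
    images of [phi] and [psi], and it commutes with relabelings and with the
    action. *)
Lemma card_fixed_transport k (X Y X' Y' : finType) (phi : X' -> X) (psi : Y' -> Y)
    (mu : {perm X}) (nu : {perm Y}) (mu' : {perm X'}) (nu' : {perm Y'})
    (t : 'S_k.+1) :
    injective phi -> injective psi ->
    (forall x, mu (phi x) = phi (mu' x)) -> (forall y, nu (psi y) = psi (nu' y)) ->
  #|[set S in CTY_on k (phi @: setT) (psi @: setT)
       | act_CTY t (relabel_CTY mu nu S) == S]| =
  #|[set S in CTY k X' Y' | act_CTY t (relabel_CTY mu' nu' S) == S]|.
Proof.
move=> phi_inj psi_inj mu_phi nu_psi; have pinj := push_CTY_inj phi_inj psi_inj.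
rewrite -(card_imset _ pinj); apply: eq_card => S.
have actE S' : S' \in CTY k X' Y' ->
    act_CTY t (relabel_CTY mu nu (push_CTY phi psi S')) =
    push_CTY phi psi (act_CTY t (relabel_CTY mu' nu' S')).
  rewrite -CTY_onT => S'T; have /CTY_onP := relabel_tree mu' nu' S'T.
  case E : (relabel_CTY _ _ S') => [T2 r2] T2r; rewrite -(push_act _ _ _ T2r) //.
  congr act_CTY; rewrite -E !relabel_CTYE /push_CTY /=.
  rewrite nu_psi !push_push //; try exact: perm_inj.
  by congr (_, _); apply: push_fun_eq => z /=; rewrite ?mu_phi ?nu_psi.
rewrite inE; apply/andP/imsetP=> [[]|[S']]; last first.
  rewrite inE => /andP[S'T /eqP S'fix] ->; rewrite actE // S'fix; split=> //.
  by apply/CTY_onP; apply: push_tree => //; apply/CTY_onP; rewrite CTY_onT.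
case: S => T r /CTY_onP Tr /eqP Sfix.
have [r' _ rE] := imsetP (tree_root Tr); rewrite /= in rE Tr; subst r.
have Tr' := pull_tree phi_inj psi_inj Tr.
have SE : (T, psi r') = push_CTY phi psi (pull phi psi T, r').
  by rewrite /push_CTY /= (pullK phi_inj psi_inj Tr).
have S'T : (pull phi psi T, r') \in CTY k X' Y'.
  by rewrite -CTY_onT; apply/CTY_onP.
exists (pull phi psi T, r'); last exact: SE.
rewrite inE S'T andTb; apply/eqP/pinj; rewrite -actE // -SE; exact: Sfix.
Qed.

(** * The subtrees hanging from the root black vertex *)

Section RootSubtrees.
Variables (k : nat) (X Y : finType).
Implicit Types (T : coding_data X Y) (S : CTXY_data X Y) (i : 'I_k.+1).
Implicit Types (v : X + Y) (c : X + Y -> option 'I_k.+1).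

Definition branch S i : Y := nbr_at S.1 S.2.1 S.2.2 i.

(** The index of the subtree that contains [v]. *)
Definition color S v : option 'I_k.+1 :=
  if v == inl S.2.1 then None
  else Some (pos_of k S.1 S.2.1 S.2.2 (white_towards S.1 S.2.1 v S.2.2)).

Definition blacks c i : {set X} := [set x | c (inl x) == Some i].
Definition whites c i : {set Y} := [set y | c (inr y) == Some i].

Definition restrict T (A : {set X}) : coding_data X Y :=
  ([ffun x => if x \in A then nbrs T x else set0],
   [ffun x => if x \in A then next_nbr T x else finfun id]).

Definition subtree S i : CTY_data X Y :=
  (restrict S.1 (blacks (color S) i), branch S i).

Lemma restrict_nbrs T A x :
  nbrs (restrict T A) x = if x \in A then nbrs T x else set0.
Proof. by rewrite /nbrs ffunE. Qed.

Lemma restrict_next T A x :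
  next_nbr (restrict T A) x = if x \in A then next_nbr T x else finfun id.
Proof. by rewrite /next_nbr ffunE. Qed.

Lemma restrict_adj T A u v : adj (restrict T A) u v =
  adj T u v && match u, v with inl x, _ | _, inl x => x \in A | _, _ => false end.
Proof.
by case: u v => [x|y] [x'|y'] //=; rewrite restrict_nbrs; case: ifP;
  rewrite ?andbT ?andbF ?inE.
Qed.

Lemma in_partsE c i v : in_parts (blacks c i) (whites c i) v = (c v == Some i).
Proof. by case: v => z; rewrite /= inE. Qed.

Lemma tree_card A B T r x : coding_tree_on k A B T r -> x \in A ->
  #|nbrs T x| = k.+1.
Proof.
move=> Tr Ax; have [p [w [_ _ _ xw]]] := vertex_path Tr Ax.
exact: (forest_card Tr xw).
Qed.

Section OfTree.
Variable S : CTXY_data X Y.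
Hypothesis S_CTXY : S \in CTXY k X Y.
Local Notation T := S.1.
Local Notation x0 := S.2.1.
Local Notation w0 := S.2.2.
Local Notation off := (remove T (inl x0)).

Lemma CTXY_tree r : coding_tree_on k setT setT T r.
Proof.
apply/(CTY_onP k setT setT (T, r)); rewrite CTY_onT inE /=.
by move: S_CTXY; rewrite inE => /andP[].
Qed.

Lemma CTXY_forest : forest k T. Proof. exact: CTXY_tree w0. Qed.

Lemma CTXY_root : w0 \in nbrs T x0.
Proof. by move: S_CTXY; rewrite inE => /andP[]. Qed.

Lemma branch_enum : cyclic_enum (nbrs T x0) (next_nbr T x0) (branch S).
Proof. exact: (forest_enum CTXY_forest CTXY_root). Qed.

Lemma color_connect i v : connect off (inr (branch S i)) v -> color S v = Some i.
Proof.
move=> conn; rewrite /color ifN; last first.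
  apply: contraTneq conn => ->; apply/negP=> /connectP[p].
  case/lastP: p => // p u; rewrite last_rcons rcons_path => /andP[_ +] uE.
  by rewrite -uE /remove eqxx !andbF.
rewrite (white_towardsE _ (forest_acyclic CTXY_forest) _ conn).
  by rewrite (pos_of_enum branch_enum).
exact: (cyclic_enum_in _ branch_enum).
Qed.

Lemma color_exists v :
  v != inl x0 -> exists i, connect off (inr (branch S i)) v.
Proof.
move=> vx0; have conn : connect (adj T) (inl x0) v.
  have Tr := CTXY_tree w0; apply: (connect_trans (y := inr w0)).
    exact: (connect1 (CTXY_root : adj T (inl x0) (inr w0))).
  by rewrite (tree_component Tr); case: (v) => z; rewrite /= inE.
rewrite eq_sym in vx0; have [[//|w] /= x0w conn_w] := connect_avoiding conn vx0.
by have [i wE] := cyclic_enumP _ branch_enum x0w; exists i; rewrite -wE.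
Qed.

Lemma colorP i v :
  reflect (connect off (inr (branch S i)) v) (color S v == Some i).
Proof.
apply: (iffP eqP) => [col|]; last exact: color_connect.
have [vE|/color_exists[j conn]] := eqVneq v (inl x0).
  by rewrite /color vE eqxx in col.
by have := color_connect conn; rewrite col => -[->].
Qed.

Lemma color_None v : (color S v == None) = (v == inl x0).
Proof. by rewrite /color; case: ifP. Qed.

Lemma subtree_tree i :
  subtree S i \in CTY_on k (blacks (color S) i) (whites (color S) i).
Proof.
have Tf := CTXY_forest; apply/CTY_onP; set T' := (subtree S i).1.
split=> [|v|x]; last by rewrite restrict_nbrs => /negPf->.
  split=> [|x|x y].
  - apply: sub_acyclic (forest_acyclic Tf) => u v.
    by rewrite restrict_adj => /andP[].
  - rewrite restrict_nbrs restrict_next; case: ifP => _.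
      exact: (forest_order Tf).
    by split=> y; rewrite inE // ffunE.
  rewrite restrict_nbrs; case: ifP => _; last by rewrite in_set0.
  exact: forest_card.

rewrite in_partsE; apply/idP/colorP.
  apply: connect_sub => {}v {}u; rewrite restrict_adj => /andP[vu iA].
  have bx x : x \in blacks (color S) i -> inl x != inl x0 :> X + Y.
    by rewrite inE; apply: contraTneq => ->; rewrite /color eqxx.
  apply: connect1; rewrite /remove vu.
  by case: v u vu iA => [x|y] [x'|y'] //= _ /bx ->; rewrite ?andbT.
case/connectP=> p path_p ->; apply/connectP; exists p => //.
move: path_p (connect0 off (inr (branch S i))); rewrite [(subtree S i).2]/=.
elim: p {1 3 4}(inr _) => //= u p IHp {}v /andP[vu path_p] conn_v.
have conn_u := connect_trans conn_v (connect1 vu).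
rewrite IHp // andbT restrict_adj; case/and3P: vu => vu _ _; rewrite vu /=.
move: conn_v conn_u => /color_connect cv /color_connect cu.
by case: v u vu cv cu {path_p IHp} => [x|y] [x'|y'] //= _ cv cu;
  rewrite inE ?cv ?cu.
Qed.

End OfTree.

(** The root black vertex is the only one without color, its neighbors in cyclic
    order are the roots of the subtrees, and the data at any other black vertex
    are found in the subtree of its color. *)
Lemma subtree_inj S S' : S \in CTXY k X Y -> S' \in CTXY k X Y ->
  color S =1 color S' -> subtree S =1 subtree S' -> S = S'.
Proof.
move=> SP SP' eq_col eq_sub.
have eq_branch i : branch S i = branch S' i by case: (eq_sub i).
have Su := branch_enum SP; have Su' := branch_enum SP'.
have eq_x0 : S.2.1 = S'.2.1.
  suff /eqP[] : inl S.2.1 == inl S'.2.1 :> X + Y by [].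
  by rewrite -color_None -eq_col color_None.
have eq_w0 : S.2.2 = S'.2.2 := eq_branch ord0.
have eq_N0 : nbrs S.1 S.2.1 = nbrs S'.1 S.2.1.
  have [_ -> _ _] := Su; rewrite eq_x0; have [_ -> _ _] := Su'.
  exact: eq_imset.
have eq_T : S.1 = S'.1.
  suff eqNf x : nbrs S.1 x = nbrs S'.1 x /\ next_nbr S.1 x = next_nbr S'.1 x.
    by apply: coding_data_eq => [x|x y]; have [eqN eqf] := eqNf x; rewrite ?eqN ?eqf.
  have [->|xx0] := eqVneq x S.2.1.
    split=> //; apply: (cyclic_enum_uniq Su); rewrite eq_N0 eq_x0.
    have [u_inj NE fu foff] := Su'; split=> // [i j||i].
    - by rewrite !eq_branch; apply: u_inj.
    - by rewrite NE; apply: eq_imset => i.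
    by rewrite !eq_branch fu.
  have [//|i /(color_connect SP)/eqP col] := color_exists SP (v := inl x).
  have col' := col; rewrite eq_col in col'.
  have := congr1 (fun W => nbrs W.1 x) (eq_sub i).
  have := congr1 (fun W => next_nbr W.1 x) (eq_sub i).
  by rewrite /= !restrict_nbrs !restrict_next !inE col col' => -> ->.
move: eq_T eq_x0 eq_w0 {SP SP' eq_col eq_sub eq_branch Su Su' eq_N0}.
by case: S S' => [T [x w]] [T' [x' w']] /= -> -> ->.
Qed.

End RootSubtrees.

Section Assemble.
Variables (k : nat) (X Y : finType) (x0 : X).
Variables (c : X + Y -> option 'I_k.+1) (W : 'I_k.+1 -> CTY_data X Y).
Hypothesis c_None : forall v, (c v == None) = (v == inl x0).
Hypothesis W_tree : forall i, W i \in CTY_on k (blacks c i) (whites c i).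

Local Notation r i := (W i).2.

(** The tree obtained by attaching the roots of the [W i], in this cyclic order,
    to a new black vertex [x0]. *)
Definition assembled_data : coding_data X Y :=
  ([ffun x => if c (inl x) is Some i then nbrs (W i).1 x
              else [set r i | i : 'I_k.+1]],
   [ffun x => if c (inl x) is Some i then next_nbr (W i).1 x
              else [ffun y => if [pick i | r i == y] is Some i then r (ordS i)
                              else y]]).

Definition assembled : CTXY_data X Y := (assembled_data, (x0, r ord0)).

Local Notation T := assembled_data.

Let Wt i : coding_tree_on k (blacks c i) (whites c i) (W i).1 (r i).
Proof. exact/CTY_onP/W_tree. Qed.

Let c_x0 : c (inl x0) = None. Proof. by apply/eqP; rewrite c_None. Qed.

Let c_root i : c (inr (r i)) = Some i.
Proof. by have := tree_root (Wt i); rewrite inE => /eqP. Qed.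

Let root_inj : injective (fun i => r i).
Proof. by move=> i j eq_ij; have := c_root i; rewrite /= eq_ij c_root => -[]. Qed.

Let T_nbrs i x : c (inl x) = Some i -> nbrs T x = nbrs (W i).1 x.
Proof. by rewrite /nbrs ffunE => ->. Qed.

Let T_next i x : c (inl x) = Some i -> next_nbr T x = next_nbr (W i).1 x.
Proof. by rewrite /next_nbr ffunE => ->. Qed.

Let T_nbrs0 : nbrs T x0 = [set r i | i : 'I_k.+1].
Proof. by rewrite /nbrs ffunE c_x0. Qed.

Let T_enum : cyclic_enum (nbrs T x0) (next_nbr T x0) (fun i => r i).
Proof.
rewrite T_nbrs0 /next_nbr ffunE c_x0; split=> // [i|y]; rewrite ffunE.
  by case: pickP => [j /eqP/root_inj->|/(_ i)/eqP].
by case: pickP => // i /eqP <-; rewrite (imset_f (fun i => r i)).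
Qed.

Let W_nbr i x y : y \in nbrs (W i).1 x -> c (inl x) = Some i /\ c (inr y) = Some i.
Proof. by case/(tree_nbrs (Wt i))/andP; rewrite !inE => /eqP-> /eqP->. Qed.

Let W_adj i u v : adj (W i).1 u v -> [/\ c u = Some i, c v = Some i & adj T u v].
Proof.
case: u v => [x|y] [x'|y'] //= xy; have [cx cy] := W_nbr xy.
  by rewrite (T_nbrs cx).
by rewrite (T_nbrs cx).
Qed.

Let off_color u v : remove T (inl x0) u v -> c u = c v.
Proof.
have nbr x y : x != x0 -> y \in nbrs T x -> c (inl x) = c (inr y).
  move=> xx0; case cx: (c (inl x)) => [i|].
    by rewrite (T_nbrs cx) => /W_nbr[_ ->].
  by move/eqP: cx xx0; rewrite c_None => /eqP[->]; rewrite eqxx.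
case: u v => [x|y] [x'|y'] //= /and3P[xy xx0 x'x0].
  by apply: nbr xy; apply: contraNneq xx0 => ->.
by apply/esym/(nbr _ _ _ xy); apply: contraNneq x'x0 => ->.
Qed.

Let off_path i v p : path (remove T (inl x0)) v p -> c v = Some i ->
  path (adj (W i).1) v p.
Proof.
elim: p v => //= u p IHp v /andP[vu path_p] cv.
have cu : c u = Some i by rewrite -(off_color vu).
rewrite IHp // andbT; case/and3P: vu => + _ _.
by case: v u cv cu {IHp path_p} => [x|y] [x'|y'] //= cv cu;
  rewrite (T_nbrs (i := i)).
Qed.

Let root_connect i v : c v = Some i ->
  connect (remove T (inl x0)) (inr (r i)) v.
Proof.
move=> cv; have := tree_component (Wt i) v; rewrite in_partsE cv eqxx.
apply: connect_sub => {cv}v u /W_adj[cv cu vu]; apply: connect1.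
by rewrite /remove vu -!c_None cv cu.
Qed.

(** A cycle off [x0] stays in one of the [W i]; a cycle through [x0] would leave
    and reach it by two branches that are joined off [x0], hence by only one. *)
Let T_acyclic : acyclic (adj T).
Proof.
move=> s uniq_s cycle_s; have [x0s|x0s] := boolP (inl x0 \in s).
  have [n p rotE] := rot_to x0s.
  rewrite -(size_rot n) rotE; rewrite -(rot_cycle n) rotE in cycle_s.
  rewrite -(rot_uniq n) rotE in uniq_s.
  case: p => // v p in uniq_s cycle_s {rotE} *; have /andP[x0_p uniq_p] := uniq_s.
  move: cycle_s; rewrite /= rcons_path => /and3P[x0v path_p lastx0].
  case: v => // y in x0v path_p x0_p uniq_p lastx0 {uniq_s} *.
  have [i yE] := cyclic_enumP _ T_enum x0v.
  have off_p : path (remove T (inl x0)) (inr y) p.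
    rewrite (path_avoiding _ (u := inl x0)) // path_p.
    by apply: contraNN x0_p => x0_p; rewrite in_cons x0_p orbT.
  have off_last : c (last (inr y) p) = Some i.
    have <- : c (inr y) = Some i by rewrite yE c_root.
    by elim: (p) (inr y) off_p => //= u q IHq v /andP[/off_color-> /IHq].
  case lastE: (last _ _) lastx0 off_last => [//|y'] /= x0y' cy'.
  have [j y'E] := cyclic_enumP _ T_enum x0y'.
  have ij : i = j by move: cy'; rewrite y'E c_root => -[].
  case/lastP: p => // p v in lastE uniq_p {x0_p path_p off_p} *.
  move: lastE; rewrite last_rcons => vE; move: uniq_p.
  by rewrite /= vE y'E yE ij mem_rcons in_cons eqxx.
case: s => // v s in uniq_s cycle_s x0s *.
have vx0 : v != inl x0.
  by apply: contraNneq x0s => ->; rewrite mem_head.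
case cv: (c v) => [i|]; last by move/eqP: cv vx0; rewrite c_None => ->.
apply: (forest_acyclic (Wt i)) => //; apply: off_path cv.
rewrite (path_avoiding _ (u := inl x0)) // [path _ _ _]cycle_s mem_rcons.
by move: x0s; rewrite in_cons.
Qed.

Lemma assembled_CTXY : assembled \in CTXY k X Y.
Proof.
have r0 : r ord0 \in nbrs T x0 by apply: (cyclic_enum_in _ T_enum).
suff : (T, r ord0) \in CTY k X Y by rewrite !inE /= r0 andbT.
rewrite -CTY_onT; apply/CTY_onP; split=> [|v|x]; last by rewrite inE.
  split=> // [x|x y].
    case cx: (c (inl x)) => [i|].
      rewrite (T_nbrs cx) (T_next cx); exact: (forest_order (Wt i)).
    move/eqP: cx; rewrite c_None => /eqP[->].
    exact: cyclic_enum_order T_enum.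
  case cx: (c (inl x)) => [i|] _.
    by rewrite (T_nbrs cx) (tree_card (Wt i)) // inE cx.
  move/eqP: cx; rewrite c_None => /eqP[->].
  exact: cyclic_enum_card T_enum.
have -> : in_parts setT setT v by case: v => v; rewrite /= inE.
have from_x0 u : connect (adj T) (inl x0) u.
  have [->|ux0] := eqVneq u (inl x0); first exact: connect0.
  case cu: (c u) => [i|]; last by move/eqP: cu ux0; rewrite c_None => ->.
  apply: (connect_trans (y := inr (r i))).
    apply: connect1; exact: (cyclic_enum_in i T_enum).
  exact: (avoiding_connect (root_connect cu)).
apply: (connect_trans (y := inl x0)) => //.
by rewrite (sym_connect_sym (@adj_sym _ _ _)).
Qed.

Lemma assembled_branch i : branch assembled i = r i.
Proof. exact: (nbr_at_enum T_enum). Qed.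

Lemma assembled_color : color k assembled =1 c.
Proof.
move=> v; have [->|vx0] := eqVneq v (inl x0).
  by rewrite c_x0; apply/eqP; rewrite color_None.
case cv: (c v) => [i|]; last by move/eqP: cv vx0; rewrite c_None => ->.
apply: (color_connect assembled_CTXY); rewrite assembled_branch.
exact: root_connect.
Qed.

Lemma assembled_subtree : subtree assembled =1 W.
Proof.
move=> i; rewrite /subtree assembled_branch [RHS]surjective_pairing.
congr (_, _).
suff eqNf x : nbrs (restrict T (blacks (color k assembled) i)) x = nbrs (W i).1 x /\
    next_nbr (restrict T (blacks (color k assembled) i)) x = next_nbr (W i).1 x.
  by apply: coding_data_eq => [x|x y]; have [eqN eqf] := eqNf x; rewrite ?eqN ?eqf.
rewrite restrict_nbrs restrict_next inE assembled_color.
case: eqP => [cx|/eqP cx]; first by rewrite (T_nbrs cx) (T_next cx).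
have N0 : nbrs (W i).1 x = set0 by rewrite (tree_outside (Wt i)) // inE.
rewrite N0; split=> //; apply/ffunP=> y; rewrite ffunE.
by rewrite (forest_order (Wt i) x).1 // N0 inE.
Qed.

End Assemble.

(** * Relabelings and the action, subtree by subtree *)

Section FixedTrees.
Variables (k : nat) (X Y : finType).
Implicit Types (S : CTXY_data X Y) (i : 'I_k.+1).

Section Relabel.
Variables (mu : {perm X}) (nu : {perm Y}) (S : CTXY_data X Y).
Hypothesis S_CTXY : S \in CTXY k X Y.
Local Notation f := (emb_vertex mu nu).
Local Notation S' := (relabel_CTXY mu nu S).

Let S_emb : embeds mu nu setT S.1 S'.1.
Proof.
rewrite /= relabelE; apply: push_embeds => [||x]; try exact: perm_inj.
by rewrite inE.
Qed.

Lemma relabel_CTXY_in : S' \in CTXY k X Y.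
Proof.
have S_CTY : (S.1, S.2.2) \in CTY_on k setT setT.
  exact/CTY_onP/(CTXY_tree S_CTXY).
have := relabel_tree mu nu S_CTY.
have -> : mu @: setT = setT.
  by apply/setP=> x; rewrite inE -[x](permKV mu) imset_f ?inE.
have -> : nu @: setT = setT.
  by apply/setP=> y; rewrite inE -[y](permKV nu) imset_f ?inE.
rewrite CTY_onT !inE /= => ->; rewrite /nbrs ffunE permK.
by rewrite imset_f // (CTXY_root S_CTXY).
Qed.

Lemma relabel_branch i : branch S' i = nu (branch S i).
Proof.
have Tu := emb_enum S_emb (in_setT _)
  (forest_order (CTXY_forest relabel_CTXY_in) _).1 (branch_enum S_CTXY).
exact: (nbr_at_enum Tu).
Qed.

Lemma relabel_color v : color k S' (f v) = color k S v.
Proof.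
have f_inj : injective f := emb_inj S_emb.
case cv: (color k S v) => [i|]; last first.
  by apply/eqP; rewrite color_None (inj_eq f_inj _ (inl _)) -(color_None k) cv.
apply: (color_connect relabel_CTXY_in); rewrite relabel_branch.
move/eqP/(colorP S_CTXY): cv => /connectP[p + ->].
rewrite (path_avoiding _ (u := inl S.2.1)) // => /andP[path_p off_p].
rewrite -[inr _]/(f (inr (branch S i))) -last_map.
apply: (path_connect_remove (emb_path S_emb path_p)).
rewrite -[inl _]/(f (inl S.2.1)) -map_cons (mem_map f_inj) in_cons.
by rewrite negb_or off_p.
Qed.

Lemma relabel_subtree i : subtree S' i = relabel_CTY mu nu (subtree S i).
Proof.
rewrite relabel_CTYE /subtree relabel_branch /push_CTY; congr (_, _).
have in_mu x : (mu x \in blacks (color k S') i) = (x \in blacks (color k S) i).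
  by rewrite !inE -(relabel_color (inl x)).
have muP x : x \in codom mu by rewrite -[x](permKV mu) codom_f.
have nuP y : y \in codom nu by rewrite -[y](permKV nu) codom_f.
apply: push_eq => [||x|x y|x|x y]; try exact: perm_inj.
- rewrite !restrict_nbrs in_mu; case: ifP => _; last by rewrite imset0.
  exact: (emb_nbrs S_emb).
- rewrite !restrict_next in_mu; case: ifP => _; last by rewrite !ffunE.
  by rewrite /= /next_nbr !ffunE !permK.
- by rewrite muP.
by rewrite muP nuP.
Qed.

End Relabel.

Section Act.
Variables (s : 'S_k.+1) (S : CTXY_data X Y).
Hypothesis S_CTXY : S \in CTXY k X Y.
Local Notation S' := (act_CTXY s S).
Local Notation x0 := S.2.1.

Let x0E : S'.2.1 = x0. Proof. by case: (S) => T [x w]. Qed.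

Let NE x : nbrs S'.1 x = nbrs S.1 x. Proof. by case: (S) => T [x1 w]. Qed.

Let adjE : adj S'.1 = adj S.1. Proof. by case: (S) => T [x1 w]. Qed.

Let w0E : S'.2.2 = branch S ((s^-1)%g ord0). Proof. by case: (S) => T [x1 w]. Qed.

Let next0 : next_nbr S'.1 x0 = permute_nbrs S.1 x0 (branch S (ord0 : 'I_k.+1)) s.
Proof. by case: (S) => T [x1 w]; rewrite /next_nbr ffunE eqxx. Qed.

Let nextE i x : color k S (inl x) = Some i ->
  next_nbr S'.1 x = act_next (rho i s) S.1 (branch S i) x.
Proof.
move=> cx; have xx0 : x != x0.
  by apply: contra_eqN cx => /eqP->; rewrite /color eqxx.
have /(colorP S_CTXY) conn : color k S (inl x) == Some i by rewrite cx.
have Su := branch_enum S_CTXY; have Sf := CTXY_forest S_CTXY.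
have wE d : white_towards S.1 x0 (inl x) d = branch S i.
  exact: (white_towardsE _ (forest_acyclic Sf) (cyclic_enum_in i Su) conn).
have posE : pos_of k S.1 x0 S.2.2 (branch S i) = i by rewrite (pos_of_enum Su).
rewrite /act_next; move: xx0 wE posE {cx conn Su Sf}.
case: (S) => T [x1 w] /= xx1 wE posE; rewrite /next_nbr ffunE (negPf xx1) wE.
by rewrite posE.
Qed.

Let S_emb i : embeds id id (blacks (color k S) i) (subtree S i).1 S.1.
Proof.
split=> // [x|x y|x].
- by rewrite restrict_nbrs imset_id => ->.
- by rewrite restrict_next => ->.
by rewrite restrict_nbrs => /negPf->.
Qed.

Let act_subtree i := act_CTY (rho i s) (subtree S i).

Let sub_next i x : color k S (inl x) = Some i ->
  next_nbr S'.1 x = next_nbr (act_subtree i).1 x.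
Proof.
move=> cx; have Si := CTY_onP _ _ _ _ (subtree_tree S_CTXY i).
have emb := emb_act (rho i s) (S_emb i) (CTXY_forest S_CTXY) Si.
have xA : x \in blacks (color k S) i by rewrite inE cx.
rewrite (nextE cx); apply/ffunP=> y; rewrite act_nextF.
have [xy|xy] := boolP (y \in nbrs (subtree S i).1 x).
  by have := emb_next emb xA xy; rewrite !act_nextF.
by move: (xy); rewrite restrict_nbrs xA => xy'; rewrite !ffunE (negPf xy) (negPf xy').
Qed.

Lemma act_CTXY_in : S' \in CTXY k X Y.
Proof.
have Su := branch_enum S_CTXY.
have S'w : S'.2.2 \in nbrs S'.1 S'.2.1.
  by rewrite x0E NE w0E (cyclic_enum_in _ Su).
suff : (S'.1, S'.2.2) \in CTY k X Y by rewrite !inE S'w andbT.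
have [[acyc ord card] comp out] := CTXY_tree S_CTXY S'.2.2.
rewrite -CTY_onT; apply/CTY_onP; split=> [|v|x]; last by rewrite inE.
  split=> [|x|x y]; rewrite ?adjE ?NE //; last exact: card.
  have [->|xx0] := eqVneq x x0.
    rewrite -(NE x0); exact: (cyclic_enum_order (permuted_enum Su (NE x0) next0)).
  case cx: (color k S (inl x)) => [i|]; last first.
    by move/eqP: cx xx0; rewrite color_None => /eqP[->]; rewrite eqxx.
  have Si := CTY_onP _ _ _ _ (subtree_tree S_CTXY i).
  have := forest_order (act_tree (rho i s) Si) x.
  rewrite (sub_next cx) => ordi; suff -> : nbrs S.1 x = nbrs (act_subtree i).1 x by [].
  by rewrite [RHS]restrict_nbrs inE cx eqxx.
by rewrite adjE comp.
Qed.

Lemma act_branch i : branch S' (s i) = branch S i.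
Proof.
rewrite /branch w0E x0E.
by rewrite (nbr_at_permuted (branch_enum S_CTXY) (NE x0) next0) permK.
Qed.

Lemma act_color v : color k S' v = omap s (color k S v).
Proof.
case cv: (color k S v) => [i|] /=; last first.
  by apply/eqP; rewrite color_None x0E -(color_None k) cv.
apply: (color_connect act_CTXY_in); rewrite act_branch x0E.
move/eqP/(colorP S_CTXY): cv; rewrite (eq_connect (e' := remove S'.1 (inl x0))) //.
by move=> u u'; rewrite /remove adjE.
Qed.

Lemma act_subtreeE i :
  subtree S' (s i) = act_CTY (rho i s) (subtree S i).
Proof.
rewrite [RHS]surjective_pairing /subtree act_branch; congr (_, _).
have in_s x : (x \in blacks (color k S') (s i)) = (x \in blacks (color k S) i).
  rewrite !inE act_color; case: (color k S _) => //= j.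
  by rewrite /eq_op /= (inj_eq perm_inj).
suff eqNf x :
    nbrs (restrict S'.1 (blacks (color k S') (s i))) x = nbrs (act_subtree i).1 x /\
    next_nbr (restrict S'.1 (blacks (color k S') (s i))) x =
    next_nbr (act_subtree i).1 x.
  by apply: coding_data_eq => [x|x y]; have [eqN eqf] := eqNf x; rewrite ?eqN ?eqf.
rewrite restrict_nbrs restrict_next in_s NE [nbrs (act_subtree i).1 x]restrict_nbrs.
split=> //; case: ifPn => [|xA]; first by rewrite inE => /eqP/sub_next.
have Si := CTY_onP _ _ _ _ (subtree_tree S_CTXY i).
by rewrite act_nextF (act_next_out _ Si) // restrict_next (negPf xA).
Qed.

End Act.

(** The subtree at position [s i] of the image of [S] comes from the subtree at
    position [i] of [S]. As the colors of the image are those of [S], it is equal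
    to [S] as soon as its subtrees are ([subtree_inj]). *)
Lemma fixed_CTXYP (s : 'S_k.+1) (mu : {perm X}) (nu : {perm Y}) S :
    S \in CTXY k X Y ->
    (forall v, color k S (emb_vertex mu nu v) = omap s (color k S v)) ->
  reflect (forall i, subtree S (s i) =
                     act_CTY (rho i s) (relabel_CTY mu nu (subtree S i)))
          (act_CTXY s (relabel_CTXY mu nu S) == S).
Proof.
move=> SP equiv; have rP := relabel_CTXY_in mu nu SP.
have actE i : subtree (act_CTXY s (relabel_CTXY mu nu S)) (s i) =
    act_CTY (rho i s) (relabel_CTY mu nu (subtree S i)).
  by rewrite act_subtreeE // relabel_subtree.
apply: (iffP eqP) => [fixS i|subE]; first by rewrite -actE fixS.
apply: (subtree_inj (act_CTXY_in s rP) SP) => [v|i]; last first.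
  by rewrite -[i](permKV s) actE subE.
rewrite act_color //; have [f fK] : {f | cancel f (emb_vertex mu nu)}.
  exists (emb_vertex (mu^-1)%g (nu^-1)%g).
  by case=> z; rewrite /= permKV.
by rewrite -[v]fK relabel_color // equiv.
Qed.

Lemma fixed_CTXY_color (s : 'S_k.+1) (mu : {perm X}) (nu : {perm Y}) S v :
    S \in CTXY k X Y -> act_CTXY s (relabel_CTXY mu nu S) = S ->
  color k S (emb_vertex mu nu v) = omap s (color k S v).
Proof.
move=> SP fixS; rewrite -{1}fixS act_color ?relabel_color //.
exact: relabel_CTXY_in.
Qed.

End FixedTrees.

(** * Families that follow the cycles of a permutation *)

Section CycleReps.
Variables (I : finType) (s : {perm I}) (rep : I -> I).

Definition cycle_reps :=
  (forall i, rep i \in porbit s i) /\ (forall i j, j \in porbit s i -> rep j = rep i).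

Hypothesis reps : cycle_reps.

Definition cycle_len i := #|porbit s i|.

Definition rep_dist i := index i (traject s (rep i) (cycle_len i)).

Lemma repK i : rep (rep i) = rep i.
Proof. by apply: reps.2; apply: reps.1. Qed.

Lemma rep_perm i : rep (s i) = rep i.
Proof. by apply: reps.2; have := mem_porbit s 1 i; rewrite expg1. Qed.

Lemma rep_iter n i : rep (iter n s i) = rep i.
Proof. by elim: n => //= n; rewrite rep_perm. Qed.

Lemma porbit_rep i : porbit s (rep i) = porbit s i.
Proof. by apply/eqP; rewrite eq_porbit_mem reps.1. Qed.

Lemma cycle_len_rep i : cycle_len (rep i) = cycle_len i.
Proof. by rewrite /cycle_len porbit_rep. Qed.

Lemma cycle_len_perm i : cycle_len (s i) = cycle_len i.
Proof. by rewrite -cycle_len_rep rep_perm cycle_len_rep. Qed.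

Lemma cycle_len_gt0 i : 0 < cycle_len i.
Proof. by apply/card_gt0P; exists i; apply: porbit_id. Qed.

Lemma iter_cycle_len i : iter (cycle_len i) s i = i.
Proof. exact: iter_porbit. Qed.

Let rep_traject i : i \in traject s (rep i) (cycle_len i).
Proof. by rewrite -cycle_len_rep -porbit_traject porbit_rep porbit_id. Qed.

Lemma rep_dist_lt i : rep_dist i < cycle_len i.
Proof. by have := rep_traject i; rewrite -index_mem size_traject. Qed.

Lemma iter_rep_dist i : iter (rep_dist i) s (rep i) = i.
Proof.
by rewrite -(nth_traject s (rep_dist_lt i)) nth_index // rep_traject.
Qed.

Lemma rep_dist_iter n i : rep i = i -> n < cycle_len i -> rep_dist (iter n s i) = n.
Proof.
move=> ri ltn; rewrite /rep_dist rep_iter ri.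
have -> : cycle_len (iter n s i) = cycle_len i.
  by elim: (n) => //= m IHm; rewrite cycle_len_perm.
by rewrite -(nth_traject s ltn) index_uniq ?size_traject // uniq_traject_porbit.
Qed.

Lemma rep_dist_rep i : rep_dist (rep i) = 0.
Proof. by rewrite (@rep_dist_iter 0) ?repK ?cycle_len_gt0. Qed.

Lemma rep_dist_perm i :
  if rep i == s i then (rep_dist i).+1 = cycle_len i
  else rep_dist (s i) = (rep_dist i).+1.
Proof.
have siE : s i = iter (rep_dist i).+1 s (rep i) by rewrite iterS iter_rep_dist.
have lt_i := rep_dist_lt i.
have [eq_len|neq_len] := eqVneq (rep_dist i).+1 (cycle_len i).
  by rewrite {1}siE eq_len -cycle_len_rep iter_cycle_len eqxx.
have lt_i1 : (rep_dist i).+1 < cycle_len (rep i).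
  by rewrite cycle_len_rep ltn_neqAle neq_len.
have := rep_dist_iter (repK i) lt_i1; rewrite -siE => distE.
case: eqP => // rs; have := rep_dist_rep i; by rewrite rs distE.
Qed.

Section Families.
Variables (E : finType) (Q : I -> {set E}) (F : I -> E -> E).
Hypothesis F_in : forall i w, w \in Q i -> F i w \in Q (s i).

Fixpoint along n i w := if n is n'.+1 then F (iter n' s i) (along n' i w) else w.

Lemma along_in n i w : w \in Q i -> along n i w \in Q (iter n s i).
Proof. by move=> wQ; elim: n => //= n IHn; apply: F_in. Qed.

(** The family is determined by its value at each representative [i], and going
    once around the cycle of [i] leaves a single condition on this value. *)
Lemma card_cycle_families :
  #|[set W : {ffun I -> E} | [forall i, (W i \in Q i) && (W (s i) == F i (W i))]]| =
  \prod_(i | rep i == i) #|[set w in Q i | along (cycle_len i) i w == w]|.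
Proof.
pose fixed i := [set w in Q i | along (cycle_len i) i w == w].
(* [None] is the default value at the indices that are not representatives. *)
pose res (W : {ffun I -> E}) := [ffun i => if rep i == i then Some (W i) else None].
set A := [set W | _]; have AP W : W \in A ->
    (forall i, W i \in Q i) /\ (forall i, W (s i) = F i (W i)).
  by rewrite inE => /forallP WA; split=> i; have /andP[? /eqP] := WA i.
have W_along W n i : W \in A -> along n i (W i) = W (iter n s i).
  by case/AP=> _ WF; elim: n => //= n ->; rewrite WF.
have res_inj : {in A &, injective res}.
  move=> W W' WA WA' eqW; apply/ffunP=> i.
  rewrite -(iter_rep_dist i) -!W_along //; congr along.
  by have /ffunP/(_ (rep i)) := eqW; rewrite !ffunE repK eqxx => -[].
rewrite -(card_in_imset res_inj).
have -> : \prod_(i | rep i == i) #|fixed i| =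
    #|pfamily None [pred i | rep i == i] (fun i => mem (Some @: fixed i))|.
  rewrite card_pfamily foldrE big_image.
  by apply: eq_big => [i|i _]; rewrite ?inE // card_imset //; apply: Some_inj.
apply: eq_card => f; apply/imsetP/pfamilyP=> [[W WA ->]|[suppf fP]].
  have [WQ _] := AP _ WA; split=> [|i].
    by apply/subsetP=> i; rewrite !inE ffunE; case: ifP.
  rewrite !inE ffunE => ri; rewrite ri imset_f // inE WQ W_along //.
  by rewrite iter_cycle_len eqxx.
have {}fP i : {w | f (rep i) = Some w & w \in fixed (rep i)}.
  have := fP (rep i); rewrite inE repK eqxx => /(_ isT).
  case: (f (rep i)) => [w|] wf; last by exfalso; case/imsetP: wf.
  by exists w => //; have /imsetP[w' w'f [->]] := wf.
pose w i := s2val (fP i).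
have wf i : w i \in fixed (rep i) by rewrite /w; case: (fP i).
have fE i : f (rep i) = Some (w i) by rewrite /w; case: (fP i).
have wE i j : rep i = rep j -> w i = w j.
  by move=> eq_ij; apply: Some_inj; rewrite -!fE eq_ij.
exists [ffun i => along (rep_dist i) (rep i) (w i)].
  rewrite inE; apply/forallP=> i; rewrite !ffunE; apply/andP; split.
    have := wf i; rewrite inE => /andP[wQ _].
    by have := along_in (rep_dist i) wQ; rewrite iter_rep_dist.
  rewrite rep_perm (wE (s i) i) ?rep_perm //.
  have := rep_dist_perm i; case: ifP => [/eqP rs len_i|_ ->]; last first.
    by rewrite /= iter_rep_dist.
  rewrite -rs rep_dist_rep /=.
  have -> : F i (along (rep_dist i) (rep i) (w i)) =
      along (rep_dist i).+1 (rep i) (w i) by rewrite /= iter_rep_dist.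
  by have := wf i; rewrite inE cycle_len_rep len_i => /andP[_ /eqP->].
apply/ffunP=> i; rewrite !ffunE; case: eqP => [ri|/eqP nri].
  by have := rep_dist_rep i; rewrite ri => ->; rewrite /= -fE ri.
have := subsetP suppf i; rewrite inE; case: eqP => [-> //|_ /(_ isT)].
by rewrite inE (negPf nri).
Qed.

End Families.

End CycleReps.

Section ColoredFixedTrees.
Variables (k : nat) (s : 'S_k.+1) (rep : 'I_k.+1 -> 'I_k.+1).
Hypothesis reps : cycle_reps s rep.
Variables (X Y : finType) (mu : {perm X}) (nu : {perm Y}) (x0 : X).
Variable c : X + Y -> option 'I_k.+1.
Hypothesis c_None : forall v, (c v == None) = (v == inl x0).
Hypothesis c_equiv : forall v, c (emb_vertex mu nu v) = omap s (c v).

Let Q i : {set CTY_data X Y} := CTY_on k (blacks c i) (whites c i).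
Let F i (w : CTY_data X Y) := act_CTY (rho i s) (relabel_CTY mu nu w).

Let s_some v i : (omap s v == Some (s i)) = (v == Some i).
Proof. by case: v => //= j; rewrite /eq_op /= (inj_eq perm_inj). Qed.

Let blacksE i : blacks c (s i) = mu @: blacks c i.
Proof.
apply/setP=> x; rewrite -[x](permKV mu) (mem_imset _ _ perm_inj) !inE.
by have := c_equiv (inl ((mu^-1)%g x)); rewrite /= => ->; rewrite s_some.
Qed.

Let whitesE i : whites c (s i) = nu @: whites c i.
Proof.
apply/setP=> y; rewrite -[y](permKV nu) (mem_imset _ _ perm_inj) !inE.
by have := c_equiv (inr ((nu^-1)%g y)); rewrite /= => ->; rewrite s_some.
Qed.

Let F_in i w : w \in Q i -> F i w \in Q (s i).
Proof.
by move=> wQ; rewrite /Q blacksE whitesE act_CTY_on // relabel_tree.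
Qed.

Lemma rho_prod_fix0 l : 0 < size l -> rho_prod s l ord0 = ord0.
Proof.
case: l => //= i l _; rewrite /rho_prod big_cons permM rho_fix0.
elim: l => [|j l IHl]; first by rewrite big_nil perm1.
by rewrite big_cons permM rho_fix0.
Qed.

Let alongE n i w : w \in Q i -> along s F n.+1 i w =
  act_CTY (rho_prod s (traject s i n.+1))
    (relabel_CTY (mu ^+ n.+1)%g (nu ^+ n.+1)%g w).
Proof.
move=> wQ; elim: n => [|n IHn]; first by rewrite /= /rho_prod big_seq1 !expg1.
rewrite -[along _ _ n.+2 _ _]/(F (iter n.+1 s i) (along s F n.+1 i w)) {}IHn /F.
set n1 := n.+1.
have relQ : relabel_CTY (mu ^+ n1)%g (nu ^+ n1)%g w
    \in CTY_on k ((mu ^+ n1)%g @: blacks c i) ((nu ^+ n1)%g @: whites c i).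
  exact: relabel_tree.
rewrite -(relabel_act _ _ _ relQ) relabel_CTYM -(expgSr mu n1) -(expgSr nu n1).
rewrite [traject s i n1.+1]trajectSr /rho_prod big_rcons.
have : relabel_CTY (mu ^+ n1.+1)%g (nu ^+ n1.+1)%g w
    \in CTY_on k ((mu ^+ n1.+1)%g @: blacks c i) ((nu ^+ n1.+1)%g @: whites c i).
  exact: relabel_tree.
case: (relabel_CTY _ _ w) => T r /CTY_onP Tr; apply: (act_CTYM _ Tr).
by apply: rho_prod_fix0; rewrite size_traject.
Qed.

(** The subtrees along a cycle of [s] are determined by the one at the
    representative; going once around the cycle iterates the relabeling and
    composes the [rho i s] in the order of the cycle. *)
Lemma card_colored_fixed :
  #|[set S in CTXY k X Y | [forall v, color k S v == c v]
       & act_CTXY s (relabel_CTXY mu nu S) == S]| =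
  \prod_(i | rep i == i)
    #|[set W in Q i | act_CTY (rho_prod s (traject s i (cycle_len s i)))
        (relabel_CTY (mu ^+ cycle_len s i)%g (nu ^+ cycle_len s i)%g W) == W]|.
Proof.
transitivity (\prod_(i | rep i == i)
    #|[set w in Q i | along s F (cycle_len s i) i w == w]|); last first.
  apply: eq_bigr => i _; apply: eq_card => w; rewrite !inE.
  case: (boolP (asbool _)) => //= wQ.
  have := cycle_len_gt0 s i; case: (cycle_len s i) => // n _.
  by rewrite alongE // inE.
rewrite -(card_cycle_families reps F_in).
set A := [set S in CTXY k X Y | _ & _]; set B := [set W | _].
have AP S : S \in A -> [/\ S \in CTXY k X Y, color k S =1 c
    & act_CTXY s (relabel_CTXY mu nu S) == S].
  rewrite in_set => /and3P[-> /forallP cS ->]; split=> // v.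
  by apply/eqP.
pose subtrees S : {ffun 'I_k.+1 -> CTY_data X Y} := [ffun i => subtree S i].
have subtrees_inj : {in A &, injective subtrees}.
  move=> S S' SA SA' eqS; have [SP cS _] := AP S SA; have [SP' cS' _] := AP S' SA'.
  apply: (subtree_inj SP SP') => [v|i]; first by rewrite cS cS'.
  by have /ffunP/(_ i) := eqS; rewrite !ffunE.
rewrite -(card_in_imset subtrees_inj); apply: eq_card => W.
have eq_parts S : color k S =1 c -> forall i,
    (blacks (color k S) i = blacks c i) * (whites (color k S) i = whites c i).
  by move=> cS i; split; apply/setP=> z; rewrite !inE cS.
apply/imsetP/idP=> [[S /AP[SP cS fixS] ->]|].
  have cSe v : color k S (emb_vertex mu nu v) = omap s (color k S v).
    by rewrite !cS c_equiv.
  rewrite inE; apply/forallP=> i; rewrite !ffunE.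
  have := subtree_tree SP i; rewrite !(eq_parts S cS) => -> /=.
  by rewrite (fixed_CTXYP SP cSe fixS).
rewrite inE => /forallP WP.
have WQ i : W i \in CTY_on k (blacks c i) (whites c i) by case/andP: (WP i).
have SP := assembled_CTXY c_None WQ; set S := assembled x0 c W in SP *.
have cS : color k S =1 c := assembled_color c_None WQ.
have subS : subtree S =1 W := assembled_subtree c_None WQ.
exists S; last by apply/ffunP=> i; rewrite ffunE subS.
rewrite in_set SP /=; apply/andP; split; first by apply/forallP=> v; rewrite cS.
apply/(fixed_CTXYP SP) => [v|i]; first by rewrite !cS c_equiv.
by rewrite !subS; case/andP: (WP i) => _ /eqP.
Qed.

End ColoredFixedTrees.

(** * Frames of colored permutations *)

Section Frames.
Variables (I : finType) (s : {perm I}) (rep : I -> I).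
Hypothesis reps : cycle_reps s rep.
Variable m : I -> nat.
Hypothesis m_perm : forall i, m (s i) = m i.

Local Notation D := {i : I & 'I_(m i)}.

Lemma box_eq (u v : D) : tag u = tag v -> tagged u = tagged v :> nat -> u = v.
Proof.
case: u v => i a [j b] /= eq_ij; case: _ / eq_ij b => b /= eq_ab.
by congr Tagged; apply: val_inj.
Qed.

Lemma boxed_inj i : injective (fun a : 'I_(m i) => Tagged (fun i => 'I_(m i)) a).
Proof.
move=> a b eq_ab; apply: val_inj.
exact: (congr1 (fun w : D => nat_of_ord (tagged w)) eq_ab).
Qed.

Definition box_shift (u : D) : D :=
  Tagged (fun i => 'I_(m i)) (cast_ord (esym (m_perm (tag u))) (tagged u)).

Lemma box_shift_inj : injective box_shift.
Proof.
move=> u v eq_uv; have /= /perm_inj := congr1 tag eq_uv => eq_tag.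
by apply: box_eq => //; have := congr1 (fun w : D => nat_of_ord (tagged w)) eq_uv.
Qed.

Lemma m_rep i : m (rep i) = m i.
Proof.
rewrite -{2}(iter_rep_dist reps i); elim: (rep_dist _ _ _) => //= n ->.
by rewrite m_perm.
Qed.

Definition box_rep (u : D) : D :=
  Tagged (fun i => 'I_(m i)) (cast_ord (esym (m_rep (tag u))) (tagged u)).

Lemma box_rep_shift u : box_rep (box_shift u) = box_rep u.
Proof. by apply: box_eq; rewrite /= ?(rep_perm reps). Qed.

Lemma box_shift_onto u : exists v, u = box_shift v.
Proof. by exists (invF box_shift_inj u); rewrite f_invF. Qed.

(** The possible return permutations at all the representatives, gathered into one
    permutation of the boxes. *)
Definition box_perms : {set {perm D}} :=
  [set h : {perm D} | [forall u, (tag (h u) == tag u) &&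
                      ((rep (tag u) == tag u) || (h u == u))]].

Lemma box_permsP (h : {perm D}) :
  reflect ((forall u, tag (h u) = tag u) /\
           (forall u, rep (tag u) != tag u -> h u = u)) (h \in box_perms).
Proof.
rewrite inE; apply: (iffP forallP) => [hP|[tag_h h_off] u].
  split=> u; have /andP[/eqP tag_h h_off] := hP u => // nru.
  by move: h_off; rewrite (negPf nru) => /eqP.
rewrite tag_h eqxx; case: eqP => //= /eqP nru; exact/eqP/h_off.
Qed.

Variable X : finType.
Implicit Types (Phi : {ffun D -> X}) (h : {perm D}) (mu : {perm X}).
Implicit Types (g : {ffun X -> I}).

(** A frame [Phi] numbers the elements of each color, in such a way that [mu]
    keeps the numbers; what it does to them when it returns to a representative
    is recorded by [h]. *)
Definition framed Phi h mu g :=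
  [&& injectiveb Phi, h \in box_perms
    & [forall u, (g (Phi u) == tag u) && (mu (Phi u) == Phi (h (box_shift u)))]].

Definition colored mu g :=
  [forall x, g (mu x) == s (g x)] && [forall i, #|[set x | g x == i]| == m i].

Lemma framedP Phi h mu g :
  reflect [/\ injective Phi, h \in box_perms, forall u, g (Phi u) = tag u
            & forall u, mu (Phi u) = Phi (h (box_shift u))] (framed Phi h mu g).
Proof.
apply: (iffP and3P) => [[/injectiveP Phi_inj h_box /forallP Phi_fr]|].
  by split=> // u; have /andP[/eqP? /eqP?] := Phi_fr u.
case=> Phi_inj h_box gPhi muPhi; split=> //; first exact/injectiveP.
by apply/forallP=> u; rewrite gPhi muPhi !eqxx.
Qed.

Lemma card_box : #|{: D}| = \sum_i m i.
Proof. by rewrite card_tagged sumnE big_map big_enum; under eq_bigr do rewrite card_ord. Qed.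

Lemma box_bij Phi : #|X| = #|{: D}| -> injective Phi -> bijective Phi.
Proof. by move=> cardX Phi_inj; apply: inj_card_bij; rewrite ?cardX. Qed.

Lemma colored_card mu g : colored mu g -> #|X| = #|{: D}|.
Proof.
case/andP=> _ /forallP/(_ _)/eqP card_g.
rewrite card_box -sum1_card (partition_big g predT) //=.
by apply: eq_bigr => i _; rewrite -card_g -sum1dep_card.
Qed.

Lemma framed_colored Phi h mu g : #|X| = #|{: D}| ->
  framed Phi h mu g -> colored mu g.
Proof.
move=> cardX /framedP[Phi_inj /box_permsP[tag_h _] gPhi muPhi].
have [Psi PhiK PsiK] := box_bij cardX Phi_inj.
apply/andP; split; apply/forallP=> z.
  by rewrite -[z]PsiK muPhi !gPhi tag_h.
apply/eqP; rewrite -[RHS]card_ord.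
have -> : [set x | g x == z] = [set Phi (Tagged (fun i => 'I_(m i)) a) | a : 'I_(m z)].
  apply/setP=> x; rewrite inE; apply/eqP/imsetP=> [gx|[a _ ->]]; last exact: gPhi.
  rewrite -{}[x]PsiK gPhi in gx *; case: (Psi x) gx => i a /= eq_iz.
  by case: _ / eq_iz; exists a.
by rewrite card_imset // => a b /Phi_inj/boxed_inj.
Qed.

Lemma framed_uniq Phi h mu g mu' g' : #|X| = #|{: D}| ->
  framed Phi h mu g -> framed Phi h mu' g' -> mu = mu' /\ g = g'.
Proof.
move=> cardX /framedP[Phi_inj _ gPhi muPhi] /framedP[_ _ gPhi' muPhi'].
have [Psi PhiK PsiK] := box_bij cardX Phi_inj.
by split; [apply/permP|apply/ffunP] => x; rewrite -[x]PsiK ?muPhi ?gPhi.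
Qed.

Lemma framed_exists Phi h : #|X| = #|{: D}| -> injective Phi -> h \in box_perms ->
  exists mu, exists g, framed Phi h mu g.
Proof.
move=> cardX Phi_inj h_box; have [Psi PhiK PsiK] := box_bij cardX Phi_inj.
have mu_inj : injective (fun x => Phi (h (box_shift (Psi x)))).
  move=> x y /Phi_inj/perm_inj/box_shift_inj; exact: (can_inj PsiK).
exists (perm mu_inj), [ffun x => tag (Psi x)]; apply/framedP.
by split=> // u; rewrite ?permE ?ffunE PhiK.
Qed.

(** The numbering is arbitrary at the representatives, from where [mu] propagates
    it along the cycles of [s]; and there are as many numberings as return
    permutations. *)
Lemma card_frames mu g : colored mu g ->
  #|[set p : {ffun D -> X} * {perm D} | framed p.1 p.2 mu g]| = #|box_perms|.
Proof.
move=> col; have cardX := colored_card col.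
have /andP[/forallP/(_ _)/eqP g_mu /forallP/(_ _)/eqP card_g] := col.
have g_iter n x : g (iter n mu x) = iter n s (g x) by elim: n => //= n <-.
have [Phi0 Phi0_inj gPhi0] : exists2 Phi : {ffun D -> X},
    injective Phi & forall u, g (Phi u) = tag u.
  exists [ffun u => enum_val (cast_ord (esym (card_g (tag u))) (tagged u))].
    move=> u v; rewrite !ffunE => eq_uv.
    have eq_tag : tag u = tag v.
      have /eqP <- : g (enum_val (cast_ord (esym (card_g (tag u))) (tagged u))) == tag u.
        by have := enum_valP (cast_ord (esym (card_g (tag u))) (tagged u)); rewrite inE.
      have := enum_valP (cast_ord (esym (card_g (tag v))) (tagged v)).
      by rewrite inE eq_uv => /eqP.
    apply: box_eq => //.
    case: u v eq_uv eq_tag => i a [j b] /= + eq_ij; case: _ / eq_ij b => b.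
    by move/enum_val_inj/cast_ord_inj->.
  move=> u; rewrite ffunE.
  by have := enum_valP (cast_ord (esym (card_g (tag u))) (tagged u)); rewrite inE => /eqP.
have [Psi0 Phi0K Psi0K] := box_bij cardX Phi0_inj.
set A := [set p | _]; have AP p : p \in A -> framed p.1 p.2 mu g by rewrite inE.
(* A frame is determined by its values at the representatives. *)
have PhiE Phi h u : framed Phi h mu g ->
    Phi u = iter (rep_dist s rep (tag u)) mu (Phi (box_rep u)).
  case/framedP=> _ /box_permsP[_ h_off] _ muPhi.
  have [n] := ubnP (rep_dist s rep (tag u)); elim: n => // n IHn in u *.
  case distE: (rep_dist s rep (tag u)) => [|d] ltdn.
    congr (Phi _); apply: box_eq => //=.
    by rewrite -{1}(iter_rep_dist reps (tag u)) distE.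
  have [v uE] := box_shift_onto u.
  have := rep_dist_perm reps (tag v); rewrite -[s (tag v)]/(tag (box_shift v)) -uE.
  case: eqP => [ru|/eqP nru]; first by rewrite -ru (rep_dist_rep reps) in distE.
  rewrite distE => -[dE]; have nru' : rep (tag u) != tag u.
    by rewrite {1}uE /= (rep_perm reps).
  rewrite -{1}(h_off u nru') {1}uE -muPhi iterS dE (IHn v) -?dE //.
  by rewrite uE box_rep_shift.
(* The comparison with [Phi0] at the representatives, extended by the identity. *)
pose theta (p : {ffun D -> X} * {perm D}) : {ffun D -> D} :=
  [ffun u => if rep (tag u) == tag u then Psi0 (p.1 u) else u].
have theta_inj : {in A &, injective theta}.
  move=> [Phi h] [Phi' h'] /AP/= fr /AP/= fr' /ffunP eq_theta.
  have eq_Phi : Phi = Phi'.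
    apply/ffunP=> u; rewrite (PhiE _ _ _ fr) (PhiE _ _ _ fr'); congr iter.
    have := eq_theta (box_rep u); rewrite !ffunE /= (repK reps) eqxx.
    exact: (can_inj Psi0K).
  congr (_, _) => //; apply/permP=> u; have [v ->] := box_shift_onto u.
  case/framedP: fr' => Phi_inj _ _ muPhi'; case/framedP: fr => _ _ _ muPhi.
  by apply: Phi_inj; rewrite -muPhi' -eq_Phi muPhi.
rewrite -(card_in_imset theta_inj).
pose pfun_of (h : {perm D}) : {ffun D -> D} := [ffun u => h u].
have pfun_inj : injective pfun_of.
  by move=> h h' /ffunP eq_h; apply/permP=> u; have := eq_h u; rewrite !ffunE.
rewrite -[RHS](card_imset _ pfun_inj); apply: eq_card => t.
apply/imsetP/imsetP=> [[[Phi h] /AP/= fr ->]|[th th_box ->]].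
  have [Phi_inj _ gPhi _] := framedP _ _ _ _ fr.
  have th_inj : injective (theta (Phi, h)).
    move=> u v; rewrite !ffunE /=; case: ifP => ru; case: ifP => rv //.
    - by move/(can_inj Psi0K)/Phi_inj.
    - by move=> vE; rewrite -vE -gPhi0 Psi0K gPhi ru in rv.
    by move=> uE; rewrite uE -gPhi0 Psi0K gPhi rv in ru.
  exists (perm th_inj); last by apply/ffunP=> u; rewrite [RHS]ffunE permE.
  apply/box_permsP; split=> u; rewrite permE ffunE /=.
    by case: ifP => // _; rewrite -gPhi0 Psi0K gPhi.
  by move/negPf->.
have [tag_th th_off] := box_permsP _ th_box.
pose Phi : {ffun D -> X} :=
  [ffun u => iter (rep_dist s rep (tag u)) mu (Phi0 (th (box_rep u)))].
have gPhi u : g (Phi u) = tag u.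
  by rewrite ffunE g_iter gPhi0 tag_th /= iter_rep_dist.
have iter_inj n : injective (iter n mu) by elim: n => //= n IHn x y /perm_inj/IHn.
have Phi_inj : injective Phi.
  move=> u v eq_uv; have eq_tag : tag u = tag v by rewrite -!gPhi eq_uv.
  move: eq_uv; rewrite !ffunE eq_tag => /iter_inj/Phi0_inj/perm_inj eq_r.
  apply: box_eq => //.
  by have := congr1 (fun w : D => nat_of_ord (tagged w)) eq_r.
have [Psi PhiK PsiK] := box_bij cardX Phi_inj.
pose hf u := Psi (mu (Phi (invF box_shift_inj u))).
have hf_inj : injective hf.
  by move=> u v /(can_inj PsiK)/perm_inj/Phi_inj/(can_inj (f_invF box_shift_inj)).
have hfE u : Phi (hf (box_shift u)) = mu (Phi u) by rewrite /hf PsiK invF_f.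
have fr : framed Phi (perm hf_inj) mu g.
  apply/framedP; split=> // [|u]; last by rewrite permE hfE.
  apply/box_permsP; split=> u; have [v ->] := box_shift_onto u.
    by rewrite permE -gPhi hfE g_mu gPhi.
  rewrite permE /= => nrv; apply: Phi_inj; rewrite hfE !ffunE box_rep_shift.
  have := rep_dist_perm reps (tag v); rewrite -(rep_perm reps (tag v)) (negPf nrv).
  by move=> ->.
exists (Phi, perm hf_inj); first by rewrite inE.
apply/ffunP=> u; rewrite !ffunE /= ; case: eqP => [ru|/eqP/th_off //].
have -> : box_rep u = u by apply: box_eq.
by rewrite -ru (rep_dist_rep reps) Phi0K.
Qed.

End Frames.

Section FrameSum.
Variables (I : finType) (s : {perm I}) (rep : I -> I).
Hypothesis reps : cycle_reps s rep.
Variable m : I -> nat.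
Hypothesis m_perm : forall i, m (s i) = m i.
Variables (X : finType) (R : nmodType).

Local Notation D := {i : I & 'I_(m i)}.
Local Open Scope ring_scope.

(** The pairs of a colored permutation and one of its frames are counted in two
    ways: the number of frames of a colored permutation is given by
    [card_frames], and any injection [Phi] together with any [h] is a frame of
    exactly one colored permutation. *)
Lemma frame_sum (V : {perm X} -> {ffun X -> I} -> R) (K : {perm D} -> R) :
    #|X| = #|{: D}| ->
    (forall Phi h mu g, framed rep m_perm Phi h mu g -> V mu g = K h) ->
  (\sum_mu \sum_(g | colored s m mu g) V mu g) *+ #|box_perms rep m| =
  (\sum_(h in box_perms rep m) K h) *+ #|X| `!.
Proof.
move=> cardX VK; rewrite pair_big_dep /= -sumrMnl.
transitivity (\sum_(q | colored s m q.1 q.2)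
    \sum_(p : ({ffun D -> X} * {perm D})%type | framed rep m_perm p.1 p.2 q.1 q.2)
      V q.1 q.2).
  by apply: eq_bigr => q /(card_frames reps m_perm) <-; rewrite sumr_const cardsE.
rewrite (exchange_big_dep xpredT) //=.
transitivity (\sum_(p : ({ffun D -> X} * {perm D})%type
    | injectiveb p.1 && (p.2 \in box_perms rep m)) K p.2); last first.
  rewrite -(pair_big (fun Phi : {ffun D -> X} => injectiveb Phi)
    (mem (box_perms rep m)) (fun _ h => K h)) /= sumr_const; congr (_ *+ _).
  have := card_inj_ffuns {: D} X; rewrite -cardX ffactnn => <-.
  by apply: eq_card => Phi; rewrite inE.
rewrite [RHS]big_mkcond; apply: eq_bigr => -[Phi h] _ /=.
case: ifP => [/andP[/injectiveP Phi_inj h_box]|not_fr]; last first.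
  rewrite big1 // => -[mu g] /andP[_ /=]; case/framedP=> Phi_inj h_box _ _.
  by case/andP: not_fr; split=> //; apply/injectiveP.
have [mu [g fr]] := framed_exists m_perm cardX Phi_inj h_box.
rewrite (big_pred1 (mu, g)) => [|[mu' g']] /=; first exact: VK fr.
apply/andP/eqP=> [[_ fr']|[-> ->]].
  by have [-> ->] := framed_uniq cardX fr' fr.
by split=> //; apply: framed_colored fr.
Qed.

End FrameSum.

(** The dependent version of [bigA_distr_big_dep]. *)
Lemma bigA_distr_fprod (R : comPzSemiRingType) (I : finType) (T_ : I -> finType)
    (Q : forall i, pred (T_ i)) (F : forall i, T_ i -> R) :
  (\prod_i \sum_(j | Q i j) F i j =
   \sum_(t : fprod T_ | [forall i, Q i (t i)]) \prod_i F i (t i))%R.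
Proof.
pose G i := [ffun j => if Q i j then F i j else 0%R].
transitivity (\sum_(t : fprod T_) \prod_(i in I) G i (t i))%R; last first.
  rewrite [RHS]big_mkcond; apply: eq_bigr => t _; case: ifP => [/forallP Qt|].
    by apply: eq_bigr => i _; rewrite ffunE Qt.
  move/negbT; rewrite negb_forall => /existsP[i nQ].
  by rewrite (bigD1 i) //= ffunE (negPf nQ) mul0r.
rewrite big_fprod -(bigA_distr_big_dep _ (fun i => untag 0%R (G i))) /=.
apply: eq_bigr => i _.
rewrite big_mkcond; apply: etrans (big_tag (fun i j => G i j) i).
by apply: eq_bigr => j _; rewrite ffunE.
Qed.

Section BoxPerms.
Variables (I : finType) (rep : I -> I) (m : I -> nat).
Local Notation D := {i : I & 'I_(m i)}.
Local Notation boxed := (Tagged (fun i => 'I_(m i))).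
Local Notation perms := (fprod (fun i => {perm 'I_(m i)} : finType)).

Lemma box_perm_inj (p : perms) :
  injective (fun u : D => boxed (p (tag u) (tagged u))).
Proof.
move=> u v eq_uv; have eq_tag : tag u = tag v := congr1 tag eq_uv.
apply: box_eq => //; case: u v eq_tag eq_uv => i a [j b] /= eq_ij.
by case: _ / eq_ij b => b /boxed_inj/perm_inj ->.
Qed.

Definition box_perm (p : perms) : {perm D} := perm (@box_perm_inj p).

Definition rep_perms : pred perms :=
  [pred p : perms | [forall i, (rep i == i) || (p i == 1%g)]].

Lemma box_perm_injective : injective box_perm.
Proof.
move=> p q eq_pq; apply/fprodP=> i; apply/permP=> a.
by have /permP/(_ (boxed a)) := eq_pq; rewrite !permE => /boxed_inj.
Qed.

Lemma box_permsE : box_perms rep m = box_perm @: [set p | rep_perms p].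
Proof.
apply/setP=> h; apply/box_permsP/imsetP=> [[tag_h h_off]|[p + ->]]; last first.
  rewrite inE => /forallP pP; split=> u; rewrite permE //= => nru.
  by apply: box_eq => //=; have := pP (tag u); rewrite (negPf nru) => /eqP->; rewrite perm1.
have h_eq i (a : 'I_(m i)) : boxed
    (tagged_as (boxed a) (h (boxed a))) = h (boxed a).
  apply: box_eq; first by rewrite tag_h.
  have := tag_h (boxed a); case: (h _) => j b /= eq_ji.
  by case: _ / (esym eq_ji) b => b; rewrite (tagged_asE (u := boxed a)).
have pi_inj i : injective (fun a : 'I_(m i) =>
    tagged_as (boxed a) (h (boxed a)) : 'I_(m i)).
  move=> a b eq_ab; have : h (boxed a) = h (boxed b).
    by rewrite -(h_eq i a) -(h_eq i b); congr existT; apply: eq_ab.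
  by move/perm_inj/boxed_inj.
exists [fprod i => perm (@pi_inj i)].
  rewrite inE; apply/forallP=> i; case: eqP => //= /eqP nri.
  rewrite fprodE; apply/eqP/permP=> a; rewrite permE perm1.
  by rewrite h_off // (tagged_asE (u := boxed a)).
apply/permP=> -[i a]; rewrite permE fprodE permE; apply/esym/h_eq.
Qed.

Local Open Scope ring_scope.

Lemma sum_box_perms (R : comPzSemiRingType) (K : {perm D} -> R)
    (F : forall i, 'S_(m i) -> R) :
    (forall p, p \in rep_perms -> K (box_perm p) = \prod_(i | rep i == i) F i (p i)) ->
  \sum_(h in box_perms rep m) K h = \prod_(i | rep i == i) \sum_(h : 'S_(m i)) F i h.
Proof.
move=> KE; rewrite box_permsE big_imset /=; last first.
  by move=> p q _ _; apply: box_perm_injective.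
pose G i (h : 'S_(m i)) := if rep i == i then F i h else 1%R.
have -> : \prod_(i | rep i == i) \sum_(h : 'S_(m i)) F i h =
    \prod_i \sum_(h : 'S_(m i) | (rep i == i) || (h == 1%g)) G i h.
  rewrite big_mkcond; apply: eq_bigr => i _; rewrite /G.
  by case: (rep i == i) => //=; rewrite big_pred1_eq.
rewrite (bigA_distr_fprod (T_ := fun i => {perm 'I_(m i)} : finType)).
apply: eq_big => [p|p]; first by rewrite !inE.
by rewrite inE => pP; rewrite KE // [LHS]big_mkcond.
Qed.

Lemma card_box_perms : #|box_perms rep m| = (\prod_(i | rep i == i) (m i)`!)%N.
Proof.
rewrite -sum1_card.
apply: etrans (@sum_box_perms nat (fun=> 1%N) (fun _ _ => 1%N) _) _ => [p _|].
  by rewrite big1.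
by apply: eq_bigr => i _; rewrite sumr_const card_Sn natn.
Qed.

End BoxPerms.

(** * Averages over colored permutations *)

Section ScaledFrameSum.
Variables (I : finType) (s : {perm I}) (rep : I -> I).
Hypothesis reps : cycle_reps s rep.
Variables (m : I -> nat) (m_perm : forall i, m (s i) = m i).
Variables (X : finType) (R : comAlgType rat).
Local Notation boxes := {i : I & 'I_(m i)}.
Local Open Scope ring_scope.

Lemma scale_mulrn_inv (a b : nat) (u v : R) : (0 < a)%N -> (0 < b)%N ->
  u *+ a = v *+ b -> b%:R^-1 *: u = a%:R^-1 *: v :> R.
Proof.
move=> a_gt0 b_gt0 uv.
have a0 : a%:R != 0 :> rat by rewrite pnatr_eq0 -lt0n.
have b0 : b%:R != 0 :> rat by rewrite pnatr_eq0 -lt0n.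
apply: (scalerI a0); rewrite scalerA mulrC -scalerA scaler_nat uv.
by rewrite -[v *+ b]scaler_nat !scalerA mulVf // mulfV.
Qed.

Lemma scaled_frame_sum (V : {perm X} -> {ffun X -> I} -> R)
    (F : forall i, 'S_(m i) -> R) :
    #|X| = #|{: boxes}| ->
    (forall Phi p mu g, framed rep m_perm Phi (box_perm p) mu g ->
      V mu g = \prod_(i | rep i == i) F i (p i)) ->
  (#|X| `!)%:R^-1 *: (\sum_mu \sum_(g | colored s m mu g) V mu g) =
  \prod_(i | rep i == i) (((m i)`!)%:R^-1 *: \sum_(h : 'S_(m i)) F i h).
Proof.
move=> cardX VF.
pose K (h : {perm boxes}) := if [pick p | (box_perm p == h) && (p \in @rep_perms _ rep m)]
  is Some p then \prod_(i | rep i == i) F i (p i) else 0.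
have KE p : p \in @rep_perms _ rep m ->
    K (box_perm p) = \prod_(i | rep i == i) F i (p i).
  move=> pP; rewrite /K; case: pickP => [q /andP[/eqP/box_perm_injective-> //]|].
  by move/(_ p); rewrite eqxx pP.
have VK Phi h mu g : framed rep m_perm Phi h mu g -> V mu g = K h.
  move=> fr; have [_ + _ _] := framedP _ _ _ _ _ _ fr.
  rewrite box_permsE => /imsetP[p + hE]; rewrite inE hE => pP.
  by rewrite KE //; apply: VF; rewrite -hE; apply: fr.
have := frame_sum reps cardX VK.
rewrite (sum_box_perms KE) card_box_perms => sumE.
rewrite scaler_prod prodfV -natr_prod.
by apply: scale_mulrn_inv sumE; rewrite ?fact_gt0 // prodn_gt0 // => i; apply: fact_gt0.
Qed.

End ScaledFrameSum.

Section ColoredSum.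
Variables (I : finType) (s : {perm I}) (rep : I -> I).
Hypothesis reps : cycle_reps s rep.
Variables (X Y : finType) (R : comAlgType rat).
Variable V : {perm X} -> {ffun X -> I} -> {perm Y} -> {ffun Y -> I} -> R.
Variable F : forall (i : I) (m n : nat), 'S_m -> 'S_n -> R.

Local Notation boxes m := {i : I & 'I_(m i)}.
Local Open Scope ring_scope.

Hypothesis V_framed : forall (m n : I -> nat) (m_perm : forall i, m (s i) = m i)
    (n_perm : forall i, n (s i) = n i) Phi Psi mu g nu g' p q,
  #|X| = #|{: boxes m}| -> #|Y| = #|{: boxes n}| ->
  framed rep m_perm Phi (box_perm p) mu g ->
  framed rep n_perm Psi (box_perm q) nu g' ->
  V mu g nu g' = \prod_(i | rep i == i) F i (p i) (q i).

Definition equivariant (Z : finType) (mu : {perm Z}) (g : {ffun Z -> I}) :=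
  [forall z, g (mu z) == s (g z)].

Lemma colored_sum (m n : I -> nat) :
    (forall i, m (s i) = m i) -> (forall i, n (s i) = n i) ->
    #|X| = #|{: boxes m}| -> #|Y| = #|{: boxes n}| ->
  (#|X| `! * #|Y| `!)%:R^-1 *:
    (\sum_mu \sum_(g | colored s m mu g) \sum_nu \sum_(g' | colored s n nu g')
      V mu g nu g') =
  \prod_(i | rep i == i) (((m i)`! * (n i)`!)%:R^-1 *:
    \sum_(p : 'S_(m i)) \sum_(q : 'S_(n i)) F i p q).
Proof.
move=> m_perm n_perm cardX cardY.
pose F2 i (p : 'S_(m i)) := (((n i)`!)%:R^-1 *: \sum_(q : 'S_(n i)) F i p q).
pose V2 mu g := (#|Y| `!)%:R^-1 *: \sum_nu \sum_(g' | colored s n nu g') V mu g nu g'.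
have -> : (#|X| `! * #|Y| `!)%:R^-1 *:
    (\sum_mu \sum_(g | colored s m mu g) \sum_nu \sum_(g' | colored s n nu g')
      V mu g nu g') =
    (#|X| `!)%:R^-1 *: (\sum_mu \sum_(g | colored s m mu g) V2 mu g).
  rewrite natrM invfM -scalerA scaler_sumr; congr (_ *: _).
  by apply: eq_bigr => mu _; rewrite scaler_sumr.
rewrite (scaled_frame_sum reps (m_perm := m_perm) (F := F2)) // => [|Phi p mu g fr].
  by apply: eq_bigr => i _; rewrite natrM invfM -scalerA -scaler_sumr.
apply: (scaled_frame_sum reps (m_perm := n_perm)) => // Psi q nu g' fr'.
exact: (V_framed cardX cardY fr fr').
Qed.

Variable N : nat.
Hypotheses (leXN : (#|X| <= N)%N) (leYN : (#|Y| <= N)%N).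

(** The sizes of the colors of an equivariant coloring are constant along the
    cycles of [s]. They are recorded by their values at the representatives,
    which are bounded by [N] and have to add up to the number of labels. *)
Lemma equivariant_sum :
  (#|X| `! * #|Y| `!)%:R^-1 *:
    (\sum_mu \sum_(g | equivariant mu g) \sum_nu \sum_(g' | equivariant nu g')
      V mu g nu g') =
  \sum_(f in pfamily (ord0, ord0) [pred i | rep i == i]
                (fun=> xpredT : pred ('I_N.+1 * 'I_N.+1))
         | (#|X| == \sum_i (f (rep i)).1)%N && (#|Y| == \sum_i (f (rep i)).2)%N)
    \prod_(i | rep i == i) (((f i).1`! * (f i).2`!)%:R^-1 *:
      \sum_(p : 'S_(f i).1) \sum_(q : 'S_(f i).2) F i p q).
Proof.
pose size_of (Z : finType) (g : {ffun Z -> I}) i : 'I_N.+1 := inord #|[set z | g z == i]|.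
pose sizes (q : {perm X} * {ffun X -> I} * ({perm Y} * {ffun Y -> I})) :
    {ffun I -> 'I_N.+1 * 'I_N.+1} :=
  [ffun i => if rep i == i then (size_of X q.1.2 i, size_of Y q.2.2 i)
             else (ord0, ord0)].
have size_perm (Z : finType) (mu : {perm Z}) g i : equivariant mu g ->
    #|[set z | g z == s i]| = #|[set z | g z == i]|.
  move/forallP=> g_mu; rewrite -[RHS](card_imset _ (@perm_inj _ mu)).
  apply: eq_card => z; rewrite inE -[z](permKV mu) (mem_imset _ _ perm_inj) inE.
  by rewrite (eqP (g_mu _)) (inj_eq perm_inj).
have size_rep (Z : finType) (mu : {perm Z}) g i : equivariant mu g ->
    #|[set z | g z == rep i]| = #|[set z | g z == i]|.
  move=> g_mu; rewrite -{2}(iter_rep_dist reps i).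
  by elim: (rep_dist _ _ _) => //= n ->; rewrite (size_perm _ mu).
have coloredE (Z : finType) (mu : {perm Z}) g (h : I -> 'I_N.+1) : (#|Z| <= N)%N ->
    (forall i, rep i != i -> h i = ord0) ->
    colored s (fun i => h (rep i)) mu g =
    equivariant mu g && [forall i, (if rep i == i then size_of Z g i else ord0) == h i].
  move=> leZN h_off; rewrite /colored -/(equivariant mu g).
  apply: andb_id2l => g_mu; apply/forallP/forallP=> hE i.
    case: ifPn => [/eqP ri|nri]; last by rewrite h_off.
    by rewrite /size_of (eqP (hE i)) ri inord_val.
  have := hE (rep i); rewrite (repK reps) eqxx => /eqP <-.
  rewrite /size_of inordK; first by rewrite (size_rep _ _ _ i g_mu).
  by rewrite ltnS (leq_trans (max_card _)).
rewrite pair_big_dep /=.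
under eq_bigr do rewrite pair_big_dep /=.
rewrite pair_big_dep /=.
rewrite (partition_big sizes (mem (pfamily (ord0, ord0) [pred i | rep i == i]
                (fun=> xpredT : pred ('I_N.+1 * 'I_N.+1))))) /=; last first.
  move=> q _; apply/pfamilyP; split=> //; apply/subsetP=> i; rewrite !inE ffunE.
  by case: ifP.
rewrite scaler_sumr [RHS]big_mkcondr; apply: eq_bigr => f /pfamilyP[f_off _].
have f_off' i : rep i != i -> f i = (ord0, ord0).
  by move=> nri; apply: contraNeq nri => fi; apply: (subsetP f_off i); rewrite inE.
pose m i := (f (rep i)).1 : nat; pose n i := (f (rep i)).2 : nat.
transitivity ((#|X| `! * #|Y| `!)%:R^-1 *:
    (\sum_mu \sum_(g | colored s m mu g) \sum_nu \sum_(g' | colored s n nu g')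
      V mu g nu g')).
  rewrite [in RHS]pair_big_dep /=; congr (_ *: _).
  under [in RHS]eq_bigr do rewrite pair_big_dep /=.
  rewrite [in RHS]pair_big_dep /=; apply: eq_bigl => -[[mu g] [nu g']] /=.
  rewrite /m /n (coloredE _ _ _ (fun i => (f i).1) leXN); last by move=> i /f_off' ->.
  rewrite (coloredE _ _ _ (fun i => (f i).2) leYN); last by move=> i /f_off' ->.
  rewrite andbACA; congr (_ && _).
  apply/eqP/andP=> [<-|[/forallP gf /forallP gf']].
    by split; apply/forallP=> i; rewrite !ffunE /=; case: ifP.
  apply/ffunP=> i; rewrite ffunE; have := gf i; have := gf' i; move=> /eqP + /eqP.
  by case: ifP => _ E2 E1; rewrite [RHS]surjective_pairing -E1 -E2.
case: ifP => [/andP[/eqP cardX /eqP cardY]|cards].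
  have m_perm i : m (s i) = m i by rewrite /m (rep_perm reps).
  have n_perm i : n (s i) = n i by rewrite /n (rep_perm reps).
  rewrite colored_sum ?card_box //; apply: eq_bigr => i /eqP ri.
  by rewrite /m /n ri.
rewrite big1 ?scaler0 // => mu _; rewrite big1 // => g gm.
rewrite big1 // => nu _; rewrite big1 // => g' gn.
by case/negP: (negbT cards); rewrite -!card_box -(colored_card gm) -(colored_card gn) !eqxx.
Qed.

End ColoredSum.

(** * Cycles of a colored permutation *)

Lemma porbit_dvd (T : finType) (t : {perm T}) x n :
  (iter n t x == x) = (#|porbit t x| %| n).
Proof.
set l := #|porbit t x|; have l_gt0 : 0 < l by apply/card_gt0P; exists x; apply: porbit_id.
have iter_l q : iter (q * l) t x = x.
  by elim: q => // q IHq; rewrite mulSn iterD IHq iter_porbit.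
rewrite {1}(divn_eq n l) addnC iterD iter_l /dvdn.
have lt_r := ltn_pmod n l_gt0; apply/eqP/eqP=> [iter_r|->//].
have := uniq_traject_porbit t x; rewrite -/l => uniq_l.
have := nth_uniq x _ _ uniq_l; rewrite size_traject => /(_ (n %% l) 0 lt_r l_gt0).
by rewrite !nth_traject // iter_r eqxx => /esym/eqP.
Qed.

Section FramedCycles.
Variables (I : finType) (s : {perm I}) (rep : I -> I).
Hypothesis reps : cycle_reps s rep.
Variables (m : I -> nat) (m_perm : forall i, m (s i) = m i) (X : finType).
Local Notation boxed := (Tagged (fun i => 'I_(m i))).
Variables (Phi : {ffun {i : I & 'I_(m i)} -> X})
  (p : fprod (fun i => {perm 'I_(m i)} : finType)) (mu : {perm X})
  (g : {ffun X -> I}).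
Hypothesis fr : framed rep m_perm Phi (box_perm p) mu g.
Hypothesis cardX : #|X| = #|{: {i : I & 'I_(m i)}}|.

Let Phi_inj : injective Phi. Proof. by case/framedP: fr. Qed.
Let gPhi u : g (Phi u) = tag u. Proof. by case/framedP: fr. Qed.

Let box_shift_val n u : tagged (iter n (box_shift m_perm) u) = tagged u :> nat.
Proof. by elim: n => //= n ->. Qed.

Let box_shift_tag n u : tag (iter n (box_shift m_perm) u) = iter n s (tag u).
Proof. by elim: n => //= n ->. Qed.

Lemma framed_iter n u : rep (tag u) = tag u -> n < cycle_len s (tag u) ->
  iter n mu (Phi u) = Phi (iter n (box_shift m_perm) u).
Proof.
move=> ru; case/framedP: fr => _ /box_permsP[_ h_off] _ muPhi.
elim: n => //= n IHn ltn; rewrite IHn 1?ltnW // muPhi h_off //=.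
rewrite box_shift_tag (rep_perm reps) (rep_iter reps) ru.
apply/eqP=> /esym/eqP; rewrite -iterS porbit_dvd => /dvdn_leq-/(_ isT).
by rewrite leqNgt ltn.
Qed.

(** Each step of [mu] shifts the boxes, and [h] only intervenes when the cycle of
    colors closes up. *)
Lemma framed_return i (a : 'I_(m i)) : rep i = i ->
  (mu ^+ cycle_len s i)%g (Phi (boxed a)) = Phi (boxed (p i a)).
Proof.
move=> ri; have := cycle_len_gt0 s i; rewrite permX.
case lenE: (cycle_len s i) => [//|n] _ /=.
case/framedP: (fr) => _ _ _ muPhi; rewrite framed_iter ?lenE // muPhi -iterS.
have -> : iter n.+1 (box_shift m_perm) (boxed a) = boxed a.
  by apply: box_eq; rewrite ?box_shift_val // box_shift_tag -lenE iter_cycle_len.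
by rewrite permE.
Qed.

Lemma framed_return_iter i (a : 'I_(m i)) n : rep i = i ->
  iter (n * cycle_len s i) mu (Phi (boxed a)) = Phi (boxed (iter n (p i) a)).
Proof.
move=> ri; elim: n => // n IHn.
by rewrite mulSn iterD IHn -permX framed_return.
Qed.

Let g_iter n x : g (iter n mu x) = iter n s (g x).
Proof.
have /andP[/forallP g_mu _] := framed_colored cardX fr.
by elim: n => //= n <-; apply/eqP.
Qed.

Let return_dvd i (a b : 'I_(m i)) n : rep i = i ->
  iter n mu (Phi (boxed a)) = Phi (boxed b) -> cycle_len s i %| n.
Proof.
move=> ri nE; have := g_iter n (Phi (boxed a)); rewrite nE !gPhi /=.
by move/esym/eqP; rewrite porbit_dvd.
Qed.

Lemma framed_porbit i (a b : 'I_(m i)) : rep i = i ->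
  (Phi (boxed b) \in porbit mu (Phi (boxed a))) = (b \in porbit (p i) a).
Proof.
move=> ri; apply/porbitP/porbitP=> [[n bE]|[n ->]].
  rewrite permX in bE; have /dvdnP[q nE] := return_dvd ri (esym bE).
  exists q; rewrite permX; move: bE; rewrite nE framed_return_iter //.
  by move/Phi_inj/boxed_inj.
by exists (n * cycle_len s i); rewrite !permX framed_return_iter.
Qed.

Lemma card_framed_porbit i (a : 'I_(m i)) : rep i = i ->
  #|porbit mu (Phi (boxed a))| = #|porbit (p i) a| * cycle_len s i.
Proof.
move=> ri; have dvdE n : (#|porbit mu (Phi (boxed a))| %| n) =
    (#|porbit (p i) a| * cycle_len s i %| n).
  have len_gt0 := cycle_len_gt0 s i.
  have returnE q : (iter (q * cycle_len s i) mu (Phi (boxed a)) == Phi (boxed a)) =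
      (#|porbit (p i) a| %| q).
    rewrite framed_return_iter // (inj_eq Phi_inj) -porbit_dvd.
    by apply/eqP/eqP=> [/boxed_inj|-> //].
  rewrite -porbit_dvd; apply/idP/idP=> [nE|/dvdnP[q ->]].
    have /dvdnP[q nE'] := return_dvd ri (eqP nE).
    by rewrite nE' returnE in nE *; rewrite dvdn_pmul2r.
  by rewrite mulnA returnE dvdn_mull.
by apply/eqP; rewrite eqn_dvd dvdE dvdnn -dvdE dvdnn.
Qed.

(** The cycles of the return permutation at [i] are the traces of the cycles of
    [mu] on the color [i]; their lengths are multiplied by the length of the
    cycle of colors, since [mu] runs through each of these colors in turn. *)
Lemma framed_cycle_prod (M : conomType) (f : nat -> M) :
  \big[mmul/mone]_(c in porbits mu) f #|c| =
  \big[mmul/mone]_(i | rep i == i) \big[mmul/mone]_(c in porbits (p i))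
    f (#|c| * cycle_len s i).
Proof.
pose orbit_of i (c : {set 'I_(m i)}) : {set X} :=
  \bigcup_(a in c) porbit mu (Phi (boxed a)).
have orbit_ofE i a : rep i = i -> orbit_of i (porbit (p i) a) = porbit mu (Phi (boxed a)).
  move=> ri; apply/setP=> x; apply/bigcupP/idP=> [[b ba xb]|xa]; last first.
    by exists a => //; apply: porbit_id.
  by rewrite -framed_porbit // -eq_porbit_mem in ba; rewrite -(eqP ba).
pose orbits i := if rep i == i then orbit_of i @: porbits (p i) else set0.
have orbitsP i c : reflect (rep i = i /\ exists a, c = porbit mu (Phi (boxed (a : 'I_(m i)))))
    (c \in orbits i).
  rewrite /orbits; case: eqP => [ri|nri]; last by rewrite inE; constructor=> -[].
  apply: (iffP imsetP) => [[_ /imsetP[a _ ->] ->]|[_ [a ->]]].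
    by split=> //; exists a; rewrite orbit_ofE.
  by exists (porbit (p i) a); rewrite ?orbit_ofE // imset_f.
have -> : porbits mu = \bigcup_i orbits i.
  apply/setP=> c; apply/imsetP/bigcupP=> [[x _ ->]|[i _ /orbitsP[_ [a ->]]]]; last first.
    by exists (Phi (boxed a)).
  have [Psi PhiK PsiK] := box_bij cardX Phi_inj; rewrite -[x]PsiK.
  move: (Psi x) => u; exists (rep (tag u)) => //; apply/orbitsP.
  split; first exact: (repK reps).
  exists (tagged (box_rep reps m_perm u)); apply/eqP; rewrite eq_porbit_mem.
  apply/porbitP; exists (rep_dist s rep (tag u)).
  rewrite permX framed_iter ?(repK reps) //=; last first.
    by rewrite (cycle_len_rep reps) rep_dist_lt.
  congr (Phi _); apply: box_eq; rewrite ?box_shift_tag ?box_shift_val //=.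
  by rewrite iter_rep_dist.
rewrite partition_disjoint_bigcup => [|i j neq_ij]; last first.
  rewrite -setI_eq0; apply/eqP/setP=> c; rewrite !inE; apply/negP=> /andP[].
  move=> /orbitsP[ri [a ->]] /orbitsP[rj [b /eqP]].
  rewrite eq_porbit_mem => /porbitP[n /(congr1 g)]; rewrite permX g_iter !gPhi /=.
  by move=> iE; rewrite -ri iE (rep_iter reps) rj eqxx in neq_ij.
rewrite [RHS]big_mkcond; apply: eq_bigr => i _; rewrite /orbits.
case: eqP => [ri|_]; last by rewrite big_set0.
rewrite big_imset /= => [|_ _ /imsetP[a _ ->] /imsetP[b _ ->]].
  by apply: eq_bigr => _ /imsetP[a _ ->]; rewrite orbit_ofE // card_framed_porbit.
rewrite !orbit_ofE // => /eqP; rewrite eq_porbit_mem framed_porbit // => ab.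
by apply/eqP; rewrite eq_porbit_mem.
Qed.

End FramedCycles.

(** * Monomials *)

Section Monomials.
Implicit Types (e a b : pmonom) (v w : nat + nat).

Lemma expcmnE e n v : expcmn e n v = n * e v.
Proof.
case: n => [|n]; first by rewrite /expcmn /= onecmE.
rewrite /expcmn iteropS; elim: n => [|n IHn]; first by rewrite mul1n.
by rewrite iterS mulcmE IHn -mulSn.
Qed.

Lemma expcmn_const (T : finType) (A : {pred T}) e :
  \big[mmul/mone]_(t in A) e = expcmn e #|A|.
Proof.
apply/eqP/cmP=> v; rewrite expcmnE.
rewrite big_const; elim: #|A| => [|n IHn] /=; first by rewrite cm1.
by rewrite cmM IHn mulSn.
Qed.

(** The weighted degrees. They separate the monomials ([pmonom_eq]), so that
    identities between monomials are identities between natural numbers. *)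
Definition wgt (f : nat + nat -> nat) e := \sum_(v <- finsupp e) f v * e v.

Lemma wgtE (f : nat + nat -> nat) (D : {fset nat + nat}) e :
  (finsupp e `<=` D)%fset -> wgt f e = \sum_(v <- D) f v * e v.
Proof.
move=> eD; rewrite /wgt (big_fset_incl _ eD) // => v vD.
by rewrite -cmE_eq0 => /eqP->; rewrite muln0.
Qed.

Lemma wgtM f e e' : wgt f (mmul e e') = wgt f e + wgt f e'.
Proof.
rewrite {1}/wgt mdomD (wgtE _ (fsubsetUl (finsupp e) (finsupp e'))).
rewrite (wgtE _ (fsubsetUr (finsupp e) (finsupp e'))) -big_split /=.
by apply: eq_bigr => v _; rewrite cmM mulnDr.
Qed.

Lemma wgt1 f : wgt f mone = 0.
Proof. by rewrite /wgt mdom1 big_seq_fset0. Qed.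

Lemma wgtU f v : wgt f (ucm v) = f v.
Proof. by rewrite /wgt mdomU big_seq_fset1 cmUU muln1. Qed.

Lemma wgt_prod (J : Type) (r : seq J) (P : pred J) f (F : J -> pmonom) :
  wgt f (\big[mmul/mone]_(j <- r | P j) F j) = \sum_(j <- r | P j) wgt f (F j).
Proof. exact: (big_morph (wgt f) (wgtM f) (wgt1 f)). Qed.

Lemma wgt_coef v e : wgt (fun w => v == w) e = e v.
Proof.
rewrite (wgtE _ (fsubsetUl (finsupp e) [fset v]%fset)).
rewrite (big_fsetD1 v) /=; last by rewrite !inE eqxx orbT.
rewrite eqxx mul1n big1_fset ?addn0 // => w; rewrite !inE => /andP[wv _] _.
by rewrite eq_sym (negPf wv).
Qed.

Lemma wgt_exp f e n : wgt f (expcmn e n) = n * wgt f e.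
Proof.
elim: n => [|n IHn]; first by rewrite wgt1.
have -> : expcmn e n.+1 = mmul e (expcmn e n).
  by apply/eqP/cmP=> v; rewrite cmM !expcmnE mulSn.
by rewrite wgtM IHn mulSn.
Qed.

Definition dilate_var (l : nat) v : nat + nat :=
  match v with inl j => inl (j * l)%N | inr j => inr (j * l)%N end.

Lemma wgt_dilate f l e : wgt f (dilate_monom l e) = wgt (f \o dilate_var l) e.
Proof.
rewrite /dilate_monom wgt_prod; apply: eq_bigr => v _.
by rewrite wgt_exp wgtU mulnC.
Qed.

Lemma pmonom_eq e e' : (forall f, wgt f e = wgt f e') -> e = e'.
Proof. by move=> eq_w; apply/eqP/cmP=> v; rewrite -!wgt_coef. Qed.

Lemma dilate_monomM l e e' :
  dilate_monom l (mmul e e') = mmul (dilate_monom l e) (dilate_monom l e').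
Proof. by apply: pmonom_eq => f; rewrite !(wgt_dilate, wgtM). Qed.

Lemma dilate_monomU l v : dilate_monom l (ucm v) = ucm (dilate_var l v).
Proof. by apply: pmonom_eq => f; rewrite wgt_dilate !wgtU. Qed.

Lemma dilate_monom1 l : dilate_monom l mone = mone.
Proof. by apply: pmonom_eq => f; rewrite wgt_dilate !wgt1. Qed.

Lemma dilate_monom_prod l (J : Type) (r : seq J) (P : pred J) (F : J -> pmonom) :
  dilate_monom l (\big[mmul/mone]_(j <- r | P j) F j) =
  \big[mmul/mone]_(j <- r | P j) dilate_monom l (F j).
Proof. exact: (big_morph _ (dilate_monomM l) (dilate_monom1 l)). Qed.

Lemma dilate_monom_inj l : 0 < l -> injective (dilate_monom l).
Proof.
move=> l_gt0 e e' eq_d; have var_inj : injective (dilate_var l).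
  move=> [i|i] [j|j] //= [] /eqP; rewrite eqn_pmul2r // => /eqP->; by [].
apply/eqP/cmP=> v; rewrite -!wgt_coef.
have wE a : wgt (fun w => v == w) a =
    wgt (fun w => dilate_var l v == w) (dilate_monom l a).
  rewrite wgt_dilate; apply: eq_bigr => w _; congr (_ * _).
  by rewrite /= (inj_eq var_inj).
by rewrite !wE eq_d.
Qed.

Definition degX := wgt (fun v => if v is inl j then j else 0).
Definition degY := wgt (fun v => if v is inr j then j else 0).

Lemma degX_dilate l e : degX (dilate_monom l e) = degX e * l.
Proof.
rewrite /degX wgt_dilate /wgt big_distrl /=; apply: eq_bigr => -[j|j] _ //=.
by rewrite mulnAC.
Qed.

Lemma degY_dilate l e : degY (dilate_monom l e) = degY e * l.
Proof.
rewrite /degY wgt_dilate /wgt big_distrl /=; apply: eq_bigr => -[j|j] _ //=.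
by rewrite mulnAC.
Qed.

Lemma num_cycles_prod n (mu : 'S_n) (f : nat -> nat + nat) :
  \big[mmul/mone]_(1 <= i < n.+1) expcmn (ucm (f i)) (num_cycles mu i) =
  \big[mmul/mone]_(c in porbits mu) ucm (f #|c|) :> pmonom.
Proof.
under eq_bigr do rewrite -expcmn_const.
under eq_bigr do [under eq_bigl do rewrite inE].
rewrite (exchange_big_dep (mem (porbits mu))) /= => [|i c _ /andP[] //].
apply: eq_bigr => c c_orb; rewrite -big_filter.
have -> : [seq i <- index_iota 1 n.+1 | (c \in porbits mu) && (#|c| == i)] = [:: #|c|].
  have c_iota : #|c| \in index_iota 1 n.+1.
    rewrite mem_index_iota ltnS; case/imsetP: c_orb => x _ ->.
    by rewrite (cycle_len_gt0 mu x) (leq_trans (max_card _)) ?card_ord.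
  rewrite c_orb /=; rewrite -(filter_pred1_uniq (iota_uniq _ _) c_iota).
  by apply: eq_filter => i; rewrite /= eq_sym.
by rewrite big_seq1.
Qed.

Lemma cycle_monomE m n (mu : 'S_m) (nu : 'S_n) : cycle_monom mu nu =
  mmul (\big[mmul/mone]_(c in porbits mu) ucm (inl #|c|))
       (\big[mmul/mone]_(c in porbits nu) ucm (inr #|c|)).
Proof. by rewrite /cycle_monom (num_cycles_prod _ inl) (num_cycles_prod _ inr). Qed.

Lemma sum_card_porbits n (mu : 'S_n) : \sum_(c in porbits mu) #|c| = n.
Proof.
have /and3P[/eqP covE trivP _] : partition (porbits mu) [set: 'I_n].
  apply/and3P; split.
  - apply/eqP/setP=> x; rewrite inE; apply/bigcupP; exists (porbit mu x).
      exact: imset_f.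
    exact: porbit_id.
  - apply/trivIsetP=> _ _ /imsetP[x _ ->] /imsetP[y _ ->] neq_xy.
    rewrite -setI_eq0; apply/eqP/setP=> z; rewrite !inE; apply/negP=> /andP[zx zy].
    by move: zx zy neq_xy; rewrite -!eq_porbit_mem => /eqP<- /eqP->; rewrite eqxx.
  by apply/imsetP=> -[x _ /setP/(_ x)]; rewrite inE porbit_id.
by have := eqP trivP; rewrite /= covE cardsT card_ord.
Qed.

Lemma degX_cycle_monom m n (mu : 'S_m) (nu : 'S_n) : degX (cycle_monom mu nu) = m.
Proof.
rewrite cycle_monomE /degX wgtM !wgt_prod.
under eq_bigr do rewrite wgtU; rewrite sum_card_porbits big1 ?addn0 // => c _.
by rewrite wgtU.
Qed.

Lemma degY_cycle_monom m n (mu : 'S_m) (nu : 'S_n) : degY (cycle_monom mu nu) = n.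
Proof.
rewrite cycle_monomE /degY wgtM !wgt_prod big1 => [|c _]; last by rewrite wgtU.
by under eq_bigr do rewrite wgtU; rewrite sum_card_porbits.
Qed.

Lemma dilate_cycle_monom l m n (mu : 'S_m) (nu : 'S_n) :
  dilate_monom l (cycle_monom mu nu) =
  mmul (\big[mmul/mone]_(c in porbits mu) ucm (inl (#|c| * l)))
       (\big[mmul/mone]_(c in porbits nu) ucm (inr (#|c| * l))).
Proof.
rewrite cycle_monomE dilate_monomM !dilate_monom_prod.
by congr mmul; apply: eq_bigr => c _; rewrite dilate_monomU.
Qed.

End Monomials.

(** * Series and their truncations *)

Section Series.
Local Open Scope ring_scope.
Local Notation poly_ring := {malg rat[pmonom]}.
Implicit Types (e : pmonom) (f : pseries) (u : poly_ring).

Lemma fsbig_on_seq (T : choiceType) (A : classical_sets.set T) (r : seq T)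
    (F : T -> rat) :
    uniq r -> (forall x, x \in r -> A x) -> (forall x, A x -> x \notin r -> F x = 0) ->
  \sum_(x \in A) F x = \sum_(x <- r) F x.
Proof.
move=> uniq_r rA F0; rewrite (fsbigE r) // big_seq_cond [RHS]big_seq.
by apply: eq_bigl => x; case: (boolP (x \in r)) => //= /rA/mem_set.
Qed.

(** Each coefficient of a product of series depends on finitely many coefficients
    of the factors, and is thus computed in a ring of polynomials, where sums and
    products are the usual big operators. *)
Definition agree (N : nat) f u :=
  forall e, (degX e + degY e <= N)%N -> f e = u@_e.

Lemma agree_monom N e : agree N (monom_series e) << e >>.
Proof. by move=> e' _; rewrite mcoeffU1 /monom_series eq_sym. Qed.

Lemma mul_seriesE N f1 f2 u1 u2 : agree N f1 u1 -> agree N f2 u2 ->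
  agree N (mul_series f1 f2) (u1 * u2).
Proof.
move=> fu1 fu2 e degN; rewrite mcoeffMl.
pose r := [seq ab <- [seq (a, b) | a <- msupp u1, b <- msupp u2] | mmul ab.1 ab.2 == e].
have deg_le a b : mmul a b = e -> f1 a = u1@_a /\ f2 b = u2@_b.
  move=> abE; move: degN; rewrite -abE /degX /degY !wgtM => degN.
  by split; [apply: fu1|apply: fu2]; apply: leq_trans degN; rewrite ?leq_add ?leq_addr ?leq_addl.
rewrite /mul_series (fsbig_on_seq (r := r)) /=.
- rewrite /r big_filter big_mkcond big_allpairs /=; apply: eq_bigr => a _.
  apply: eq_bigr => b _ /=; case: eqP => [/deg_le[-> ->]|_].
    by rewrite mulr1n.
  by rewrite mulr0n.
- by apply/filter_uniq/allpairs_uniq; rewrite ?fset_uniq // => -[? ?] [? ?].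
- by move=> ab /=; rewrite mem_filter => /andP[/eqP].
move=> [a b] /= abE; have [-> ->] := deg_le a b abE.
rewrite mem_filter abE eqxx /= => /negP ab_r.
have [a_supp|/mcoeff_outdom->] := boolP (a \in msupp u1); last by rewrite mul0r.
have [b_supp|/mcoeff_outdom->] := boolP (b \in msupp u2); last by rewrite mulr0.
by case: ab_r; apply/allpairsP; exists (a, b).
Qed.

Lemma agree_prod N (J : finType) (P : pred J) (F : J -> pseries) (U : J -> poly_ring) :
  (forall j, P j -> agree N (F j) (U j)) ->
  agree N (\big[mul_series/monom_series mone]_(j | P j) F j) (\prod_(j | P j) U j).
Proof.
move=> FU; apply: (big_ind2 (agree N)) => //; first exact: agree_monom.
by move=> f1 u1 f2 u2; apply: mul_seriesE.
Qed.

(** The degrees of a cycle monomial are the numbers of labels, so that a single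
    term of the sum over the sizes contributes to a given coefficient. *)
Lemma cycle_indexE (D : nat -> nat -> finType) (F : forall m n, {set D m n})
    (rel : forall m n, 'S_m -> 'S_n -> D m n -> D m n)
    (act : forall m n, D m n -> D m n) e :
  cycle_index F rel act e = ((degX e)`! * (degY e)`!)%:R^-1 *
    \sum_(mu : 'S_(degX e)) \sum_(nu : 'S_(degY e))
      #|[set S in F _ _ | act _ _ (rel _ _ mu nu S) == S]|%:R *
      (cycle_monom mu nu == e)%:R.
Proof.
rewrite /cycle_index (fsbig_on_seq (r := [:: (degX e, degY e)])) //=.
- rewrite big_seq1 /=; congr (_ * _); apply: eq_bigr => mu _; apply: eq_bigr => nu _.
  by rewrite /monom_series eq_sym.
move=> [m n] _ /=; rewrite inE => /eqP neq_mn; rewrite big1 ?mulr0 // => mu _.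
rewrite big1 // => nu _; rewrite /monom_series; case: eqP => [eE|_]; rewrite ?mulr0 //.
by case: neq_mn; rewrite eE degX_cycle_monom degY_cycle_monom.
Qed.

(** The dilation is injective and multiplies the degrees by [l >= 1]: at most one
    monomial dilates to [e], and its degrees are also bounded by [N]. *)
Lemma agree_dilate N l f (fix_of : forall m n, 'S_m -> 'S_n -> nat) : (0 < l)%N ->
    (forall e, f e = ((degX e)`! * (degY e)`!)%:R^-1 *
      \sum_(mu : 'S_(degX e)) \sum_(nu : 'S_(degY e))
        (fix_of _ _ mu nu)%:R * (cycle_monom mu nu == e)%:R) ->
  agree N (dilate l f) (\sum_(mn : 'I_N.+1 * 'I_N.+1)
    ((mn.1`! * mn.2`!)%:R^-1 *: \sum_(mu : 'S_mn.1) \sum_(nu : 'S_mn.2)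
      ((fix_of _ _ mu nu)%:R *: << dilate_monom l (cycle_monom mu nu) >>))).
Proof.
move=> l_gt0 fE e degN.
pose G (h : pmonom -> rat) m n := (m`! * n`!)%:R^-1 *
  \sum_(mu : 'S_m) \sum_(nu : 'S_n) (fix_of _ _ mu nu)%:R * h (cycle_monom mu nu).
transitivity (\sum_(mn : 'I_N.+1 * 'I_N.+1)
    G (fun a => (dilate_monom l a == e)%:R) mn.1 mn.2); last first.
  rewrite raddf_sum; apply: eq_bigr => mn _ /=; rewrite mcoeffZ; congr (_ * _).
  rewrite raddf_sum; apply: eq_bigr => mu _ /=.
  by rewrite raddf_sum; apply: eq_bigr => nu _ /=; rewrite mcoeffZ mcoeffU1.
have [[e' eE]|no_e'] := pselect (exists e', dilate_monom l e' = e); last first.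
  rewrite big1 => [|mn _].
    by rewrite /dilate (fsbig_on_seq (r := [::])) ?big_nil //= => a aE; case: no_e'; exists a.
  rewrite /G big1 ?mulr0 // => mu _; rewrite big1 // => nu _.
  by case: eqP => [aE|_]; rewrite ?mulr0 //; case: no_e'; exists (cycle_monom mu nu).
have -> : dilate l f e = f e'.
  rewrite /dilate (fsbig_on_seq (r := [:: e'])) ?big_seq1 //= => [a|a aE].
    by rewrite inE => /eqP->.
  by rewrite inE -(inj_eq (dilate_monom_inj l_gt0)) aE eE eqxx.
have G0 m n : (m, n) != (degX e', degY e') ->
    G (fun a => (dilate_monom l a == e)%:R) m n = 0.
  move=> /eqP neq_mn; rewrite /G big1 ?mulr0 // => mu _; rewrite big1 // => nu _.
  rewrite -eE (inj_eq (dilate_monom_inj l_gt0)); case: eqP => [aE|_]; rewrite ?mulr0 //.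
  by case: neq_mn; rewrite -aE degX_cycle_monom degY_cycle_monom.
have [degX_lt degY_lt] : (degX e' < N.+1)%N /\ (degY e' < N.+1)%N.
  move: degN; rewrite -eE degX_dilate degY_dilate -mulnDl => degN.
  by rewrite !ltnS; split; apply: leq_trans degN;
    rewrite (leq_trans _ (leq_pmulr _ l_gt0)) ?leq_addr ?leq_addl.
rewrite (bigD1 (Ordinal degX_lt, Ordinal degY_lt)) //= big1 ?addr0 => [|[m n] neq_mn].
  rewrite fE /G; congr (_ * _); apply: eq_bigr => mu _; apply: eq_bigr => nu _.
  by rewrite -eE (inj_eq (dilate_monom_inj l_gt0)).
by apply: G0; apply: contraNneq neq_mn => -[mE nE]; apply/eqP; congr (_, _); apply: val_inj.
Qed.

(** The bidegree of a cycle index is the pair of the numbers of labels of both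
    sorts: it discards the families of sizes that do not add up. *)
Definition bihomog (a b : nat) u := forall e, u@_e != 0 -> degX e = a /\ degY e = b.

Lemma bihomog0 a b : bihomog a b 0.
Proof. by move=> e; rewrite mcoeff0 eqxx. Qed.

Lemma bihomogD a b u1 u2 : bihomog a b u1 -> bihomog a b u2 -> bihomog a b (u1 + u2).
Proof.
move=> h1 h2 e; rewrite mcoeffD; have [->|/h1//] := eqVneq (u1@_e) 0.
by rewrite add0r; apply: h2.
Qed.

Lemma bihomog_sum a b (J : finType) (F : J -> poly_ring) :
  (forall j, bihomog a b (F j)) -> bihomog a b (\sum_j F j).
Proof.
move=> hF; apply: (big_ind (bihomog a b)); [exact: bihomog0|exact: bihomogD|].
by move=> j _; apply: hF.
Qed.

Lemma bihomogZ a b c u : bihomog a b u -> bihomog a b (c *: u).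
Proof.
by move=> hu e; rewrite mcoeffZ mulf_eq0 negb_or => /andP[_ /hu].
Qed.

Lemma bihomogU a b e : degX e = a -> degY e = b -> bihomog a b << e >>.
Proof. by move=> <- <- e'; rewrite mcoeffU1; case: (e =P e') => [->|_] //; rewrite eqxx. Qed.

Lemma bihomogM a1 b1 a2 b2 u1 u2 : bihomog a1 b1 u1 -> bihomog a2 b2 u2 ->
  bihomog (a1 + a2) (b1 + b2) (u1 * u2).
Proof.
move=> h1 h2 e; apply: contra_neqP => not_ab; rewrite mcoeffMl big1 // => e1 _.
rewrite big1 // => e2 _; case: eqP => [eE|_]; rewrite ?mulr0n // mulr1n.
have [->|/h1[dX1 dY1]] := eqVneq (u1@_e1) 0; first by rewrite mul0r.
have [->|/h2[dX2 dY2]] := eqVneq (u2@_e2) 0; first by rewrite mulr0.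
by case: not_ab; rewrite -eE /degX /degY !wgtM -/degX -/degY dX1 dX2 dY1 dY2.
Qed.

Lemma bihomog_prod (J : finType) (P : pred J) (a b : J -> nat) (F : J -> poly_ring) :
  (forall j, P j -> bihomog (a j) (b j) (F j)) ->
  bihomog (\sum_(j | P j) a j) (\sum_(j | P j) b j) (\prod_(j | P j) F j).
Proof.
move=> hF; apply: (big_rec3 (fun u n m => bihomog m n u)) => [|j u n m Pj hu].
  by apply: bihomogU; rewrite /degX /degY wgt1.
by apply: bihomogM (hF j Pj) hu.
Qed.

End Series.

(** * The cycle index of the edge-rooted trees *)

Lemma sum_over_reps (I : finType) (s : {perm I}) (rep : I -> I) (G : I -> nat) :
  cycle_reps s rep ->
  \sum_i G (rep i) = \sum_(i | rep i == i) G i * cycle_len s i.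
Proof.
move=> reps; rewrite (partition_big rep [pred i | rep i == i]) /= => [|i _]; last first.
  by rewrite (repK reps).
apply: eq_bigr => i /eqP ri.
transitivity (\sum_(j in porbit s i) G i).
  apply: eq_big => [j|j /eqP-> //]; apply/eqP/idP=> [<-|/(reps.2 i)].
    by rewrite (porbit_rep reps) porbit_id.
  by rewrite ri.
by rewrite sum_nat_const mulnC.
Qed.

Section OptionPerm.
Variables (I : finType) (s : {perm I}) (rep : I -> I).

Lemma omap_perm_inj : injective (omap s).
Proof. by move=> [i|] [j|] //= [/perm_inj->]. Qed.

(** The cycles of [s] on the positions of the subtrees, and one more fixed color
    for the root black vertex. *)
Definition option_perm : {perm option I} := perm omap_perm_inj.

Lemma option_permX n v : (option_perm ^+ n)%g v = omap (s ^+ n)%g v.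
Proof.
rewrite permX; elim: n v => [|n IHn] v /=; first by case: v => //= i; rewrite perm1.
by rewrite IHn permE; case: v => //= i; rewrite expgSr permM.
Qed.

Lemma porbit_Some i : porbit option_perm (Some i) = Some @: porbit s i.
Proof.
apply/setP=> v; apply/porbitP/imsetP=> [[n ->]|[_ /porbitP[n ->] ->]].
  by exists ((s ^+ n)%g i); rewrite ?option_permX // mem_porbit.
by exists n; rewrite option_permX.
Qed.

Lemma porbit_None : porbit option_perm None = [set None].
Proof.
apply/setP=> v; rewrite inE; apply/porbitP/eqP=> [[n ->]|->].
  by rewrite option_permX.
by exists 0; rewrite expg0 perm1.
Qed.

Lemma cycle_len_Some i : cycle_len option_perm (Some i) = cycle_len s i.
Proof. by rewrite /cycle_len porbit_Some card_imset //; apply: Some_inj. Qed.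

Lemma cycle_len_None : cycle_len option_perm None = 1.
Proof. by rewrite /cycle_len porbit_None cards1. Qed.

Lemma option_reps : cycle_reps s rep -> cycle_reps option_perm (omap rep).
Proof.
case=> rep_in rep_eq; split=> [[i|]|[i|] v] /=.
- by rewrite porbit_Some imset_f.
- exact: porbit_id.
- by rewrite porbit_Some => /imsetP[j /rep_eq ij ->] /=; rewrite ij.
by rewrite porbit_None inE => /eqP->.
Qed.

End OptionPerm.

Lemma big_option_pred (R : Type) (idx : R) (op : Monoid.com_law idx) (I : finType)
    (P : pred (option I)) (F : option I -> R) : P None ->
  \big[op/idx]_(v | P v) F v =
  op (F None) (\big[op/idx]_(i | P (Some i)) F (Some i)).
Proof.
move=> PN; rewrite (bigD1 None) //=; congr (op _ _).
case: (pickP I) => [i0 _|I0].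
  rewrite (reindex_onto Some (odflt i0)) => [|[i|] /andP[] //].
  by apply: eq_bigl => i; rewrite andbT eqxx andbT.
by rewrite !big1 // => [i|[i|]]; rewrite ?andbF //; have := I0 i.
Qed.

Section FixedColorings.
Variables (k : nat) (s : 'S_k.+1) (rep : 'I_k.+1 -> 'I_k.+1).
Hypothesis reps : cycle_reps s rep.
Local Open Scope ring_scope.
Local Notation poly_ring := {malg rat[pmonom]}.
Local Notation s1 := (option_perm s).
Local Notation rep1 := (omap rep).

Let reps1 : cycle_reps s1 rep1 := option_reps reps.

Definition cycle_rho i : 'S_k.+1 := rho_prod s (traject s i (cycle_len s i)).

(** The root black vertex forms a color of its own, [None], which has one black
    label and no white label. *)
Definition fixed_of (v : option 'I_k.+1) m n (p : 'S_m) (q : 'S_n) : nat :=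
  if v is Some i then
    #|[set W in CTY k 'I_m 'I_n | act_CTY (cycle_rho i) (relabel_CTY p q W) == W]|
  else (m == 1%N) && (n == 0%N).

Definition cycle_term (v : option 'I_k.+1) m n (p : 'S_m) (q : 'S_n) : poly_ring :=
  (fixed_of v p q)%:R *: << dilate_monom (cycle_len s1 v) (cycle_monom p q) >>.

(** The factor of a cycle in the cycle index, up to [N] labels of each sort. *)
Definition cycle_sum N v : poly_ring :=
  \sum_(mn : 'I_N.+1 * 'I_N.+1) ((mn.1`! * mn.2`!)%:R^-1 *:
    \sum_(p : 'S_mn.1) \sum_(q : 'S_mn.2) cycle_term v p q).

Definition joint_coloring (X Y : finType) (g : {ffun X -> option 'I_k.+1})
    (g' : {ffun Y -> option 'I_k.+1}) (v : X + Y) :=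
  match v with inl x => g x | inr y => g' y end.

Definition colored_fixed (X Y : finType) mu nu g g' :=
  [set S in CTXY k X Y | [forall v, color k S v == joint_coloring g g' v]
     & act_CTXY s (relabel_CTXY mu nu S) == S].

Lemma mcoeffU_prod (J : finType) (P : pred J) (e : J -> pmonom) :
  << \big[mmul/mone]_(j | P j) e j >> = \prod_(j | P j) << e j >> :> poly_ring.
Proof.
apply: (big_morph (fun a : pmonom => << a >> : poly_ring)) => [a b|//].
by rewrite [RHS]malgM_def fgmulUU mulr1.
Qed.

(** The fixed structures are sorted by the colorings of their labels, which are
    equivariant by [fixed_CTXY_color]. *)
Lemma card_fixed_coloring (X Y : finType) (mu : {perm X}) (nu : {perm Y}) :
  #|[set S in CTXY k X Y | act_CTXY s (relabel_CTXY mu nu S) == S]| =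
  (\sum_(g | equivariant s1 mu g) \sum_(g' | equivariant s1 nu g')
    #|colored_fixed mu nu g g'|)%N.
Proof.
set fixed := [set S in CTXY k X Y | _].
pose colors (S : CTXY_data X Y) : {ffun X -> option 'I_k.+1} * {ffun Y -> option 'I_k.+1} :=
  ([ffun x => color k S (inl x)], [ffun y => color k S (inr y)]).
have fixedP S : S \in fixed -> S \in CTXY k X Y /\ act_CTXY s (relabel_CTXY mu nu S) = S.
  by rewrite in_set => /andP[-> /eqP].
rewrite pair_big -sum1_card (partition_big colors
  (fun gg => equivariant s1 mu gg.1 && equivariant s1 nu gg.2)); last first.
  move=> S /fixedP[SP fixS]; apply/andP; split; apply/forallP=> z.
    by rewrite !ffunE permE; apply/eqP; apply: (fixed_CTXY_color (inl z) SP fixS).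
  by rewrite !ffunE permE; apply/eqP; apply: (fixed_CTXY_color (inr z) SP fixS).
apply: eq_bigr => -[g g'] _; rewrite sum1_card; apply: eq_card => S.
rewrite [RHS]in_set [LHS]inE /= in_set -andbA; congr (_ && _).
rewrite andbC; congr (_ && _).
apply/eqP/forallP=> [colE|colE].
  have gE := congr1 fst colE; have gE' := congr1 snd colE; rewrite /= in gE gE'.
  by case=> z; rewrite /= -?gE -?gE' ffunE.
by congr (_, _); apply/ffunP=> z; rewrite ffunE; apply/eqP;
  [apply: (colE (inl z))|apply: (colE (inr z))].
Qed.

(** By [card_colored_fixed], the trees with given colors are counted by their
    subtrees at the representatives, and the frame transports each of these to
    a standard set of labels, where the iterates of [mu] and [nu] become the
    return permutations [p i] and [q i]. *)
Lemma framed_cycle_term (X Y : finType) (m n : option 'I_k.+1 -> nat)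
    (m_perm : forall v, m (s1 v) = m v) (n_perm : forall v, n (s1 v) = n v)
    Phi Psi (mu : {perm X}) g (nu : {perm Y}) g' p q :
    #|X| = #|{: {v : option 'I_k.+1 & 'I_(m v)}}| ->
    #|Y| = #|{: {v : option 'I_k.+1 & 'I_(n v)}}| ->
    framed rep1 m_perm Phi (box_perm p) mu g ->
    framed rep1 n_perm Psi (box_perm q) nu g' ->
  #|colored_fixed mu nu g g'| =
  (\prod_(v | rep1 v == v) fixed_of v (p v) (q v))%N.
Proof.
move=> cardX cardY frX frY.
have colX := framed_colored cardX frX; have colY := framed_colored cardY frY.
have /andP[/forallP/(_ _)/eqP g_mu /forallP/(_ _)/eqP card_g] := colX.
have /andP[/forallP/(_ _)/eqP g_nu /forallP/(_ _)/eqP card_g'] := colY.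
rewrite big_option_pred //=.
have [/andP[/eqP mN /eqP nN]|not_root] := boolP ((m None == 1%N) && (n None == 0%N)); last first.
  rewrite mul0n; apply/eqP; rewrite cards_eq0; apply/eqP/setP=> S; rewrite in_set0.
  apply/negP; rewrite in_set => /and3P[SP /forallP colS _].
  case/andP: not_root; split; apply/eqP.
    rewrite -card_g -(cards1 S.2.1); apply: eq_card => x; rewrite !inE.
    have /eqP := colS (inl x); rewrite /= => <-; rewrite color_None.
    by apply/eqP/eqP=> [[->]|->].
  rewrite -card_g'; apply: eq_card0 => y; rewrite inE.
  by have /eqP := colS (inr y); rewrite /= => <-; rewrite color_None.
rewrite mul1n.
have [x0 x0E] : exists x0, forall x, (g x == None) = (x == x0).
  have /cards1P[x0 setE] : #|[set x | g x == None]| == 1%N by rewrite card_g mN.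
  by exists x0 => x; have /setP/(_ x) := setE; rewrite !inE.
have c_None v : (joint_coloring g g' v == None) = (v == inl x0).
  case: v => [x|y] /=; first by rewrite x0E; apply/eqP/eqP=> [->|[->]].
  have := card_g' None; rewrite nN => /eqP; rewrite cards_eq0 => /eqP/setP/(_ y).
  by rewrite !inE => ->.
have c_equiv v : joint_coloring g g' (emb_vertex mu nu v) = omap s (joint_coloring g g' v).
  by case: v => z /=; rewrite ?g_mu ?g_nu permE.
rewrite /colored_fixed (card_colored_fixed reps c_None c_equiv).
apply: eq_big => [i|i /eqP ri]; first by rewrite /eq_op.
have ri1 : rep1 (Some i) = Some i by rewrite /= ri.
have [Phi_inj _ gPhi _] := framedP _ _ _ _ _ _ frX.
have [Psi_inj _ gPsi _] := framedP _ _ _ _ _ _ frY.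
pose phi (a : 'I_(m (Some i))) := Phi (Tagged (fun v => 'I_(m v)) a).
pose psi (a : 'I_(n (Some i))) := Psi (Tagged (fun v => 'I_(n v)) a).
have phi_inj : injective phi by move=> a b /Phi_inj/boxed_inj.
have psi_inj : injective psi by move=> a b /Psi_inj/boxed_inj.
have blacksE : blacks (joint_coloring g g') i = phi @: setT.
  apply/esym/eqP; rewrite eqEcard card_imset // cardsT card_ord.
  rewrite -[X in (_ <= X)%N](card_g (Some i)) leqnn andbT.
  by apply/subsetP=> _ /imsetP[a _ ->]; rewrite inE /= gPhi.
have whitesE : whites (joint_coloring g g') i = psi @: setT.
  apply/esym/eqP; rewrite eqEcard card_imset // cardsT card_ord.
  rewrite -[X in (_ <= X)%N](card_g' (Some i)) leqnn andbT.
  by apply/subsetP=> _ /imsetP[a _ ->]; rewrite inE /= gPsi.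
rewrite blacksE whitesE; apply: card_fixed_transport => // a.
  by rewrite -cycle_len_Some (framed_return reps1 frX).
by rewrite -cycle_len_Some (framed_return reps1 frY).
Qed.

Lemma cycle_sum_root N : cycle_sum N.+1 None = << ucm (inl 1%N) >>.
Proof.
rewrite /cycle_sum (bigD1 (inord 1, ord0)) //= [X in _ + X]big1 ?addr0 => [|[m n] neq_mn]; last first.
  rewrite big1 ?scaler0 // => p _; rewrite big1 // => q _.
  rewrite /cycle_term /fixed_of; case: andP => [[/eqP m1 /eqP n0]|_]; last by rewrite scale0r.
  case/eqP: neq_mn; congr (_, _); apply: val_inj; rewrite //= ?inordK //.
rewrite inordK //= invr1 scale1r.
have S1 (p : 'S_1) : p = 1%g by apply/permP=> a; rewrite [LHS]ord1 [RHS]ord1.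
have S0 (q : 'S_0) : q = 1%g by apply/permP=> -[].
rewrite (big_pred1 1%g) => [|p]; last by rewrite (S1 p) /= eqxx.
rewrite (big_pred1 1%g) => [|q]; last by rewrite (S0 q) /= eqxx.
rewrite /cycle_term scale1r cycle_len_None; congr << _ >>.
set a : 'S_1 := 1%g; set b : 'S_0 := 1%g.
have abE : cycle_monom a b = expcmn (ucm (inl 1%N)) (num_cycles a 1).
  by rewrite /cycle_monom big_nat1 big_geq // Monoid.mulm1.
have := degX_cycle_monom a b; rewrite abE /degX wgt_exp wgtU muln1 => ->.
exact: dilate_monomU.
Qed.

Lemma bihomog_cycle_sum v m n : bihomog (m * cycle_len s1 v) (n * cycle_len s1 v)
  ((m`! * n`!)%:R^-1 *: \sum_(p : 'S_m) \sum_(q : 'S_n) cycle_term v p q).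
Proof.
apply/bihomogZ/bihomog_sum => p; apply/bihomog_sum => q; apply/bihomogZ/bihomogU.
  by rewrite degX_dilate degX_cycle_monom.
by rewrite degY_dilate degY_cycle_monom.
Qed.

(** The average over the colored permutations of the degree of [e] is a sum over
    the families of sizes that add up to this degree ([equivariant_sum]); the
    expansion of the product has a term for every family of sizes, but the other
    ones have another bidegree. *)
Lemma Z_CTXY_coef e N : (degX e + degY e <= N.+1)%N ->
  Z_CTXY s e = (\prod_(v | rep1 v == v) cycle_sum N.+1 v)@_e.
Proof.
move=> degN; rewrite /Z_CTXY cycle_indexE; set a := degX e; set b := degY e.
pose V (mu : 'S_a) g (nu : 'S_b) g' : poly_ring :=
  #|colored_fixed mu nu g g'|%:R *: << cycle_monom mu nu >>.
transitivity (((a`! * b`!)%:R^-1 *: (\sum_mu \sum_(g | equivariant s1 mu g)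
    \sum_nu \sum_(g' | equivariant s1 nu g') V mu g nu g'))@_e).
  rewrite mcoeffZ; congr (_ * _); rewrite raddf_sum; apply: eq_bigr => mu _ /=.
  rewrite exchange_big /= raddf_sum; apply: eq_bigr => nu _ /=.
  rewrite card_fixed_coloring natr_sum big_distrl /= raddf_sum.
  apply: eq_bigr => g _; rewrite natr_sum big_distrl /= raddf_sum.
  by apply: eq_bigr => g' _; rewrite /= mcoeffZ mcoeffU1.
have V_framed (m n : option 'I_k.+1 -> nat) (m_perm : forall v, m (s1 v) = m v)
    (n_perm : forall v, n (s1 v) = n v) Phi Psi mu g nu g' p q :
    #|'I_a| = #|{: {v : option 'I_k.+1 & 'I_(m v)}}| ->
    #|'I_b| = #|{: {v : option 'I_k.+1 & 'I_(n v)}}| ->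
    framed (s := s1) rep1 m_perm Phi (box_perm p) mu g ->
    framed (s := s1) rep1 n_perm Psi (box_perm q) nu g' ->
    V mu g nu g' = \prod_(v | rep1 v == v) cycle_term v (p v) (q v).
  move=> cardX cardY frX frY.
  rewrite /V (framed_cycle_term cardX cardY frX frY) natr_prod scaler_prod.
  rewrite -mcoeffU_prod cycle_monomE.
  rewrite (framed_cycle_prod reps1 frX cardX (fun j => ucm (inl j) : pmonom)).
  rewrite (framed_cycle_prod reps1 frY cardY (fun j => ucm (inr j) : pmonom)).
  rewrite -big_split; congr (_ *: << _ >>); apply: eq_bigr => v _.
  by rewrite dilate_cycle_monom.
have := equivariant_sum reps1 V_framed (N := N.+1); rewrite !card_ord => -> //; first last.
- exact: leq_trans (leq_addl _ _) degN.
- exact: leq_trans (leq_addr _ _) degN.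
rewrite (big_distr_big_dep (ord0, ord0)) /= [in RHS](bigID
  (fun f : {ffun option 'I_k.+1 -> 'I_N.+2 * 'I_N.+2} =>
  (a == \sum_i (f (rep1 i)).1)%N && (b == \sum_i (f (rep1 i)).2)%N)) /=.
rewrite mcoeffD [X in _ = _ + X]raddf_sum [X in _ = _ + X]big1 ?addr0 // => f /=.
case/andP=> _; apply: contraNeq => f_e.
have [dX dY] := @bihomog_prod _ [pred v | rep1 v == v] _ _ _
  (fun v _ => @bihomog_cycle_sum v (f v).1 (f v).2) e f_e.
rewrite (sum_over_reps (fun v => (f v).1 : nat) reps1) -dX.
by rewrite (sum_over_reps (fun v => (f v).2 : nat) reps1) -dY !eqxx.
Qed.

End FixedColorings.

Section Linearizations.
Variables (k : nat) (s : 'S_k.+1) (lin : {set 'I_k.+1} -> seq 'I_k.+1).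
Hypothesis hlin : forall c, c \in porbits s -> linearizes s c (lin c).

Definition lin_rep i := head i (lin (porbit s i)).

Let lin_porbit i : linearizes s (porbit s i) (lin (porbit s i)).
Proof. by apply: hlin; apply: imset_f. Qed.

Lemma lin_traject i : lin (porbit s i) = traject s (lin_rep i) (cycle_len s i).
Proof.
rewrite /lin_rep /cycle_len; have [uniq_l l_orb cyc_l] := lin_porbit i.
have -> : #|porbit s i| = size (lin (porbit s i)).
  by rewrite -(eq_card l_orb); apply/card_uniqP.
have := l_orb i; rewrite porbit_id.
by case: (lin _) uniq_l cyc_l {l_orb} => // j l _ /fcycle_consE.
Qed.

Lemma lin_reps : cycle_reps s lin_rep.
Proof.
split=> [i|i j /[dup] ij]; have [_ l_orb _] := lin_porbit i; have := l_orb i;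
  rewrite porbit_id /lin_rep.
  by case: (lin _) l_orb => //= j l l_orb _; rewrite -l_orb mem_head.
by rewrite -eq_porbit_mem in ij; rewrite (eqP ij); case: (lin _).
Qed.

End Linearizations.


Theorem theorem5p6 (k : nat) (hk : (1 <= k)%N) (sigma : 'S_k.+1)
    (lin : {set 'I_k.+1} -> seq 'I_k.+1)
    (hlin : forall c, c \in porbits sigma -> linearizes sigma c (lin c)) :
  Z_CTXY sigma =
  mul_series (monom_series (ucm (inl 1%N)))
    (\big[mul_series/monom_series mone]_(c in porbits sigma)
       dilate #|c| (Z_CTY (rho_prod sigma (lin c)))).
Proof.
have reps := lin_reps hlin; set rep := lin_rep sigma lin in reps.
apply/funext=> e; have [N degN] : exists N, (degX e + degY e <= N.+1)%N.
  by exists (degX e + degY e)%N.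
rewrite (Z_CTXY_coef reps degN) big_option_pred; last by [].
rewrite cycle_sum_root.
pose U c : {malg rat[pmonom]} := (\sum_(mn : 'I_N.+2 * 'I_N.+2)
  ((mn.1`! * mn.2`!)%:R^-1 *: \sum_(p : 'S_mn.1) \sum_(q : 'S_mn.2)
    (#|[set W in CTY k 'I_mn.1 'I_mn.2
          | act_CTY (rho_prod sigma (lin c)) (relabel_CTY p q W) == W]|%:R *:
     << dilate_monom #|c| (cycle_monom p q) >>)))%R.
have agreeU c : c \in porbits sigma ->
    agree N.+1 (dilate #|c| (Z_CTY (rho_prod sigma (lin c)))) (U c).
  case/imsetP=> i _ cE; apply: (agree_dilate (fix_of := fun m n p q => #|[set W in CTY k 'I_m 'I_n
          | act_CTY (rho_prod sigma (lin c)) (relabel_CTY p q W) == W]|)).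
    by rewrite cE; apply: cycle_len_gt0.
  by move=> e'; rewrite /Z_CTY cycle_indexE.
have := mul_seriesE (@agree_monom N.+1 (ucm (inl 1%N))) (agree_prod agreeU).
move/(_ e degN) => ->; congr (mcoeff _ (_ * _)%R).
pose rep_of (c : {set 'I_k.+1}) := if [pick i in c] is Some i then rep i else ord0.
have rep_ofE i : rep_of (porbit sigma i) = rep i.
  rewrite /rep_of; case: pickP => [j /(reps.2 i) //|/(_ i)].
  by rewrite porbit_id.
rewrite [RHS](reindex_onto (porbit sigma) rep_of) => [|_ /imsetP[i _ ->]]; last first.
  by rewrite rep_ofE (porbit_rep reps).
have termE i : rep i = i -> U (porbit sigma i) = cycle_sum sigma N.+1 (Some i).
  move=> ri.
  apply: eq_bigr => mn _.
  apply: (congr1 (fun u => _ *: u)%R).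
  apply: eq_bigr => p _.
  apply: eq_bigr => q _.
  rewrite /cycle_term cycle_len_Some.
  by rewrite (lin_traject hlin) -/rep ri.
apply: eq_big => [i|i ri]; first by rewrite rep_ofE imset_f // andTb.
by rewrite termE //; apply: Some_inj; apply/eqP.
Qed.
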